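(* Let $(Y,\lambda)$ be a standard Borel space equipped with a non-atomic $\sigma$-finite infinite Borel measure $\lambda$. Then the Polish group $\mathrm{Aut}(Y,\lambda)$, equipped with the weak topology, has the automatic continuity property.
   Context: $\mathrm{Aut}(Y,\lambda)$ is the group of all Borel bijections $T:Y\to Y$ such that $\lambda(T^{-1}(A))=\lambda(A)$ for all Borel $A\subseteq Y$, two such bijections being identified if they coincide on a conull set. The weak topology on $\mathrm{Aut}(Y,\lambda)$ is the topology in which $T_n\to T$ if and only if $\lambda(T_n(A)\bigtriangleup T(A))\to 0$ for every Borel $A\subseteq Y$ with $\lambda(A)<+\infty$; it is a Polish group topology. A Polish group $G$ has the automatic continuity property if every group homomorphism $\pi:G\to H$ into a separable topological group $H$ is continuous. *)

(* Defs.v *)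
From HB Require Import structures.
From mathcomp Require Import all_boot all_order all_algebra.
From mathcomp Require Import all_classical all_reals all_analysis.

Set Implicit Arguments.
Unset Strict Implicit.
Unset Printing Implicit Defensive.

Import Order.TTheory GRing.Theory Num.Theory.
Local Open Scope classical_set_scope.
Local Open Scope ring_scope.
Local Open Scope group_scope.

(* No Hausdorff axiom. *)
HB.mixin Record isTopologicalGroup G & Topological G & Group G := {
  mulg_continuous : continuous (fun x : G * G => x.1 * x.2);
  invg_continuous : continuous (fun x : G => x^-1)
}.

#[short(type="topologicalGroupType")]
HB.structure Definition TopologicalGroup :=
  {G of Topological G & Group G & isTopologicalGroup G}.

Definition separable_space (X : topologicalType) : Prop :=
  exists2 D : set X, countable D & dense D.

Definition automatic_continuity (G : topologicalGroupType) : Prop :=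
  forall H : topologicalGroupType, separable_space H ->
  forall pi : G -> H, {morph pi : x y / x * y} -> continuous pi.

(* Y is Borel isomorphic to a Polish space X. *)
Definition standard_borel (R : realType) (d : measure_display)
    (Y : measurableType d) : Prop :=
  exists (X : completePseudoMetricType R) (f : X -> Y),
    [/\ hausdorff_space X, separable_space X, bijective f &
      forall A : set Y, measurable A <-> <<s open >> (f @^-1` A)].

Definition nonatomic (R : realType) (d : measure_display)
    (Y : measurableType d) (lambda : set Y -> \bar R) : Prop :=
  forall A : set Y, measurable A -> (0 < lambda A)%E ->
  exists B : set Y, [/\ measurable B, B `<=` A, (0 < lambda B)%E &
                        (lambda B < lambda A)%E].

Section Aut.
Context (R : realType) (d : measure_display) (Y : measurableType d).
Variable lambda : {measure set Y -> \bar R}.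

(* On a standard Borel space, mpb_image_measurable follows from the injectivity
   and measurability of the map, by the Lusin-Souslin theorem. *)
Record mp_bijection := MpBijection {
  mpb_fun :> Y -> Y;
  mpb_bij : bijective mpb_fun;
  mpb_measurable : measurable_fun setT mpb_fun;
  mpb_image_measurable : forall A, measurable A -> measurable (mpb_fun @` A);
  mpb_preserving : forall A, measurable A -> lambda (mpb_fun @^-1` A) = lambda A
}.

HB.instance Definition _ := gen_eqMixin mp_bijection.
HB.instance Definition _ := gen_choiceMixin mp_bijection.

Implicit Types S T U : mp_bijection.

Definition mpb_inv_fun T : Y -> Y :=
  projT1 (cid (let: Bijective g fK gK := mpb_bij T in
    ex_intro (fun g => cancel T g /\ cancel g T) g (conj fK gK))).

Lemma mpb_funK T : cancel T (mpb_inv_fun T).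
Proof. by rewrite /mpb_inv_fun; case: cid => g []. Qed.

Lemma mpb_inv_funK T : cancel (mpb_inv_fun T) T.
Proof. by rewrite /mpb_inv_fun; case: cid => g []. Qed.

Lemma mpb_preimage_inv T A : mpb_inv_fun T @^-1` A = T @` A.
Proof.
apply/seteqP; split=> y /=; first by move=> Ay; exists (mpb_inv_fun T y) => //;
  rewrite mpb_inv_funK.
by case=> x Ax <-; rewrite mpb_funK.
Qed.

Lemma mpb_image_inv T A : mpb_inv_fun T @` A = T @^-1` A.
Proof.
apply/seteqP; split=> y /=; first by case=> x Ax <-; rewrite mpb_inv_funK.
by move=> Ay; exists (T y) => //; rewrite mpb_funK.
Qed.

Lemma mpb_preimage_measurable T A : measurable A -> measurable (T @^-1` A).
Proof.
by move=> mA; rewrite -[X in measurable X]setTI; exact: mpb_measurable.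
Qed.

Lemma mpb_preservingV T A : measurable A -> lambda (T @` A) = lambda A.
Proof.
move=> mA; rewrite -(mpb_preserving T); last exact: mpb_image_measurable.
congr (lambda _); apply/seteqP; split=> y /=; last by move=> Ay; exists y.
by case=> x Ax /(bij_inj (mpb_bij T)) <-.
Qed.

Fact mpb_one_bij : bijective (@idfun Y).
Proof. by exists idfun. Qed.

Fact mpb_one_image A : measurable A -> measurable (@idfun Y @` A).
Proof. by rewrite image_id. Qed.

Definition mpb_one : mp_bijection :=
  MpBijection mpb_one_bij (@measurable_id _ Y setT) mpb_one_image
    (fun A _ => erefl).

Fact mpb_mul_bij S T : bijective (S \o T).
Proof. by apply: bij_comp; exact: mpb_bij. Qed.

Fact mpb_mul_measurable S T : measurable_fun setT (S \o T).
Proof. by apply: measurableT_comp; exact: mpb_measurable. Qed.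

Fact mpb_mul_image S T A : measurable A -> measurable ((S \o T) @` A).
Proof. by move=> mA; rewrite -image_comp; do 2!apply: mpb_image_measurable. Qed.

Fact mpb_mul_preserving S T A :
  measurable A -> lambda ((S \o T) @^-1` A) = lambda A.
Proof.
move=> mA; rewrite comp_preimage !mpb_preserving//.
exact: mpb_preimage_measurable.
Qed.

Definition mpb_mul S T : mp_bijection :=
  MpBijection (mpb_mul_bij S T) (mpb_mul_measurable S T) (@mpb_mul_image S T)
    (@mpb_mul_preserving S T).

Fact mpb_inv_bij T : bijective (mpb_inv_fun T).
Proof. by exists T; [exact: mpb_inv_funK|exact: mpb_funK]. Qed.

Fact mpb_inv_measurable T : measurable_fun setT (mpb_inv_fun T).
Proof.
by move=> _ A mA; rewrite setTI mpb_preimage_inv; exact: mpb_image_measurable.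
Qed.

Fact mpb_inv_image T A : measurable A -> measurable (mpb_inv_fun T @` A).
Proof.
by move=> mA; rewrite mpb_image_inv; exact: mpb_preimage_measurable.
Qed.

Fact mpb_inv_preserving T A :
  measurable A -> lambda (mpb_inv_fun T @^-1` A) = lambda A.
Proof. by move=> mA; rewrite mpb_preimage_inv mpb_preservingV. Qed.

Definition mpb_inv T : mp_bijection :=
  MpBijection (mpb_inv_bij T) (mpb_inv_measurable T) (@mpb_inv_image T)
    (@mpb_inv_preserving T).

Definition mpb_ae_eq S T : bool := `[< S = T %[ae lambda] >].

Lemma mpb_ae_eq_refl : reflexive mpb_ae_eq.
Proof. by move=> S; apply/asboolP; exact: aeW. Qed.

Lemma mpb_ae_eq_sym : symmetric mpb_ae_eq.
Proof.
by move=> S T; apply/idP/idP => /asboolP h; apply/asboolP/ae_eq_sym.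
Qed.

Lemma mpb_ae_eq_trans : transitive mpb_ae_eq.
Proof.
by move=> S T U /asboolP TS /asboolP SU; apply/asboolP/(ae_eq_trans TS SU).
Qed.

Canonical mpb_ae_eq_equiv :=
  EquivRel mpb_ae_eq mpb_ae_eq_refl mpb_ae_eq_sym mpb_ae_eq_trans.

Local Open Scope quotient_scope.

Definition Aut : Type := {eq_quot mpb_ae_eq}.
HB.instance Definition _ := Choice.on Aut.
HB.instance Definition _ := EqQuotient.on Aut.

(* Values of a chosen representative of the class. *)
Definition Aut_fun (T : Aut) : mp_bijection := repr T.
Coercion Aut_fun : Aut >-> mp_bijection.

Lemma Aut_eqP S T : S = T %[ae lambda] <-> \pi_Aut S = \pi_Aut T.
Proof.
by split=> [h|/eqquotP/asboolP//]; apply/eqquotP/asboolP.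
Qed.

Lemma mpb_ae_eqP S T : S = T %[ae lambda] <->
  exists M, [/\ measurable M, lambda M = 0%E & forall x, ~ M x -> S x = T x].
Proof.
split.
  case=> M [mM M0 h]; exists M; split=> // x nMx.
  by apply: contrapT => hx; apply/nMx/h => /(_ Logic.I).
case=> M [mM M0 h]; exists M; split=> // x /= hx.
by apply: contrapT => nMx; apply: hx => _; exact: h.
Qed.

Lemma Aut_funK S : (\pi_Aut S : Aut) = S %[ae lambda].
Proof. by apply/Aut_eqP; rewrite reprK. Qed.

Definition Aut_one : Aut := \pi_Aut mpb_one.
Definition Aut_mul (S T : Aut) : Aut := \pi_Aut (mpb_mul S T).
Definition Aut_inv (T : Aut) : Aut := \pi_Aut (mpb_inv T).

Lemma mpb_mul_ae_eq S S' T T' : S = S' %[ae lambda] -> T = T' %[ae lambda] ->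
  mpb_mul S T = mpb_mul S' T' %[ae lambda].
Proof.
move=> /mpb_ae_eqP[M [mM M0 SM]] /mpb_ae_eqP[N [mN N0 TN]]; apply/mpb_ae_eqP.
have mTM := mpb_preimage_measurable T mM.
exists (T @^-1` M `|` N); split; first exact: measurableU.
  by apply: null_set_setU => //; rewrite mpb_preserving.
move=> x /not_orP[/= Mx Nx]; rewrite -TN//; exact: SM.
Qed.

Lemma mpb_inv_ae_eq T T' : T = T' %[ae lambda] ->
  mpb_inv T = mpb_inv T' %[ae lambda].
Proof.
move=> /mpb_ae_eqP[M [mM M0 TM]]; apply/mpb_ae_eqP.
exists (T @` M); split; first exact: mpb_image_measurable.
  by rewrite mpb_preservingV.
move=> y nTMy /=; apply: (bij_inj (mpb_bij T')); rewrite mpb_inv_funK -TM.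
  by rewrite mpb_inv_funK.
by move=> My; apply: nTMy; exists (mpb_inv_fun T y) => //; rewrite mpb_inv_funK.
Qed.

Lemma Aut_mulE S T : Aut_mul (\pi_Aut S) (\pi_Aut T) = \pi_Aut (mpb_mul S T).
Proof. by apply/Aut_eqP; apply: mpb_mul_ae_eq; exact: Aut_funK. Qed.

Lemma Aut_invE T : Aut_inv (\pi_Aut T) = \pi_Aut (mpb_inv T).
Proof. by apply/Aut_eqP; apply: mpb_inv_ae_eq; exact: Aut_funK. Qed.

Fact Aut_mulA : associative Aut_mul.
Proof.
elim/quotW=> S; elim/quotW=> T; elim/quotW=> U.
rewrite (Aut_mulE T U) (Aut_mulE S T) (Aut_mulE S) (Aut_mulE _ U).
by apply/Aut_eqP; exact: aeW.
Qed.

Fact Aut_mul1g : left_id Aut_one Aut_mul.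
Proof. by elim/quotW=> T; rewrite Aut_mulE; apply/Aut_eqP; exact: aeW. Qed.

Fact Aut_mulg1 : right_id Aut_one Aut_mul.
Proof. by elim/quotW=> T; rewrite Aut_mulE; apply/Aut_eqP; exact: aeW. Qed.

Fact Aut_mulVg : left_inverse Aut_one Aut_inv Aut_mul.
Proof.
elim/quotW=> T; rewrite Aut_invE Aut_mulE; apply/Aut_eqP; apply: aeW => x _ /=.
exact: mpb_funK.
Qed.

Fact Aut_mulgV : right_inverse Aut_one Aut_inv Aut_mul.
Proof.
elim/quotW=> T; rewrite Aut_invE Aut_mulE; apply/Aut_eqP; apply: aeW => x _ /=.
exact: mpb_inv_funK.
Qed.

HB.instance Definition _ :=
  isGroup.Build Aut Aut_mulA Aut_mul1g Aut_mulg1 Aut_mulVg Aut_mulgV.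

Definition finite_measurable (A : set Y) : Prop :=
  measurable A /\ (lambda A < +oo)%E.

(* The neighborhoods of T are generated by the finite intersections of the sets
   {S | lambda (S(A) `+` T(A)) < e} with lambda A < +oo; see Aut_cvgP. *)
Definition Aut_ball (T : Aut) (i : seq (set Y) * R) : set Aut :=
  [set S : Aut | forall A, A \in i.1 ->
                   (lambda (S @` A `+` T @` A) < i.2%:E)%E].

Definition Aut_nbhs (T : Aut) : set_system Aut :=
  filter_from [set i : seq (set Y) * R |
    (forall A, A \in i.1 -> finite_measurable A) /\ (0 < i.2)%R] (Aut_ball T).

HB.instance Definition _ := hasNbhs.Build Aut Aut_nbhs.

Lemma measurable_setY (A B : set Y) :
  measurable A -> measurable B -> measurable (A `+` B).
Proof.
by move=> mA mB; rewrite setY_def; apply: measurableU; exact: measurableD.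
Qed.

Lemma measureY_triangle (A B C : set Y) :
  measurable A -> measurable B -> measurable C ->
  (lambda (A `+` C) <= lambda (A `+` B) + lambda (B `+` C))%E.
Proof.
move=> mA mB mC; apply: (@le_trans _ _ (lambda ((A `+` B) `|` (B `+` C)))).
  apply: le_measure; rewrite ?inE; [exact: measurable_setY| |].
    by apply: measurableU; exact: measurable_setY.
  by move=> x /=; have [] := pselect (B x); tauto.
by apply: measureU2; exact: measurable_setY.
Qed.

Lemma Aut_imageY_triangle S T U A : measurable A ->
  (lambda (S @` A `+` U @` A) <=
   lambda (S @` A `+` T @` A) + lambda (T @` A `+` U @` A))%E.
Proof.
by move=> mA; apply: measureY_triangle; exact: mpb_image_measurable.
Qed.

Lemma mpb_image_ae_eq S T A : measurable A -> S = T %[ae lambda] ->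
  lambda (S @` A `+` T @` A) = 0%E.
Proof.
move=> mA /mpb_ae_eqP[M [mM M0 h]].
have mI U := mpb_image_measurable U mM.
apply: (@subset_measure0 _ _ _ _ _ (S @` M `|` T @` M)).
- by apply: measurable_setY; exact: mpb_image_measurable.
- exact: measurableU.
- move=> y /= [[[x Ax <-] nT]|[[x Ax <-] nS]].
    left; exists x => //; apply: contrapT => nMx; apply: nT.
    by exists x => //; rewrite h.
  right; exists x => //; apply: contrapT => nMx; apply: nS.
  by exists x => //; rewrite h.
- by apply: null_set_setU; rewrite ?mpb_preservingV.
Qed.


Lemma mpb_imageY T A B : measurable A -> measurable B ->
  lambda (T @` A `+` T @` B) = lambda (A `+` B).
Proof.
move=> mA mB; rewrite -!mpb_preimage_inv.
apply: (mpb_inv_preserving T (A := A `+` B)).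
exact: measurable_setY.
Qed.

Fact Aut_nbhs_filter (T : Aut) : ProperFilter (Aut_nbhs T).
Proof.
apply: filter_from_proper; last first.
  by move=> [s e] [/= _ e0]; exists T => A _; rewrite setYK measure0 lte_fin.
apply: filter_from_filter; first by exists ([::], 1%R); split => //=.
move=> [s e] [s' e'] [/= hs e0] [/= hs' e'0].
exists (s ++ s', Num.min e e'); first split => /=.
- by move=> A; rewrite mem_cat => /orP[/hs|/hs'].
- by rewrite lt_min e0.
- move=> S hS; split=> A /= Ain.
    have /hS/lt_le_trans : A \in (s ++ s', Num.min e e').1.
      by rewrite mem_cat Ain.
    by apply; rewrite lee_fin ge_min lexx.
  have /hS/lt_le_trans : A \in (s ++ s', Num.min e e').1.
    by rewrite mem_cat Ain orbT.
  by apply; rewrite lee_fin ge_min lexx orbT.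
Qed.

Fact Aut_nbhs_singleton (T : Aut) (U : set Aut) : Aut_nbhs T U -> U T.
Proof.
move=> [[s e] [/= _ e0]]; apply => A _ /=.
by rewrite setYK measure0 lte_fin.
Qed.

Fact Aut_nbhs_nbhs (T : Aut) (U : set Aut) :
  Aut_nbhs T U -> Aut_nbhs T (Aut_nbhs^~ U).
Proof.
move=> [[s e] [/= hs e0] sU]; exists (s, (e / 2)%R).
  by split => //=; rewrite divr_gt0.
move=> S hS; exists (s, (e / 2)%R); first by split => //=; rewrite divr_gt0.
move=> V hV; apply: sU => A /= As.
apply: (le_lt_trans (Aut_imageY_triangle V S T (hs A As).1)).
rewrite [e]splitr EFinD; apply: lteD; [exact: hV|exact: hS].
Qed.

HB.instance Definition _ := Nbhs_isNbhsTopological.Build Aut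
  Aut_nbhs_filter Aut_nbhs_singleton Aut_nbhs_nbhs.

Lemma Aut_cvg_ltP (F : set_system Aut) (T : Aut) : Filter F ->
  F --> T <-> forall A, finite_measurable A -> forall e : R, (0 < e)%R ->
    {near F, forall S : Aut, (lambda (S @` A `+` T @` A) < e%:E)%E}.
Proof.
move=> FF; split=> [FT A fA e e0|h].
  apply: FT; exists ([:: A], e); first by split=> //= B; rewrite inE => /eqP ->.
  by move=> S /(_ A); apply; rewrite /= inE.
move=> U [[s e] [/= hs e0] sU]; apply: filterS sU _.
elim: s hs => [|A s ih] hs.
  by apply: filterE => S A.
have fs : F (Aut_ball T (s, e)).
  by apply: ih => B Bs; apply: hs; rewrite inE Bs orbT.
have fA : F [set S : Aut | (lambda (S @` A `+` T @` A) < e%:E)%E].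
  by apply: h => //; apply: hs; rewrite inE eqxx.
apply: filterS2 fs fA => S hs' hA B /=; rewrite inE => /orP[/eqP ->//|].
exact: hs'.
Qed.

Lemma Aut_cvgP (F : set_system Aut) (T : Aut) : Filter F ->
  F --> T <-> forall A, measurable A -> (lambda A < +oo)%E ->
    (fun S : Aut => lambda (S @` A `+` T @` A)) @ F --> 0%E.
Proof.
move=> FF; rewrite Aut_cvg_ltP; split=> [h A mA fA|h A [mA fA] e e0].
  apply/fine_cvgP; split.
    apply: filterS (h A (conj mA fA) 1%R ltr01) => S hS.
    by rewrite ge0_fin_numE//; apply: lt_trans hS _; rewrite ltry.
  apply/cvgrPdist_lt => e e0; apply: filterS (h A (conj mA fA) e e0) => S hS /=.
  rewrite sub0r normrN ger0_norm ?fine_ge0// -lte_fin fineK//.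
  by rewrite ge0_fin_numE//; apply: lt_trans hS _; rewrite ltry.
have /fine_cvgP[ffin /cvgrPdist_lt/(_ _ e0) fe] := h A mA fA.
apply: filterS2 ffin fe => S Sfin /=.
by rewrite sub0r normrN ger0_norm ?fine_ge0// -lte_fin fineK.
Qed.

Lemma mpb_image_mul S T A : mpb_mul S T @` A = S @` (T @` A).
Proof. by rewrite -image_comp. Qed.

Fact Aut_mulg_continuous : continuous (fun x : Aut * Aut => x.1 * x.2).
Proof.
suff cvgM (S T : Aut) :
    (fun x : Aut * Aut => x.1 * x.2 : Aut) @ (S, T) --> S * T.
  by case=> S T; exact: cvgM.
apply/Aut_cvg_ltP => A [mA fA] e e0.
have e20 : (0 < e / 2)%R by rewrite divr_gt0.
have mTA := mpb_image_measurable T mA.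
have nT : nbhs T (Aut_ball T ([:: A], (e / 2)%R)).
  by exists ([:: A], (e / 2)%R) => //; split=> //= B; rewrite inE => /eqP ->.
have nS : nbhs S (Aut_ball S ([:: T @` A], (e / 2)%R)).
  exists ([:: T @` A], (e / 2)%R) => //; split=> //= B; rewrite inE => /eqP ->.
  by split=> //; rewrite mpb_preservingV.
exists (Aut_ball S ([:: T @` A], (e / 2)%R),
        Aut_ball T ([:: A], (e / 2)%R)) => //.
move=> [S' T'] [/= hS hT].
have {}hS := hS (T @` A) (mem_head _ _).
have {}hT := hT A (mem_head _ _).
have ae0 (V W : Aut) : lambda ((V * W : Aut) @` A `+` mpb_mul V W @` A) = 0%E.
  by apply: mpb_image_ae_eq => //; exact: Aut_funK.
apply: (le_lt_trans (Aut_imageY_triangle _ (mpb_mul S' T') _ mA)).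
rewrite ae0 add0e.
apply: (le_lt_trans (Aut_imageY_triangle _ (mpb_mul S T) _ mA)).
rewrite [X in (_ + lambda X)%E]setYC ae0 adde0 !mpb_image_mul.
apply: (le_lt_trans (measureY_triangle (B := S' @` (T @` A)) _ _ _));
  do ?[apply: mpb_image_measurable]; rewrite //.
rewrite mpb_imageY//; last exact: mpb_image_measurable.
by rewrite [e]splitr EFinD; exact: lteD.
Qed.

Fact Aut_invg_continuous : continuous (fun T : Aut => T^-1).
Proof.
suff cvgV (T : Aut) : (fun S : Aut => S^-1 : Aut) @ T --> T^-1.
  by move=> T; exact: cvgV.
have FT : Filter ((fun S : Aut => S^-1 : Aut) @ T).
  by apply: fmap_filter; exact: nbhs_filter.
apply/Aut_cvg_ltP => A [mA fA] e e0.
pose B := mpb_inv_fun T @` A.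
have mB : measurable B by exact: mpb_inv_image.
exists ([:: B], e).
  split=> //= C; rewrite inE => /eqP ->; split=> //.
  by rewrite /B (mpb_preservingV (mpb_inv T)).
move=> S /(_ B (mem_head _ _)) /= hS.
have ae0 (V : Aut) : lambda ((V^-1%g : Aut) @` A `+` mpb_inv V @` A) = 0%E.
  by apply: mpb_image_ae_eq => //; exact: Aut_funK.
apply: (le_lt_trans (Aut_imageY_triangle _ (mpb_inv S) _ mA)).
rewrite ae0 add0e.
apply: (le_lt_trans (Aut_imageY_triangle _ (mpb_inv T) _ mA)).
rewrite [X in (_ + lambda X)%E]setYC ae0 adde0.
rewrite -(mpb_imageY S)//; try exact: mpb_inv_image.
have imK (V : mp_bijection) : V @` (mpb_inv_fun V @` A) = A.
  rewrite mpb_image_inv image_preimage//.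
  apply/seteqP; split=> // y _; exists (mpb_inv_fun V y) => //.
  exact: mpb_inv_funK.
by rewrite imK setYC -[X in _ `+` X](imK T).
Qed.

HB.instance Definition _ :=
  isTopologicalGroup.Build Aut Aut_mulg_continuous Aut_invg_continuous.

End Aut.

(* Main.v *)
From HB Require Import structures.
Require Import Defs.
From mathcomp Require Import all_boot all_order all_algebra.
From mathcomp Require Import all_classical all_reals all_analysis.
From mathcomp Require Import measurable_realfun zify lra ring.

(* A symmetric set W is called syndetic if countably many left translates of W
   cover the group.  If pi : G -> H is a homomorphism into a separable group and
   V is a symmetric neighbourhood of 1 in H, then pi^-1(V^2) is syndetic, so it
   is enough to show that W^108 is a neighbourhood of 1 whenever W is a syndetic
   subset of G = Aut(Y, lambda).

   A diagonal argument over a sequence of disjoint sets of infinite measure,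
   followed by a commutator trick with an infinite shift, gives a set B of
   infinite measure such that W^8 contains every element supported on B.  Moving
   sets into B in continuum many ways, and using the pigeonhole principle, one
   finds that W^28 contains the elements whose support has measure < eps, and
   that W^40 contains those supported on the complement of some set Z of finite
   measure.

   On Z, identified with an interval cut into dyadic cells, call an automorphism
   tame if it and its inverse are continuous for the topology generated by the
   cells.  A back-and-forth game builds two generic sequences (x_i), (s_i) and a
   limit T with T s_i T^-1 = x_i; if x_i could always be chosen outside
   {t s_i t^-1 | t in W k_i^-1}, no translate of W could contain T.  So at
   some stage all generic conjugates of some s are obtained from a single
   translate of W; by Baire category arguments W^12 contains every tame
   automorphism fixing the cells of some level.  Tame automorphisms
   are dense, whence W^40 contains every automorphism of Z fixing these cells.
   Finally, an automorphism close to 1 is the product of one with a small support,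
   one of Z fixing the cells, and one supported outside of Z. *)

Set Implicit Arguments.
Unset Strict Implicit.
Unset Printing Implicit Defensive.

(** * Balanced maps between dyadic levels *)

(** A syndetic set has no regularity: [W] need not have the Baire property, and all that is known is
    a countable cover by translates. Category arguments therefore never bear on [W] itself. Each
    step builds more candidates than the translates can tell apart (a diagonal family, a continuum
    of binary sequences, the limit of a game) and keeps a quotient of two elements of one translate,
    an element of [pw W 2]. The same obstacle explains the tame automorphisms. Generic elements must
    be built by hand, from finite conditions of which there are countably many; a general
    automorphism of [Z] is given by no coherent system of finite maps between cells, while a tame
    one is. The error of a tame approximation has small support and is absorbed separately. The
    exponents add up as follows. Commutator: 8 = 2 + 2 + 2 + 2. Conjugation into [B]: 12 = 2 + 8 +
    2, then 28 = 8 + 12 + 8 without disjointness from [B]. Complement of [Z]: 40 = 8 + 12 + 8 + 12.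
    Tame elements: 12 = 6 + 6, with 6 = 2 + 2 + 2 for one generic element. Elements of [Z] fixing
    the cells: 40 = 12 + 28. In all, 108 = 28 + 40 + 40. *)

Definition prj n m x := x %/ 2 ^ (n - m).

Definition bal n m (f : nat -> nat) :=
  (m <= n) /\ perm_eq (map f (iota 0 (2 ^ n))) (map (prj n m) (iota 0 (2 ^ n))).

Definition eqn_on n (f g : nat -> nat) := forall x, x < 2 ^ n -> f x = g x.

Lemma count_const T (b : bool) (s : seq T) : count (fun=> b) s = b * size s.
Proof. by elim: s => [|_ s /= ->]; case: b => //=; rewrite !mul1n. Qed.

Lemma count_divn (p : pred nat) (h : nat -> nat) k q :
  count p (map (fun x => h (x %/ k)) (iota 0 (k * q))) = k * count p (map h (iota 0 q)).
Proof.
case: k => [//|k]; elim: q => [|q ih]; first by rewrite !muln0.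
have -> : k.+1 * q.+1 = k.+1 * q + k.+1 by lia.
rewrite iotaD map_cat count_cat ih -[q.+1 in RHS]addn1 iotaD map_cat count_cat mulnDr.
congr (_ + _); rewrite !add0n /= addn0 count_map.
rewrite -[LHS]/(count _ (iota (k.+1 * q) k.+1)).
rewrite (@eq_in_count _ _ (fun=> p (h q))); last first.
  move=> x; rewrite mem_iota => /andP[x1 x2] /=; congr (p (h _)).
  by rewrite -(subnKC x1) mulnC divnMDl// divn_small ?addn0//; lia.
by rewrite count_const size_iota mulnC.
Qed.

Lemma prj_id n x : prj n n x = x.
Proof. by rewrite /prj subnn divn1. Qed.

Lemma prj_lt n m x : m <= n -> x < 2 ^ n -> prj n m x < 2 ^ m.
Proof.
by move=> mn xn; rewrite /prj ltn_divLR ?expn_gt0// -expnD addnC subnK.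
Qed.

Lemma prj_prj n m l x : l <= m -> m <= n -> prj m l (prj n m x) = prj n l x.
Proof.
move=> lm mn; rewrite /prj -divnMA -expnD; congr (_ %/ 2 ^ _); lia.
Qed.

Lemma count_prj (p : pred nat) (h : nat -> nat) n m : m <= n ->
  count p (map (fun x => h (prj n m x)) (iota 0 (2 ^ n))) =
  2 ^ (n - m) * count p (map h (iota 0 (2 ^ m))).
Proof.
by move=> mn; rewrite -count_divn -expnD subnK.
Qed.

Lemma perm_map_prj (h h' : nat -> nat) n m : m <= n ->
  perm_eq (map h (iota 0 (2 ^ m))) (map h' (iota 0 (2 ^ m))) ->
  perm_eq (map (fun x => h (prj n m x)) (iota 0 (2 ^ n)))
          (map (fun x => h' (prj n m x)) (iota 0 (2 ^ n))).
Proof.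
by move=> mn /permP h1; apply/permP => p; rewrite !count_prj// h1.
Qed.

Lemma mem_map_iota (f : nat -> nat) n x : x < n -> f x \in map f (iota 0 n).
Proof. by move=> xn; apply: map_f; rewrite mem_iota. Qed.

Lemma bal_lt n m f x : bal n m f -> x < 2 ^ n -> f x < 2 ^ m.
Proof.
move=> [mn /perm_mem E] /(mem_map_iota f); rewrite E => /mapP[y].
by rewrite mem_iota => /andP[_ yn] ->; exact: prj_lt.
Qed.

Lemma bal_prj n m : m <= n -> bal n m (prj n m).
Proof. by move=> mn; split. Qed.

Lemma bal_id n : bal n n id.
Proof. by split => //; apply/permP => p; congr count; apply: eq_map => x; rewrite prj_id. Qed.

Lemma eq_bal n m f g : eqn_on n f g -> bal n m f -> bal n m g.
Proof.
move=> fg [mn h]; split => //.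
rewrite (_ : map g _ = map f (iota 0 (2 ^ n)))//; apply/eq_in_map => x.
by rewrite mem_iota => /andP[_ /fg].
Qed.

Lemma bal_comp n m l f g : bal n m f -> bal m l g -> bal n l (g \o f).
Proof.
move=> [mn hf] [lm hg]; split; first exact: leq_trans mn.
rewrite map_comp; apply: (perm_trans (perm_map g hf)); rewrite -map_comp.
apply: (perm_trans (perm_map_prj mn hg)).
by apply/permP => p; congr count; apply: eq_map => x; rewrite prj_prj.
Qed.

Lemma bal_count n m f y : bal n m f ->
  count (fun x => f x == y) (iota 0 (2 ^ n)) = 2 ^ (n - m) * (y < 2 ^ m).
Proof.
move=> [mn /permP/(_ (pred1 y))]; rewrite count_map => h.
rewrite (eq_count (a2 := preim f (pred1 y)))// h.
rewrite (count_prj (pred1 y) id mn) map_id; congr (_ * _).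
by rewrite count_uniq_mem ?iota_uniq// mem_iota.
Qed.

Lemma bal_of_count n m f : m <= n -> (forall y,
  count (fun x => f x == y) (iota 0 (2 ^ n)) = 2 ^ (n - m) * (y < 2 ^ m)) -> bal n m f.
Proof.
move=> mn h; split => //; apply/allP => y _ /=; apply/eqP.
rewrite !count_map (eq_count (a2 := fun x => f x == y))// h.
by rewrite (eq_count (a2 := fun x => prj n m x == y))// (bal_count _ (bal_prj mn)).
Qed.

(** On level [n], [f] and [g \o prj n l] take every value equally often, so a permutation of the
    level turns one into the other; followed by [prj n l] it is the lift. *)
Lemma bal_lift n m l f g : bal n m f -> bal l m g -> l <= n ->
  exists2 h, bal n l h & eqn_on n (g \o h) f.
Proof.
move=> hf hg ln.
have [mn pf] := hf.
have [_ pg] := bal_comp (bal_prj ln) hg.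
have : perm_eq (map f (iota 0 (2 ^ n))) (map (g \o prj n l) (iota 0 (2 ^ n))).
  by apply: (perm_trans pf); rewrite perm_sym.
move=> /(perm_iotaP (g 0))[Is]; rewrite size_map size_iota => pIs E.
pose h0 i := nth 0 Is i.
have sI : size Is = 2 ^ n by rewrite (perm_size pIs) size_iota.
have b0 : bal n n h0.
  split => //; rewrite (_ : map h0 _ = Is); last first.
    apply: (@eq_from_nth _ 0); rewrite size_map size_iota// => i il.
    by rewrite (nth_map 0) ?size_iota// nth_iota.
  apply: (perm_trans pIs); apply/permP => p; congr count.
  by rewrite -[LHS]map_id; apply: eq_map => x; rewrite prj_id.
exists (prj n l \o h0); first exact: bal_comp b0 (bal_prj ln).
move=> x xn; have := congr1 (fun s => nth 0 s x) E.
rewrite (nth_map 0) ?size_iota// nth_iota// add0n => ->.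
rewrite (nth_map 0) ?sI// (nth_map 0) /= ?size_iota ?nth_iota ?add0n//.
- exact: bal_lt b0 xn.
- exact: bal_lt b0 xn.
Qed.

Lemma bal_inj n f x y : bal n n f -> x < 2 ^ n -> y < 2 ^ n -> f x = f y -> x = y.
Proof.
move=> hf xn yn E; have := bal_count (f x) hf.
rewrite subnn mul1n (bal_lt hf xn) => h; apply/eqP/negPn/negP => ne.
have : 2 <= count (fun z => f z == f x) (iota 0 (2 ^ n)); last by rewrite h.
rewrite -size_filter; apply: (@uniq_leq_size _ [:: x; y]).
  by rewrite /= inE ne.
by move=> z; rewrite !inE mem_filter mem_iota => /orP[]/eqP ->; rewrite ?E ?eqxx.
Qed.

Lemma bal_inv n f : bal n n f -> exists g, [/\ bal n n g, eqn_on n (f \o g) id &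
  eqn_on n (g \o f) id].
Proof.
move=> hf; have [g hg fg] := bal_lift (bal_id n) hf (leqnn n).
exists g; split => // x xn; apply: (bal_inj hf) => //.
  by apply: bal_lt hg _; exact: bal_lt hf _.
by apply: fg; exact: bal_lt hf _.
Qed.

Lemma inj_bal n f : (forall x, x < 2 ^ n -> f x < 2 ^ n) ->
  (forall x y, x < 2 ^ n -> y < 2 ^ n -> f x = f y -> x = y) -> bal n n f.
Proof.
move=> fl fi; split => //.
rewrite (_ : map (prj n n) _ = iota 0 (2 ^ n)); last first.
  by rewrite -[RHS]map_id; apply: eq_map => x; rewrite prj_id.
have u : uniq (map f (iota 0 (2 ^ n))).
  rewrite map_inj_in_uniq ?iota_uniq// => x y; rewrite !mem_iota => /andP[_ xn] /andP[_ yn].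
  exact: fi.
apply: uniq_perm; rewrite ?iota_uniq//.
have [] := uniq_min_size u (s2 := iota 0 (2 ^ n)) => //.
  by move=> y /mapP[x]; rewrite !mem_iota => /andP[_ xn] ->; exact: fl.
by rewrite size_map.
Qed.

Lemma count_pairs_fst (T U : eqType) (b : pred U) (s : seq T) (t : seq U) u : uniq s ->
  count (fun p => (p.1 == u) && b p.2) [seq (x, y) | x <- s, y <- t] =
  (u \in s) * count b t.
Proof.
elim: s => [//|x s ih] /andP[xs us]; rewrite allpairs_cons count_cat ih// count_map inE.
rewrite [X in X + _](_ : _ = (u == x) * count b t).
  rewrite -mulnDl; case: eqP xs => [->|_] //= /negbTE ->; by [].
rewrite (eq_count (a2 := fun y => (u == x) && b y)); last by move=> y /=; rewrite eq_sym.
by case: eqP => _ /=; rewrite ?mul1n// count_const.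
Qed.

Lemma count_pairs_snd (T U : eqType) (b : pred T) (s : seq T) (t : seq U) v : uniq t ->
  count (fun p => (p.2 == v) && b p.1) [seq (x, y) | x <- s, y <- t] =
  (v \in t) * count b s.
Proof.
move=> ut; elim: s => [|x s ih]; first by rewrite muln0.
rewrite allpairs_cons count_cat ih count_map mulnDr; congr (_ + _).
rewrite (eq_count (a2 := fun y => (y == v) && b x)) //.
case: (b x); last by rewrite muln0 (eq_count (a2 := pred0)) ?count_pred0// => y; rewrite andbF.
rewrite muln1 (eq_count (a2 := pred1 v)); last by move=> y; rewrite andbT.
exact: count_uniq_mem.
Qed.

(* fibre product of balanced maps, coded again on an initial segment *)
Lemma fibre_product n l m f g : bal n m f -> bal l m g ->
  exists P Q, [/\ bal (n + (l - m)) n P, bal (n + (l - m)) l Q,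
    eqn_on (n + (l - m)) (f \o P) (g \o Q) &
    forall s t, bal n n s -> bal l l t ->
     (forall x y, x < 2 ^ n -> y < 2 ^ l -> f x = g y -> f (s x) = g (t y)) ->
     exists2 w, bal (n + (l - m)) (n + (l - m)) w &
       eqn_on (n + (l - m)) (P \o w) (s \o P) /\ eqn_on (n + (l - m)) (Q \o w) (t \o Q)].
Proof.
move=> hf hg; have [mn _] := hf; have [ml _] := hg.
set q := n + (l - m).
pose S := [seq p <- [seq (x, y) | x <- iota 0 (2 ^ n), y <- iota 0 (2 ^ l)] | f p.1 == g p.2].
have uS : uniq S.
  by apply: filter_uniq; apply: allpairs_uniq; rewrite ?iota_uniq// => -[? ?] [? ?].
have memS x y : ((x, y) \in S) = [&& f x == g y, x < 2 ^ n & y < 2 ^ l].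
  rewrite mem_filter /=; congr (_ && _); apply/allpairsP/andP => /=.
    by move=> [[a b]] /= []; rewrite !mem_iota => /andP[_ a1] /andP[_ b1] [-> ->].
  by move=> [xn yl]; exists (x, y); rewrite /= !mem_iota.
have c1 u : count (fun p => p.1 == u) S = 2 ^ (l - m) * (u < 2 ^ n).
  rewrite count_filter (eq_count (a2 := fun p => (p.1 == u) && (g p.2 == f u))); last first.
    by move=> [x y] /=; case: eqP => // ->; rewrite eq_sym.
  rewrite (count_pairs_fst (fun y => g y == f u)) ?iota_uniq// mem_iota /= add0n.
  by rewrite (bal_count _ hg); case: ltnP => // un; rewrite ?mul0n ?muln0// (bal_lt hf un) mul1n.
have c2 v : count (fun p => p.2 == v) S = 2 ^ (n - m) * (v < 2 ^ l).
  rewrite count_filter (eq_count (a2 := fun p => (p.2 == v) && (f p.1 == g v))); last first.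
    by move=> [x y] /=; case: eqP => // ->.
  rewrite (count_pairs_snd (fun x => f x == g v)) ?iota_uniq// mem_iota /= add0n.
  by rewrite (bal_count _ hf); case: ltnP => // un; rewrite ?mul0n ?muln0// (bal_lt hg un) mul1n.
have sS : size S = 2 ^ q.
  have : perm_eq (map fst S) (map (prj q n) (iota 0 (2 ^ q))).
    apply/allP => u _ /=; apply/eqP; rewrite !count_map.
    rewrite (eq_count (a2 := fun p => p.1 == u))// c1.
    rewrite (eq_count (a2 := fun x => prj q n x == u))// (bal_count _ (bal_prj _)) ?leq_addr//.
    by rewrite /q addnC addnK.
  by move=> /perm_size; rewrite !size_map size_iota.
pose P w := (nth (0, 0) S w).1; pose Q w := (nth (0, 0) S w).2.
have cS (b : pred (nat * nat)) : count (fun w => b (nth (0, 0) S w)) (iota 0 (2 ^ q)) = count b S.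
  by rewrite -count_map -/(mkseq _ _) -sS mkseq_nth.
have PQ w : w < 2 ^ q -> (P w, Q w) \in S.
  by move=> wq; rewrite /P /Q -surjective_pairing mem_nth// sS.
have bP : bal q n P.
  apply: bal_of_count; first exact: leq_addr.
  by move=> u; rewrite (cS (fun p => p.1 == u)) c1 /q addnC addnK.
have bQ : bal q l Q.
  apply: bal_of_count; first by rewrite /q; lia.
  move=> u; rewrite (cS (fun p => p.2 == u)) c2; congr (2 ^ _ * _); rewrite /q; lia.
exists P, Q; split => //.
  by move=> w /PQ; rewrite memS => /and3P[/eqP].
move=> s t hs ht st.
pose W w := index (s (P w), t (Q w)) S.
have inS w : w < 2 ^ q -> (s (P w), t (Q w)) \in S.
  move=> /PQ; rewrite !memS => /and3P[/eqP e p1 p2].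
  by rewrite (st _ _ p1 p2 e) eqxx (bal_lt hs)// (bal_lt ht).
exists W; last by split => w wq; rewrite /= /P /Q /W nth_index ?inS.
apply: inj_bal => [w wq|w w' wq wq'].
  by rewrite -sS index_mem inS.
move=> /(congr1 (nth (0, 0) S)); rewrite !nth_index ?inS// => -[e1 e2].
have := PQ _ wq; have := PQ _ wq'; rewrite !memS => /and3P[_ a1 a2] /and3P[_ b1 b2].
have E : nth (0, 0) S w = nth (0, 0) S w'.
  rewrite [LHS]surjective_pairing [RHS]surjective_pairing.
  by rewrite -/(P w) -/(Q w) (bal_inj hs _ _ e1)// (bal_inj ht _ _ e2).
by apply/eqP; rewrite -(nth_uniq (0, 0) _ _ uS) ?sS// E.
Qed.

(* [None] marks the uncoloured points *)
Lemma fill_colouring (q c : nat) (K : seq nat) (col : nat -> option nat) :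
  uniq K -> size K = q * c ->
  (forall x j, x \in K -> col x = Some j -> j < c) ->
  (forall j, j < c -> count (fun x => col x == Some j) K <= q) ->
  exists f : nat -> nat, (forall x j, x \in K -> col x = Some j -> f x = j) /\
    forall j, count (fun x => f x == j) K = q * (j < c).
Proof.
move=> uK sK colc hq.
pose L := flatten [seq nseq (q - count (fun x => col x == Some j) K) j | j <- iota 0 c].
pose U := [seq x <- K | col x == None].
have cL j : count (pred1 j) L = (q - count (fun x => col x == Some j) K) * (j < c).
  rewrite /L; have : uniq (iota 0 c) by exact: iota_uniq.
  have -> : (j < c) = (j \in iota 0 c) by rewrite mem_iota.
  elim: (iota 0 c) => [|i s ih] /= ; first by rewrite muln0.
  move=> /andP[is_ us]; rewrite count_cat ih// count_nseq inE /=.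
  have [E|ne] := eqVneq i j; last first.
    by rewrite mul0n add0n inE (eq_sym j) (negbTE ne).
  by rewrite -E inE (negbTE is_) muln0 addn0 eqxx mul1n muln1.
have sumK (s : seq nat) : (forall x j, x \in s -> col x = Some j -> j < c) ->
    size s = count (fun x => col x == None) s + \sum_(j < c) count (fun x => col x == Some (val j)) s.
  elim: s => [|x s ih] h /=; first by rewrite big1.
  rewrite ih; last by move=> y j ys; apply: h; rewrite inE ys orbT.
  rewrite big_split /=; case E : (col x) => [j|] /=.
    have jc : j < c by apply: (h x); rewrite ?inE ?eqxx.
    have -> : \sum_(i < c) (Some j == Some (val i)) = 1.
      rewrite (bigD1 (Ordinal jc)) //= eqxx big1 ?addn0// => i ij.
      apply/eqP; rewrite eqb0; apply: contraNN ij => /eqP[e].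
      by rewrite -val_eqE /= e.
    by lia.
  have -> : \sum_(i < c) ((None : option nat) == Some (val i)) = 0 by rewrite big1.
  by lia.
have sL : size L = size U.
  rewrite /L size_flatten /shape -map_comp sumnE big_map.
  rewrite (eq_bigr (fun j => q - count (fun x => col x == Some j) K)); last by move=> j _ /=; rewrite size_nseq.
  have := sumK K colc; rewrite sK size_filter => h.
  have e : \sum_(j < c) (q - count (fun x => col x == Some (val j)) K) +
     \sum_(j < c) count (fun x => col x == Some (val j)) K = q * c.
    rewrite -big_split /= (eq_bigr (fun=> q)); last by move=> j _; rewrite subnK// hq.
    by rewrite sum_nat_const card_ord mulnC.
  rewrite -(big_mkord xpredT (fun j => q - count (fun x => col x == Some j) K)) in e.
  rewrite /index_iota subn0 in e.
  by move: e; rewrite h => /addIn.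
pose f x := if col x is Some j then j else nth 0 L (index x U).
exists f; split; first by move=> x j _; rewrite /f => ->.
move=> j.
have uU : uniq U by exact: filter_uniq.
have -> : count (fun x => f x == j) K =
    count (fun x => f x == j) U + count (fun x => col x == Some j) K.
  have /permP/(_ (fun x => f x == j)) <- := permEl (perm_filterC (fun x => col x == None) K).
  rewrite count_cat; congr (_ + _); rewrite count_filter; apply: eq_count => x /=.
  by rewrite /f; case: (col x) => [k|] /=; rewrite ?andbT ?andbF.
have -> : count (fun x => f x == j) U = count (pred1 j) L.
  have -> : L = [seq nth 0 L (index x U) | x <- U].
    apply: (@eq_from_nth _ 0) => [|i]; first by rewrite size_map.
    rewrite sL => iU.
    by rewrite (nth_map 0)// index_uniq.
  rewrite count_map; apply: eq_in_count => x; rewrite mem_filter => /andP[/eqP cx xK] /=.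
  by rewrite /f cx.
rewrite cL; case: ltnP => jc; first by rewrite !muln1 subnK//; exact: hq.
rewrite !muln0 add0n; apply/eqP; rewrite -leqn0 leqNgt -has_count.
by apply/hasP => -[x xK /eqP/(colc _ _ xK)]; rewrite ltnNge jc.
Qed.

(** Treated block by block: a cell [i] of level [n] contains [2 ^ (N - n)] cells of level [N], and
    [2 ^ (l - n)] colours lie over it under [eta]. A partial colouring that uses no colour more than
    [2 ^ (N - l)] times thus fills up inside each block. *)
Lemma block_colouring n l N eta (col : nat -> option nat) : bal l n eta -> l <= N ->
  (forall k j, k < 2 ^ N -> col k = Some j -> j < 2 ^ l /\ eta j = prj N n k) ->
  (forall j, count (fun k => col k == Some j) (iota 0 (2 ^ N)) <= 2 ^ (N - l)) ->
  exists z, [/\ bal N l z, eqn_on N (eta \o z) (prj N n) &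
    forall k j, k < 2 ^ N -> col k = Some j -> z k = j].
Proof.
move=> be lN hcol hq; have [nl _] := be; have nN := leq_trans nl lN.
pose K i := [seq k <- iota 0 (2 ^ N) | prj N n k == i].
pose J i := [seq j <- iota 0 (2 ^ l) | eta j == i].
have uK i : uniq (K i) by rewrite filter_uniq// iota_uniq.
have uJ i : uniq (J i) by rewrite filter_uniq// iota_uniq.
have memK k i : (k \in K i) = (k < 2 ^ N) && (prj N n k == i).
  by rewrite mem_filter mem_iota andbC.
have memJ j i : (j \in J i) = (j < 2 ^ l) && (eta j == i).
  by rewrite mem_filter mem_iota andbC.
have sJ i : i < 2 ^ n -> size (J i) = 2 ^ (l - n).
  by move=> iN; rewrite size_filter (bal_count _ be) iN muln1.
pose co i k := if col k is Some j then Some (index j (J i)) else None.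
have coE i k j : k \in K i -> j \in J i -> (co i k == Some (index j (J i))) = (col k == Some j).
  rewrite memK /co => /andP[kN /eqP ki] jJ; case E : (col k) => [j'|//].
  have [j'l ej'] := hcol _ _ kN E; have j'J : j' \in J i by rewrite memJ j'l ej' ki eqxx.
  apply/eqP/eqP => [[e]|[->//]]; congr Some.
  by rewrite -(nth_index 0 j'J) e nth_index.
have /choice[f hf] : forall i, exists f, i < 2 ^ n ->
    (forall k c, k \in K i -> co i k = Some c -> f k = c) /\
    forall c, count (fun k => f k == c) (K i) = 2 ^ (N - l) * (c < 2 ^ (l - n)).
  move=> i; have [iN|_] := boolP (i < 2 ^ n); last by exists id.
  have [| |c|f [h1 h2]] := @fill_colouring (2 ^ (N - l)) (2 ^ (l - n)) (K i) (co i) (uK i).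
  - rewrite /K size_filter (bal_count _ (bal_prj nN)) iN muln1 -expnD; congr (2 ^ _); lia.
  - move=> k c; rewrite memK /co => /andP[kN /eqP ki]; case E : (col k) => [j|//] [<-].
    have [jl ej] := hcol _ _ kN E.
    by rewrite -(sJ i)// index_mem memJ jl ej ki eqxx.
  - rewrite -(sJ i)// => cJ; set j := nth 0 (J i) c.
    have jJ : j \in J i by exact: mem_nth.
    have -> : c = index j (J i) by rewrite index_uniq.
    rewrite (@eq_in_count _ _ (fun k => col k == Some j)); last by move=> k kK; exact: coE.
    by apply: leq_trans (hq j); rewrite /K count_filter; apply: sub_count => k /= /andP[].
  - by exists f.
pose z k := nth 0 (J (prj N n k)) (f (prj N n k) k).
have inK k : k < 2 ^ N -> k \in K (prj N n k) by move=> kN; rewrite memK kN eqxx.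
have fl k : k < 2 ^ N -> f (prj N n k) k < size (J (prj N n k)).
  move=> kN; have pn := prj_lt nN kN; rewrite sJ//; have [_ h] := hf _ pn.
  rewrite ltnNge; apply/negP => ge; have := h (f (prj N n k) k).
  rewrite ltnNge ge muln0 => /eqP; rewrite -leqn0 leqNgt -has_count => /hasP; apply.
  by exists k => //=; exact: inK.
have zJ k : k < 2 ^ N -> z k \in J (prj N n k) by move=> kN; apply: mem_nth; exact: fl.
have ez : eqn_on N (eta \o z) (prj N n).
  by move=> k /zJ; rewrite memJ => /andP[_ /eqP].
exists z; split => //.
  apply: bal_of_count => // j; have [jl|jl] := ltnP j (2 ^ l); last first.
    rewrite muln0; apply/eqP; rewrite -leqn0 leqNgt -has_count; apply/hasP => -[k].
    rewrite mem_iota add0n => /= /zJ; rewrite memJ => /andP[zl _] /eqP e.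
    by move: zl; rewrite e ltnNge jl.
  have en := bal_lt be jl; have jJ : j \in J (eta j) by rewrite memJ jl eqxx.
  have [_ /(_ (index j (J (eta j))))] := hf _ en.
  rewrite -(sJ _ en) index_mem jJ => <-; rewrite /K count_filter.
  apply: eq_in_count => k; rewrite mem_iota add0n /= => kN.
  apply/eqP/andP => [e|[/eqP e1 /eqP e2]].
    have e' : prj N n k = eta j by have := zJ k kN; rewrite memJ e => /andP[_ /eqP].
    split; last exact/eqP.
    rewrite -[X in index X]e /z e' index_uniq//; last by rewrite -e' fl.
  by rewrite /z e2 e1 nth_index.
move=> k j kN e; have [jl ej] := hcol k j kN e.
have jJ : j \in J (prj N n k) by rewrite memJ jl ej eqxx.
have [h _] := hf _ (prj_lt nN kN).
by rewrite /z (h k (index j (J (prj N n k)))) ?inK// ?nth_index// /co e.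
Qed.

(** Only the first [2 ^ (N - l)] occurrences of each colour are kept before filling up, so the
    disagreement is at most the excess of that colour. *)
Lemma truncated_colouring n l N eta (col : nat -> option nat) : bal l n eta -> l <= N ->
  (forall k j, k < 2 ^ N -> col k = Some j -> j < 2 ^ l /\ eta j = prj N n k) ->
  exists z, [/\ bal N l z, eqn_on N (eta \o z) (prj N n) &
    forall j, count (fun k => (col k == Some j) && (z k != j)) (iota 0 (2 ^ N)) <=
      count (fun k => col k == Some j) (iota 0 (2 ^ N)) - 2 ^ (N - l)].
Proof.
move=> be lN hcol.
pose F j := [seq k <- iota 0 (2 ^ N) | col k == Some j].
have uF j : uniq (F j) by rewrite filter_uniq// iota_uniq.
pose L j := take (2 ^ (N - l)) (F j).
pose col' k := if col k is Some j then if k \in L j then Some j else None else None.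
have colE k j : col' k = Some j -> col k = Some j /\ k \in L j.
  by rewrite /col'; case: (col k) => [j'|//]; case E : (k \in L j') => // -[<-].
have [||z [bz ez hz]] := @block_colouring n l N eta col' be lN.
- by move=> k j kN /colE[/(hcol _ _ kN)].
- move=> j; apply: (@leq_trans (size (L j))); last by rewrite size_take_min geq_minl.
  rewrite -size_filter; apply: uniq_leq_size; first by rewrite filter_uniq// iota_uniq.
  by move=> k; rewrite mem_filter => /andP[/eqP/colE[]].
exists z; split => // j.
rewrite -[X in X - _]size_filter -size_drop -/(F j).
have -> : count (fun k => (col k == Some j) && (z k != j)) (iota 0 (2 ^ N)) =
    count (fun k => z k != j) (F j).
  by rewrite count_filter; apply: eq_count => k; rewrite andbC.
rewrite -{1}(cat_take_drop (2 ^ (N - l)) (F j)) count_cat.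
rewrite (@eq_in_count _ _ pred0) ?count_pred0 ?add0n ?count_size// => k kL.
apply/negbTE; rewrite negbK; apply/eqP.
have : k \in F j by exact: mem_take kL.
rewrite mem_filter mem_iota => /andP[/eqP ck kN].
by apply: hz => //; rewrite /col' ck [_ \in L j]kL.
Qed.

Import Order.TTheory GRing.Theory Num.Theory.
Local Open Scope classical_set_scope.
Local Open Scope ring_scope.
Local Open Scope group_scope.
Local Open Scope quotient_scope.

(** * Automorphisms and null sets *)

Notation "T $ x" := (mpb_fun (Aut_fun T) x)
  (at level 10, x at next level, format "T $ x").

(** Moves an almost-everywhere fact under the quantifier of the goal. Several of them accumulate
    into one pointwise implication, which [aeW] then exposes, the last fact first. *)
Ltac ae_use H := generalize H; apply: filter_app.

Section AutBasics.
Context (R : realType) (d : measure_display) (Y : measurableType d).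
Variable lambda : {measure set Y -> \bar R}.
Local Notation G := (Aut lambda).
Implicit Types (S T U : G) (A B : set Y).

Lemma ae_comp (T : mp_bijection lambda) (P : Y -> Prop) :
  (\forall x \ae lambda, P x) -> \forall x \ae lambda, P (T x).
Proof.
move=> [N [mN N0 PN]]; exists (T @^-1` N); split.
- exact: mpb_preimage_measurable.
- by rewrite mpb_preserving.
- by move=> x /= hx; apply: PN.
Qed.

Lemma ae_map T (P : Y -> Prop) :
  (\forall x \ae lambda, P x) -> \forall x \ae lambda, P (T $ x).
Proof. exact: ae_comp. Qed.

Lemma autE (T : mp_bijection lambda) :
  \forall x \ae lambda, (\pi_G T : G) $ x = T x.
Proof. by have := Aut_funK T; apply: filterS => x /(_ Logic.I). Qed.

Lemma aut_ext S T : (\forall x \ae lambda, S $ x = T $ x) -> S = T.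
Proof.
move=> h; rewrite -[S]reprK -[T]reprK; apply/Aut_eqP.
by apply: filterS h.
Qed.

Lemma autM S T : \forall x \ae lambda, (S * T) $ x = S $ (T $ x).
Proof. exact: autE. Qed.

Lemma aut1 : \forall x \ae lambda, (1 : G) $ x = x.
Proof. exact: autE. Qed.

Lemma autVK T : \forall x \ae lambda, T^-1 $ (T $ x) = x.
Proof.
have := ae_comp T (autE (mpb_inv T)).
by apply: filterS => x ->; exact: mpb_funK.
Qed.

Lemma autKV T : \forall x \ae lambda, T $ (T^-1 $ x) = x.
Proof.
have := autE (mpb_inv T).
by apply: filterS => x ->; exact: mpb_inv_funK.
Qed.

Lemma ae_surj T (P : Y -> Prop) :
  (\forall x \ae lambda, P (T $ x)) -> \forall x \ae lambda, P x.
Proof.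
move=> /(ae_map T^-1); apply: filterS2 (autKV T) => x.
by move=> ->.
Qed.

Definition supp A T := \forall x \ae lambda, ~ A x -> T $ x = x.

Lemma supp1 A : supp A 1.
Proof. by have := aut1; apply: filterS => x ->. Qed.

Lemma suppS A B T : A `<=` B -> supp A T -> supp B T.
Proof. by move=> AB; apply: filterS => x h nB; apply: h => /AB. Qed.

Lemma suppM A S T : supp A S -> supp A T -> supp A (S * T).
Proof.
move=> hS hT; ae_use hS; ae_use hT; ae_use (autM S T).
by apply: aeW => x -> h1 h2 nA; rewrite (h1 nA) (h2 nA).
Qed.

Lemma suppV A T : supp A T -> supp A T^-1.
Proof.
move=> hT; ae_use hT; ae_use (autVK T); apply: aeW => x h1 h2 nA.
by rewrite -[in LHS](h2 nA).
Qed.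

Lemma supp_stable A T : supp A T -> \forall x \ae lambda, A x <-> A (T $ x).
Proof.
move=> hT; have hV := suppV hT.
ae_use hT; ae_use (autVK T); ae_use (ae_map T hV).
apply: aeW => x h1 h2 h3; split => [Ax|ATx]; apply: contrapT => nA.
  by have := h1 nA; rewrite h2 => E; rewrite -E in nA.
by rewrite (h3 nA) in ATx.
Qed.

Lemma supp_conj A B T U : (\forall x \ae lambda, A x -> B (U $ x)) ->
  supp A T -> supp B (U * T * U^-1).
Proof.
move=> hU hT; apply: (ae_surj (T := U)).
ae_use hU; ae_use hT; ae_use (autM U T); ae_use (autVK U).
ae_use (ae_map U (autM (U * T) U^-1)); apply: aeW => x -> -> -> h1 h2 nB.
by rewrite h1// => /h2.
Qed.

End AutBasics.
Arguments aut1 {R d Y} lambda.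

Lemma le_measure_ae (R : realType) d (Y : measurableType d)
    (mu : {measure set Y -> \bar R}) (A B : set Y) :
  measurable A -> measurable B -> (\forall x \ae mu, A x -> B x) ->
  (mu A <= mu B)%E.
Proof.
move=> mA mB [N [mN N0 hN]].
apply: (@le_trans _ _ (mu (B `|` N))).
  apply: le_measure; rewrite ?inE//; first exact: measurableU.
  move=> x Ax; have [Nx|nNx] := pselect (N x); [by right|left].
  by apply: contrapT => nB; apply/nNx/hN => /(_ Ax).
by apply: (le_trans (measureU2 _ mB mN)); rewrite [X in (_ + X)%E]N0 adde0.
Qed.

Lemma eq_measure_ae (R : realType) d (Y : measurableType d)
    (mu : {measure set Y -> \bar R}) (A B : set Y) :
  measurable A -> measurable B -> (\forall x \ae mu, A x <-> B x) ->
  mu A = mu B.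
Proof.
move=> mA mB h; apply/le_anti/andP; split; apply: le_measure_ae => //.
  by apply: filterS h => x [].
by apply: filterS h => x [].
Qed.

Lemma ae_measure0 (R : realType) d (Y : measurableType d)
    (mu : {measure set Y -> \bar R}) (A : set Y) :
  measurable A -> (\forall x \ae mu, ~ A x) -> mu A = 0%E.
Proof.
move=> mA h; rewrite -(measure0 mu); apply: eq_measure_ae => //.
by apply: filterS h => x nA; split.
Qed.

(** * Realizing maps that are invertible almost everywhere *)

Section Realize.
Context (R : realType) (d : measure_display) (Y : measurableType d).
Variable lambda : {measure set Y -> \bar R}.
Local Notation G := (Aut lambda).

(** Let [N] be the null set where an identity fails, and [B] the points with an iterate under [f] or
    under [g] in [N]. [B] is null, and off [B] the maps preserve its complement and are true
    inverses; the identity is put on [B]. Images are measurable because they are preimages under the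
    other map. *)
Lemma realize (f g : Y -> Y) :
  measurable_fun setT f -> measurable_fun setT g ->
  (\forall x \ae lambda, g (f x) = x) -> (\forall x \ae lambda, f (g x) = x) ->
  (forall A, measurable A -> lambda (f @^-1` A) = lambda A) ->
  exists T : G, \forall x \ae lambda, T $ x = f x.
Proof.
move=> mf mg gf fg pf.
have [N [mN N0 hN]] : \forall x \ae lambda, g (f x) = x /\ f (g x) = x.
  exact: filterI gf fg.
have gfN x : ~ N x -> g (f x) = x.
  by move=> nN; apply: contrapT => h; apply/nN/hN => -[].
have fgN x : ~ N x -> f (g x) = x.
  by move=> nN; apply: contrapT => h; apply/nN/hN => -[].
have mpre (h : Y -> Y) A : measurable_fun setT h -> measurable A ->
    measurable (h @^-1` A).
  by move=> mh mA; rewrite -[X in measurable X]setTI; exact: mh.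
have mi (h : Y -> Y) n : measurable_fun setT h -> measurable_fun setT (iter n h).
  by move=> mh; elim: n => [|n ih] /=; [exact: measurable_id|exact: measurableT_comp].
have nullf A : measurable A -> lambda A = 0%E -> lambda (f @^-1` A) = 0%E.
  by move=> mA A0; rewrite pf.
have nullg A : measurable A -> lambda A = 0%E -> lambda (g @^-1` A) = 0%E.
  move=> mA A0; rewrite -(pf (g @^-1` A)); last exact: mpre.
  rewrite -A0; apply: eq_measure_ae => //; first by apply: (mpre) => //; exact: mpre.
  by apply: filterS gf => x /= ->.
pose B := \bigcup_n ((iter n f @^-1` N) `|` (iter n g @^-1` N)).
have mB : measurable B.
  by apply: bigcup_measurable => n _; apply: measurableU; apply: mpre => //; exact: mi.
have nulli (h : Y -> Y) n : measurable_fun setT h ->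
    (forall A, measurable A -> lambda A = 0%E -> lambda (h @^-1` A) = 0%E) ->
    lambda (iter n h @^-1` N) = 0%E.
  move=> mh nh; elim: n => [//|n ih].
  have -> : iter n.+1 h @^-1` N = h @^-1` (iter n h @^-1` N).
    by apply/seteqP; split=> x /=; rewrite -iterS iterSr.
  by apply: nh => //; apply: mpre => //; exact: mi.
have B0 : \forall x \ae lambda, ~ B x.
  have : \forall x \ae lambda, forall n,
      ~ ((iter n f @^-1` N) `|` (iter n g @^-1` N)) x.
    apply: ae_foralln => n; exists ((iter n f @^-1` N) `|` (iter n g @^-1` N)).
    split.
    - by apply: measurableU; apply: mpre => //; exact: mi.
    - apply: null_set_setU.
      + by apply: mpre => //; exact: mi.
      + by apply: mpre => //; exact: mi.
      + exact: nulli.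
      + exact: nulli.
    - by move=> x /= /contrapT.
  by apply: filterS => x h [n _]; exact: h.
have KN x : ~ B x -> ~ N x by move=> nB Nx; apply: nB; exists 0%N => //; left.
have Kf x : ~ B x -> ~ B (f x).
  move=> nB [n _ [|]] /= h; apply: (nB).
    by exists n.+1 => //; left; rewrite /= -iterS iterSr.
  case: n h => [|n].
    by move=> h; exists 1%N => //; left.
  rewrite iterSr gfN; last exact: KN.
  by move=> h; exists n => //; right.
have Kg x : ~ B x -> ~ B (g x).
  move=> nB [n _ [|]] /= h; apply: (nB); last first.
    by exists n.+1 => //; right; rewrite /= -iterS iterSr.
  case: n h => [|n].
    by move=> h; exists 1%N => //; right.
  rewrite iterSr fgN; last exact: KN.
  by move=> h; exists n => //; left.
have mglue (h : Y -> Y) : measurable_fun setT h ->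
    measurable_fun setT (fun x => if x \in B then x else h x).
  move=> mh; apply: measurable_fun_ifT => //.
  by apply: (measurable_fun_bool true); rewrite setTI preimage_mem_true.
pose F x := if x \in B then x else f x.
pose H x := if x \in B then x else g x.
have iB (h : Y -> Y) x : B x -> (if x \in B then x else h x) = x.
  by move=> Bx; rewrite ifT// inE.
have inB (h : Y -> Y) x : ~ B x -> (if x \in B then x else h x) = h x.
  by move=> Bx; rewrite ifF//; apply/negbTE/negP; rewrite inE.
have FK : cancel F H.
  move=> x; rewrite /F /H; have [Bx|nB] := pselect (B x); first by rewrite !iB.
  by rewrite (inB f x nB) (inB g _ (Kf _ nB)); apply/gfN/KN.
have HK : cancel H F.
  move=> x; rewrite /F /H; have [Bx|nB] := pselect (B x); first by rewrite !iB.
  by rewrite (inB g x nB) (inB f _ (Kg _ nB)); apply/fgN/KN.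
have Fbij : bijective F by exists H.
have mF := mglue _ mf; have mH := mglue _ mg.
have Fimg A : measurable A -> measurable (F @` A).
  move=> mA; suff -> : F @` A = H @^-1` A by exact: mpre.
  apply/seteqP; split=> y /= => [[x Ax <-]|Ay]; first by rewrite FK.
  by exists (H y).
have Ff : \forall x \ae lambda, F x = f x.
  by apply: filterS B0 => x nB; exact: inB.
have Fpres A : measurable A -> lambda (F @^-1` A) = lambda A.
  move=> mA; rewrite -(pf A mA); apply: eq_measure_ae; [exact: mpre|exact: mpre|].
  by apply: filterS Ff => x /= ->.
exists (\pi_G (MpBijection Fbij mF Fimg Fpres)).
by apply: filterS2 Ff (autE (MpBijection Fbij mF Fimg Fpres)) => x <- ->.
Qed.

End Realize.

(** * Gluing automorphisms along countable partitions *)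

Section Glue.
Context (R : realType) (d : measure_display) (Y : measurableType d).
Variable lambda : {measure set Y -> \bar R}.
Local Notation G := (Aut lambda).

Lemma aut_preimage_measurable (T : G) A : measurable A ->
  measurable [set x | A (T $ x)].
Proof. exact: mpb_preimage_measurable. Qed.

Lemma aut_preserving (T : G) A : measurable A ->
  lambda [set x | A (T $ x)] = lambda A.
Proof. exact: mpb_preserving. Qed.

Lemma label_measurable (io : Y -> nat) i : measurable_fun setT io ->
  measurable [set x | io x = i].
Proof.
by move=> /(_ measurableT [set i] I); rewrite setTI.
Qed.

Lemma measurable_rel (f g : Y -> nat) (Q : nat -> nat -> Prop) :
  measurable_fun setT f -> measurable_fun setT g -> measurable [set z | Q (f z) (g z)].
Proof.
move=> mf mg; rewrite (_ : [set _ | _] = \bigcup_j ([set z | f z = j] `&` g @^-1` Q j)).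
  apply: bigcupT_measurable => j; apply: measurableI; first exact: label_measurable.
  by rewrite -[X in measurable X]setTI; exact: mg.
by apply/seteqP; split=> z /=; [exists (f z)|move=> [j _ [<-]]].
Qed.

Lemma measure_label (io : Y -> nat) A : measurable_fun setT io -> measurable A ->
  lambda A = (\sum_(i <oo) lambda (A `&` [set x | io x = i]))%E.
Proof.
move=> mio mA.
have {1}-> : A = \bigcup_i (A `&` [set x | io x = i]).
  by apply/seteqP; split=> [x Ax|x [i _ []]//]; exists (io x).
rewrite measure_bigcup//.
- by apply: eq_eseriesl => i; rewrite in_setT.
- by move=> i _; apply: measurableI => //; exact: label_measurable.
- by move=> i j _ _ [x [[_ /= <-] [_ /= <-]]].
Qed.

Lemma measurable_label_fun (io : Y -> nat) (f : Y -> Y) (g : nat -> Y -> Y) :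
  measurable_fun setT io -> (forall i, measurable_fun setT (g i)) ->
  (forall x, f x = g (io x) x) -> measurable_fun setT f.
Proof.
move=> mio mg fE _ A mA; rewrite setTI.
have -> : f @^-1` A = \bigcup_i ([set x | io x = i] `&` g i @^-1` A).
  apply/seteqP; split=> [x /= Ax|x [i _ [/= ix Ax]]].
    by exists (io x) => //; split => //=; rewrite -fE.
  by rewrite fE ix.
apply: bigcup_measurable => i _; apply: measurableI.
  exact: label_measurable.
by rewrite -[X in measurable X]setTI; exact: mg.
Qed.

(** [io] labels the pieces of the source and [ka] those of the target. Two labellings are needed
    because the inverse has to know, from the image alone, which [T i] was applied. *)
Lemma aut_glue (io ka : Y -> nat) (T : nat -> G) :
  measurable_fun setT io -> measurable_fun setT ka ->
  (forall i, \forall x \ae lambda, io x = i <-> ka (T i $ x) = i) ->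
  exists S : G, \forall x \ae lambda, S $ x = T (io x) $ x /\ ka (S $ x) = io x.
Proof.
move=> mio mka h.
have h1 := ae_foralln h.
have kaE : \forall x \ae lambda, ka (T (io x) $ x) = io x.
  by apply: filterS h1 => x /(_ (io x)) [/(_ erefl)].
pose f x := T (io x) $ x.
pose g y := (T (ka y))^-1 $ y.
have mf : measurable_fun setT f.
  apply: (measurable_label_fun mio (g := fun i x => T i $ x)) => // i.
  exact: mpb_measurable.
have mg : measurable_fun setT g.
  apply: (measurable_label_fun mka (g := fun i x => (T i)^-1 $ x)) => // i.
  exact: mpb_measurable.
have gf : \forall x \ae lambda, g (f x) = x.
  have := ae_foralln (fun i => autVK (T i)).
  by apply: filterS2 kaE => x E /(_ (io x)); rewrite /g /f E.
have fg : \forall x \ae lambda, f (g x) = x.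
  have h2 := ae_foralln (fun i => autKV (T i)).
  have h3 := ae_foralln (fun i => ae_map (T i)^-1 (h i)).
  apply: filterS2 h2 h3 => x h2 /(_ (ka x)).
  by rewrite (h2 (ka x)) => -[_ /(_ erefl)]; rewrite /f /g => ->; exact: h2.
have pf A : measurable A -> lambda (f @^-1` A) = lambda A.
  move=> mA; have mfA : measurable (f @^-1` A).
    by rewrite -[X in measurable X]setTI; exact: mf.
  rewrite (measure_label mio)// [RHS](measure_label mka)//.
  apply: eq_eseriesr => i _.
  have mI : measurable (A `&` [set x | ka x = i]).
    by apply: measurableI => //; exact: label_measurable.
  rewrite -(aut_preserving (T i) mI); apply: eq_measure_ae.
  - by apply: measurableI => //; exact: label_measurable.
  - exact: aut_preimage_measurable.
  - apply: filterS (h i) => x hx /=; rewrite -hx /f; split.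
      by move=> [+ <-].
    by move=> [+ ix]; rewrite ix.
have [S SE] := realize mf mg gf fg pf.
by exists S; apply: filterS2 SE kaE => x ->.
Qed.

End Glue.

(** * Sets of equal measure are exchanged by automorphisms *)

Section Homogeneous.
Context (R : realType) (d : measure_display) (Y : measurableType d).
Variable lambda : {measure set Y -> \bar R}.
Local Notation G := (Aut lambda).
Local Notation leb := (@lebesgue_measure R).
Local Notation RR := (measurableTypeR R).

Definition interval_from0 (a : \bar R) : set RR := [set t : R | (0 <= t)%R /\ (t%:E < a)%E].

(** Only one of the two cancellation identities is asked. The other one holds at almost every point
    of the interval, because [phi] carries the restriction of [lambda] to [A] to Lebesgue measure
    there. *)
Definition interval_iso (A : set Y) (phi : Y -> RR) (psi : RR -> Y) :=
  [/\ measurable_fun setT phi, measurable_fun setT psi,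
    (forall S, measurable S -> lambda (A `&` phi @^-1` S) =
       leb (S `&` interval_from0 (lambda A))) &
    \forall x \ae lambda, A x -> psi (phi x) = x].

Definition lebesgue_like := forall A, measurable A ->
  exists phi psi, interval_iso A phi psi.

Hypothesis iso : lebesgue_like.

Lemma preimage_measurable d1 d2 (X1 : measurableType d1) (X2 : measurableType d2)
  (f : X1 -> X2) A : measurable_fun setT f -> measurable A -> measurable (f @^-1` A).
Proof. by move=> mf mA; rewrite -[X in measurable X]setTI; exact: mf. Qed.

(** Both sets are identified with the same interval. The parameters where [psD] is a true section of
    [phD] with values in [D] are conull: the others pull back under [phD] to a null part of [D].
    Being Lebesgue-null in the interval, they pull back to a null part of [C] as well. *)
Lemma iso2 A B : measurable A -> measurable B -> lambda A = lambda B ->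
  exists f g : Y -> Y, [/\ measurable_fun setT f, measurable_fun setT g,
   (\forall x \ae lambda, A x -> B (f x) /\ g (f x) = x),
   (\forall x \ae lambda, B x -> A (g x) /\ f (g x) = x) &
   forall S, measurable S -> lambda (A `&` f @^-1` S) = lambda (B `&` S)].
Proof.
move=> mA mB AB.
have [phA [psA [mphA mpsA hA iA]]] := iso mA.
have [phB [psB [mphB mpsB hB iB]]] := iso mB.
have half C D (phC phD : Y -> RR) (psC psD : RR -> Y) : measurable C -> measurable D ->
    lambda C = lambda D -> interval_iso C phC psC -> interval_iso D phD psD ->
    \forall x \ae lambda, C x -> D (psD (phC x)) /\ phD (psD (phC x)) = phC x.
  move=> mC mD CD [mphC mpsC hC iC] [mphD mpsD hD iD].
  pose S := [set t | D (psD t)] `&` [set t | phD (psD t) = t].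
  have mS : measurable S.
    apply: measurableI; first exact: preimage_measurable.
    have mE : measurable_fun setT (fun t : RR => phD (psD t) == t).
      by apply: measurable_fun_eqr => //; exact: measurableT_comp.
    have := mE measurableT [set true] I; rewrite setTI; congr measurable.
    by apply/seteqP; split=> t /= /eqP.
  have mSC := measurableC mS.
  have z : lambda (D `&` phD @^-1` (~` S)) = 0%E.
    apply: ae_measure0; first by apply: measurableI => //; exact: preimage_measurable.
    by apply: filterS iD => x h [Dx] /=; rewrite /S/= (h Dx); apply.
  rewrite hD// -CD -hC// in z.
  exists (C `&` phC @^-1` (~` S)); split => //.
    by apply: measurableI => //; exact: preimage_measurable.
  by move=> x /= /not_implyP[Cx h]; split => // -[/= h1 h2]; exact: h.
have hAB := half A B phA phB psA psB mA mB AB (And4 mphA mpsA hA iA) (And4 mphB mpsB hB iB).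
have hBA := half B A phB phA psB psA mB mA (esym AB) (And4 mphB mpsB hB iB) (And4 mphA mpsA hA iA).
exists (psB \o phA), (psA \o phB); split.
- exact: measurableT_comp.
- exact: measurableT_comp.
- by apply: filterS2 hAB iA => x /= h1 h2 Ax; have [? ->] := h1 Ax; split => //; exact: h2.
- by apply: filterS2 hBA iB => x /= h1 h2 Ax; have [? ->] := h1 Ax; split => //; exact: h2.
- move=> S mS; have mS' := preimage_measurable mpsB mS.
  rewrite comp_preimage hA// AB -hB//; apply: eq_measure_ae.
  + by apply: measurableI => //; exact: preimage_measurable.
  + exact: measurableI.
  + by apply: filterS iB => x h /=; split=> -[Bx]; rewrite h.
Qed.

Lemma homogeneous A B : measurable A -> measurable B -> lambda A = lambda B ->
  lambda (~` A) = lambda (~` B) ->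
  exists T : G, \forall x \ae lambda, A x <-> B (T $ x).
Proof.
move=> mA mB AB ABc; have mAc := measurableC mA; have mBc := measurableC mB.
have [f [g [mf mg fA gB fS]]] := iso2 mA mB AB.
have [f' [g' [mf' mg' fA' gB' fS']]] := iso2 mAc mBc ABc.
have mif (C : set Y) (h h' : Y -> Y) : measurable C -> measurable_fun setT h -> measurable_fun setT h' ->
    measurable_fun setT (fun x => if x \in C then h x else h' x).
  move=> mC mh mh'; apply: measurable_fun_ifT => //.
  by apply: (measurable_fun_bool true); rewrite setTI preimage_mem_true.
pose F x := if x \in A then f x else f' x.
pose H x := if x \in B then g x else g' x.
have FT x : A x -> F x = f x by move=> Ax; rewrite /F ifT// inE.
have FF x : ~ A x -> F x = f' x by move=> nA; rewrite /F ifF//; apply/negP; rewrite inE.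
have HT x : B x -> H x = g x by move=> Ax; rewrite /H ifT// inE.
have HF x : ~ B x -> H x = g' x by move=> nA; rewrite /H ifF//; apply/negP; rewrite inE.
have FAB : \forall x \ae lambda, A x <-> B (F x).
  apply: filterS2 fA fA' => x h1 h2; have [Ax|nAx] := pselect (A x).
    by rewrite FT//; split => // _; have [] := h1 Ax.
  by rewrite FF//; split => // ?; have [] := h2 nAx.
have [//|//||||T TF] := @realize R d Y lambda F H.
- exact: mif.
- exact: mif.
- ae_use FAB; ae_use fA; ae_use fA'; apply: aeW => x h1 h2 [h3 h4].
  have [Ax|nAx] := pselect (A x).
    by rewrite HT ?FT//; [have [] := h2 Ax|rewrite -FT//; exact: h3].
  by rewrite HF ?FF//; [have [] := h1 nAx|rewrite -FF// => /h4].
- ae_use gB; ae_use gB'; apply: aeW => x h1 h2.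
  have [Ax|nAx] := pselect (B x).
    by have [? ?] := h2 Ax; rewrite HT// FT.
  by have [? ?] := h1 nAx; rewrite HF// FF.
- move=> S mS.
  have -> : F @^-1` S = (A `&` f @^-1` S) `|` (~` A `&` f' @^-1` S).
    apply/seteqP; split=> x /=.
      by have [Ax|nAx] := pselect (A x); [rewrite FT//; left|rewrite FF//; right].
    by move=> [[Ax]|[nAx]]; [rewrite FT|rewrite FF].
  have dj (C D E : set Y) : measurable C -> measurable D -> measurable E ->
      lambda ((C `&` D) `|` (~` C `&` E)) =
      (lambda (C `&` D) + lambda (~` C `&` E))%E.
    move=> mC mD mE; rewrite measureU//; do ?exact: measurableI.
      by apply: measurableI => //; exact: measurableC.
    by apply/seteqP; split=> // x [] [? _] [].
  rewrite dj//; do ?exact: preimage_measurable.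
  by rewrite fS// fS'// -dj// -setIUl setUv setTI.
- by exists T; apply: filterS2 TF FAB => x ->.
Qed.

End Homogeneous.

(** * Cutting, swapping and labelling sets *)

Section Cut.
Context (R : realType) (d : measure_display) (Y : measurableType d).
Variable lambda : {measure set Y -> \bar R}.
Local Notation G := (Aut lambda).
Local Notation leb := (@lebesgue_measure R).
Local Notation RR := (measurableTypeR R).
Hypothesis iso : lebesgue_like lambda.
Hypothesis infY : lambda setT = +oo%E.

Lemma measure_bigcup_pinfty (F : nat -> set Y) (c : R) : (0 < c)%R ->
  (forall k, measurable (F k)) -> trivIset setT F ->
  (forall k, (c%:E <= lambda (F k))%E) -> lambda (\bigcup_k F k) = +oo%E.
Proof.
move=> c0 mF tF F1; apply/eqyP => e e0.
rewrite measure_bigcup//.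
have [n hn] : exists n : nat, (e <= c *+ n)%R.
  exists (Num.truncn (e / c)).+1; rewrite -mulr_natr -ler_pdivrMl// mulrC.
  exact/ltW/truncnS_gt.
apply: (@le_trans _ _ (\sum_(0 <= k < n) lambda (F k))%E).
  apply: (@le_trans _ _ (c *+ n)%:E); first by rewrite lee_fin.
  rewrite big_mkord; apply: (@le_trans _ _ (\sum_(i < n) c%:E)%E).
    by rewrite sumEFin lee_fin sumr_const card_ord.
  by apply: lee_sum.
rewrite [leRHS](_ : _ = (\sum_(i <oo) lambda (F i))%E); last first.
  by apply: eq_eseriesl => i; rewrite in_setT.
exact: nneseries_lim_ge.
Qed.

Lemma leb_interval (a b : R) : (0 <= a)%R -> (a <= b)%R ->
  leb ([set t | (a <= t < b)%R] `&` interval_from0 +oo%E) = (b - a)%:E.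
Proof.
move=> a0 ab; rewrite (_ : _ `&` _ = `[a, b[%classic); last first.
  apply/seteqP; split=> t /=; rewrite in_itv/=; first by case.
  by move=> /[dup] /andP[at' _] ->; split => //; split; [exact: le_trans at'|exact: ltry].
rewrite lebesgue_measure_itv/= lte_fin; case: ltP => // ba.
by congr EFin; apply/eqP; rewrite eq_sym subr_eq0 eq_le ab ba.
Qed.

Lemma measurable_Ico (a b : R) : measurable ([set t | (a <= t < b)%R] : set RR).
Proof.
suff -> : [set t | (a <= t < b)%R] = `[a, b[%classic by exact: measurable_itv.
by apply/seteqP; split => t /=; rewrite in_itv.
Qed.

Lemma subset_measure_eq (A : set Y) (t : \bar R) : measurable A -> (0 <= t)%E ->
  (t <= lambda A)%E -> exists B, [/\ measurable B, B `<=` A & lambda B = t].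
Proof.
move=> mA t0 tA; have [tfin|] := boolP (t \is a fin_num); last first.
  rewrite fin_numElt negb_and -!leNgt leeNy_eq leye_eq => /orP[/eqP t1|/eqP t1].
    by rewrite t1 in t0.
  exists A; split => //; apply/eqP; rewrite t1 -leye_eq -[X in (X <= _)%E]t1 //.
have [phi [psi [mphi mpsi h _]]] := iso mA.
have [r r0 tr] : exists2 r, (0 <= r)%R & t = r%:E.
  by exists (fine t); [exact: fine_ge0|rewrite fineK].
pose S := [set s : RR | (0 <= s < r)%R].
have mS : measurable S by exact: measurable_Ico.
exists (A `&` phi @^-1` S); split; [|by move=> x []|].
  by apply: measurableI => //; exact: preimage_measurable.
rewrite h// (_ : S `&` _ = S `&` interval_from0 +oo%E).
  by rewrite leb_interval// subr0.
apply/seteqP; split=> s [/= /andP[s0 sr] _].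
  by split; [exact/andP|split => //; exact: ltry].
split; [exact/andP|split => //].
by apply: lt_le_trans tA; rewrite tr lte_fin.
Qed.

Lemma cut_pinfty (A : set Y) : measurable A -> lambda A = +oo%E ->
  exists D : nat -> set Y, [/\ forall i, measurable (D i), trivIset setT D,
    forall i, D i `<=` A & forall i, lambda (D i) = +oo%E].
Proof.
move=> mA Ay; have [phi [psi [mphi mpsi h _]]] := iso mA.
pose S (k : nat) := [set s : RR | (k%:R <= s < k.+1%:R)%R].
have mS k : measurable (S k) by exact: measurable_Ico.
pose E k := A `&` phi @^-1` (S k).
have mE k : measurable (E k).
  by apply: measurableI => //; exact: preimage_measurable.
have E1 k : lambda (E k) = 1%E.
  rewrite h// Ay leb_interval// ?ler_nat// -natrB// subSnn//.
have tE : trivIset setT E.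
  move=> i j _ _ [x [[_ /= /andP[ia ib]] [_ /= /andP[ja jb]]]].
  apply/eqP; rewrite eqn_leq; apply/andP; split.
    by rewrite -ltnS -(ltr_nat R); exact: le_lt_trans jb.
  by rewrite -ltnS -(ltr_nat R); exact: le_lt_trans ib.
(* The unit pieces are regrouped along a coding of pairs, so that each [D i] receives infinitely
   many of them. *)
pose pr (i k : nat) : nat := pickle (i, k).
have pinj i k j l : pr i k = pr j l -> i = j /\ k = l.
  by move=> /(pcan_inj pickleK) [].
exists (fun i => \bigcup_k E (pr i k)); split.
- by move=> i; apply: bigcup_measurable => k _.
- move=> i j _ _ [x [[k _ Ex] [l _ Ex']]].
  have /pinj[//] : pr i k = pr j l.
  by apply: tE => //; exists x.
- by move=> i x [k _ []].
- move=> i; apply: (@measure_bigcup_pinfty _ 1%R) => //.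
    move=> k l _ _ Ex; have /pinj[//] : pr i k = pr i l.
    exact: tE.
  by move=> k; rewrite E1.
Qed.

Lemma measure_setC_pinfty A : measurable A -> (lambda A < +oo)%E ->
  lambda (~` A) = +oo%E.
Proof.
move=> mA fA; apply: contrapT => /eqP; rewrite -ltey => fC.
have := infY; rewrite -(setUv A) measureU//; [|exact: measurableC|exact: setICr].
by move=> /eqP; rewrite -leye_eq leNgt lte_add_pinfty.
Qed.

(** Disjointness takes care of the complements: when the measure is infinite, each complement
    contains the other set. *)
Lemma homogeneous_disj A B : measurable A -> measurable B -> lambda A = lambda B ->
  A `&` B = set0 -> exists T : G, \forall x \ae lambda, A x <-> B (T $ x).
Proof.
move=> mA mB AB dAB; apply: homogeneous => //.
have [fA|/negP] := boolP (lambda A < +oo)%E.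
  by rewrite !measure_setC_pinfty// -AB.
move/negP; rewrite -leNgt leye_eq => /eqP Ay.
have mAc := measurableC mA; have mBc := measurableC mB.
transitivity (+oo%E : \bar R); last symmetry; apply/eqP; rewrite -leye_eq.
  rewrite -Ay AB; apply: le_measure; rewrite ?inE// => x Bx Ax.
  by rewrite -[False]/(set0 x) -dAB.
rewrite -Ay; apply: le_measure; rewrite ?inE// => x Ax Bx.
by rewrite -[False]/(set0 x) -dAB.
Qed.

Lemma homogeneous_fin A B : measurable A -> measurable B -> lambda A = lambda B ->
  (lambda A < +oo)%E -> exists T : G, \forall x \ae lambda, A x <-> B (T $ x).
Proof.
move=> mA mB AB fA; apply: homogeneous => //.
by rewrite !measure_setC_pinfty// -AB.
Qed.

Lemma measurable_label_if (A : set Y) (a : nat) (f : Y -> nat) : measurable A ->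
  measurable_fun setT f -> measurable_fun setT (fun x => if x \in A then a else f x).
Proof.
move=> mA mf; apply: measurable_fun_ifT => //.
by apply: (measurable_fun_bool true); rewrite setTI preimage_mem_true.
Qed.

Lemma swap_exists A B : measurable A -> measurable B -> lambda A = lambda B ->
  A `&` B = set0 -> exists T : G, [/\ supp (A `|` B) T,
   \forall x \ae lambda, A x -> B (T $ x) & \forall x \ae lambda, B x -> A (T $ x)].
Proof.
move=> mA mB AB dAB; have [T hT] := homogeneous_disj mA mB AB dAB.
have dj x : A x -> B x -> False by move=> Ax Bx; rewrite -[False]/(set0 x) -dAB.
(* The labels 1 and 2 are exchanged between source and target; 0 marks the points that stay
   fixed. *)
pose io x := if x \in A then 1%N else if x \in B then 2%N else 0%N.
pose ka x := if x \in B then 1%N else if x \in A then 2%N else 0%N.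
have ioE x : io x = (if x \in A then 1%N else if x \in B then 2%N else 0%N) by [].
have case3 x : [\/ [/\ A x, io x = 1%N & ka x = 2%N], [/\ B x, io x = 2%N & ka x = 1%N]
    | [/\ ~ A x, ~ B x, io x = 0%N & ka x = 0%N]].
  rewrite /io /ka; have [/set_mem Ax|/negP nA] := boolP (x \in A).
    by constructor 1; rewrite ifF//; apply/negP => /set_mem; exact: dj.
  have [/set_mem Bx|/negP nB] := boolP (x \in B); first by constructor 2.
  by constructor 3; split => // ?; [apply: nA|apply: nB]; rewrite inE.
pose U (i : nat) : G := if i == 1%N then T else if i == 2%N then T^-1 else 1.
have mio : measurable_fun setT io by do 2!(apply: measurable_label_if => //).
have mka : measurable_fun setT ka by do 2!(apply: measurable_label_if => //).
have ioA x : io x = 1%N <-> A x by case: (case3 x) => [[? -> _]|[? -> _]|[? ? -> _]]; split => // /dj.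
have ioB x : io x = 2%N <-> B x.
  by case: (case3 x) => [[h -> _]|[? -> _]|[? ? -> _]]; split => // /(dj _ h).
have kaA x : ka x = 2%N <-> A x by case: (case3 x) => [[? _ ->]|[? _ ->]|[? ? _ ->]]; split => // /dj.
have kaB x : ka x = 1%N <-> B x.
  by case: (case3 x) => [[h _ ->]|[? _ ->]|[? ? _ ->]]; split => // /(dj _ h).
have [|S hS] := @aut_glue _ _ _ lambda io ka U mio mka.
  move=> i; rewrite /U; case: eqP => [->|n1].
    by apply: filterS hT => x; rewrite ioA kaB.
  case: eqP => [->|n2].
    ae_use (ae_map T^-1 hT); ae_use (autKV T); apply: aeW => x h1 h2.
    by rewrite ioB kaA h2 h1.
  have := aut1 lambda; apply: filterS => x ->.
  by case: i n1 n2 => [|[|[|i]]] // _ _; case: (case3 x) => [[_ -> ->]|[_ -> ->]|[_ _ -> ->]].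
exists S; split.
- ae_use hS; ae_use (aut1 lambda); apply: aeW => x h1 [+ _] nAB.
  by case: (case3 x) => [[? _ _]|[? _ _]|[_ _ -> _]]; [case: nAB; left|case: nAB; right|move->].
- by apply: filterS hS => x [_ +] Ax; rewrite (ioA x).2// => /kaB.
- by apply: filterS hS => x [_ +] Ax; rewrite (ioB x).2// => /kaA.
Qed.

(** The labels are shifted by one to keep 0 for the points outside all [D i], where a glued
    automorphism is the identity. *)
Lemma family_label (D : nat -> set Y) : (forall i, measurable (D i)) ->
  trivIset setT D -> exists2 io : Y -> nat, measurable_fun setT io &
    forall x i, io x = i.+1 <-> D i x.
Proof.
move=> mD tD.
have /choice[io hio] x : exists n, forall i, n = i.+1 <-> D i x.
  have [[i Di]|h] := pselect (exists i, D i x).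
    exists i.+1 => j; split => [[<-]//|Dj]; congr S.
    by apply: tD => //; exists x.
  by exists 0%N => i; split => // Di; case: h; exists i.
exists io => // _ A _; rewrite setTI.
have m1 i : measurable [set x | io x = i].
  case: i => [|i].
    rewrite (_ : [set _ | _] = ~` \bigcup_i D i).
      by apply: measurableC; exact: bigcup_measurable.
    apply/seteqP; split=> x /=; first by move=> e [i _ /hio]; rewrite e.
    move=> nD; have := hio x; case: (io x) => // n /(_ n)[/(_ erefl) Dn _].
    by case: nD; exists n.
  by rewrite (_ : [set _ | _] = D i)//; apply/seteqP; split=> x /= /hio.
rewrite (_ : io @^-1` A = \bigcup_(i in A) [set x | io x = i]).
  exact: bigcup_measurable.
by apply/seteqP; split=> [x Ax|x [i Ai /= ix]] /=; [exists (io x)|rewrite ix].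
Qed.

Lemma glue_supp (D : nat -> set Y) (T : nat -> G) : (forall i, measurable (D i)) ->
  trivIset setT D -> (forall i, supp (D i) (T i)) ->
  exists2 S : G, supp (\bigcup_i D i) S &
    forall i, \forall x \ae lambda, D i x -> S $ x = T i $ x.
Proof.
move=> mD tD sT; have [io mio hio] := family_label mD tD.
pose U i : G := if i is j.+1 then T j else 1.
have [|S hS] := @aut_glue _ _ _ lambda io io U mio mio.
  case=> [|i] /=; first by have := aut1 lambda; apply: filterS => x ->.
  by apply: filterS (supp_stable (sT i)) => x; rewrite !hio.
exists S.
  ae_use hS; ae_use (aut1 lambda); apply: aeW => x h1 [+ _] nD.
  case E : (io x) => [|n] /=; first by move->.
  by case: nD; exists n => //; apply/hio.
move=> i; apply: filterS hS => x [+ _] Di.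
by rewrite ((hio x i).2 Di).
Qed.

End Cut.

(** * Recognizing a push-forward as Lebesgue measure *)

Section Push.
Context (R : realType) (d : measure_display) (Y : measurableType d).
Variable lambda : {measure set Y -> \bar R}.
Local Notation leb := (@lebesgue_measure R).
Local Notation RR := (measurableTypeR R).

Lemma measurable_interval_from0 (a : \bar R) : measurable (interval_from0 a).
Proof.
case: a => [r||].
- rewrite (_ : interval_from0 _ = [set t | (0 <= t < r)%R]); first exact: measurable_Ico.
  apply/seteqP; split=> t /=.
    by move=> [t0]; rewrite lte_fin => tr; exact/andP.
  by move=> /andP[t0 tr]; split => //; rewrite lte_fin.
- rewrite (_ : interval_from0 _ = `[0%R, +oo[%classic); first exact: measurable_itv.
  apply/seteqP; split=> t /=; rewrite in_itv/= andbT; first by move=> [].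
  by move=> t0; split => //; exact: ltry.
- rewrite (_ : interval_from0 _ = set0) //.
  by apply/seteqP; split=> // t [_]; rewrite ltNge leNye.
Qed.

Lemma leb_ray (a : \bar R) (b : R) : (0 <= b)%R -> (b%:E <= a)%E ->
  leb (`]-oo, b[%classic `&` interval_from0 a) = b%:E.
Proof.
move=> b0 ba; rewrite -[in RHS](subr0 b) -(leb_interval (lexx 0%R) b0); congr (leb _).
apply/seteqP; split=> t; rewrite /= in_itv/=.
  by move=> [tb [t0 tc]]; split; [exact/andP|split => //; exact: ltry].
move=> [/andP[t0 tb] _]; split => //; split => //.
by apply: lt_le_trans ba; rewrite lte_fin.
Qed.

(** Rays are stable under intersection and generate the Borel sets, so two measures finite on them
    and equal on them coincide. Only [b] between 0 and [lambda Z] has to be tested: below 0 both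
    sides vanish, above [lambda Z] they are constant. *)
Lemma push_interval (Z : set Y) (E : Y -> RR) :
  measurable Z -> measurable_fun setT E ->
  (forall b : R, (0 <= b)%R -> (b%:E <= lambda Z)%E ->
    lambda (Z `&` [set x | ((E x : R) < b)%R]) = b%:E) ->
  forall S, measurable S -> lambda (Z `&` E @^-1` S) = leb (S `&` interval_from0 (lambda Z)).
Proof.
move=> mZ mE h S mS.
pose m1 := measure_function_pushforward__canonical__measure_function_Measure
  (mrestr lambda mZ) mE.
pose m2 : {measure set RR -> \bar R} := mrestr leb (measurable_interval_from0 (lambda Z)).
suff : m1 S = m2 S by rewrite /m1 /= /pushforward /mrestr setIC.
have mray (b : R) : measurable (Z `&` [set x | ((E x : R) < b)%R]).
  apply: measurableI => //; rewrite (_ : [set _ | _] = E @^-1` `]-oo, b[%classic).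
    by apply: preimage_measurable => //; exact: measurable_itv.
  by apply/seteqP; split=> x /=; rewrite in_itv.
have m1E (b : R) : m1 (`]-oo, b[%classic : set RR) = lambda (Z `&` [set x | ((E x : R) < b)%R]).
  rewrite /m1 /= /pushforward /mrestr.
  by congr (lambda _); rewrite setIC; congr (_ `&` _); apply/seteqP; split=> x /=; rewrite in_itv.
pose ray (k : nat) : set RR := `]-oo, (k%:R : R)[%classic.
apply: (@measure_unique _ R RR (@RGenInftyO.G R) ray _ _ _ _ m1 m2) => //.
- exact: RGenInftyO.measurableE.
- move=> _ _ [x ->] [y ->]; exists (Num.min x y).
  apply/seteqP; split=> t; rewrite /= !in_itv/= lt_min; first by move=> [-> ->].
  by move=> /andP[].
- by move=> i; exists i%:R.
- apply/seteqP; split=> // t _; exists (Num.truncn (t : R)).+1 => //.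
  by rewrite /ray /= in_itv/=; exact: truncnS_gt.
- move=> _ [b ->]; rewrite m1E; change (lambda (Z `&` [set x | ((E x : R) < b)%R]) = leb (`]-oo, b[%classic `&` interval_from0 (lambda Z))); have [b0|b0] := leP 0%R b; last first.
    rewrite [RHS](_ : _ = 0%E); last first.
      rewrite (_ : _ `&` _ = set0) ?measure0//; apply/seteqP; split=> // t.
      by rewrite /= in_itv/= => -[tb [t0 _]]; have := le_lt_trans t0 (lt_trans tb b0); rewrite ltxx.
    apply/eqP; rewrite -measure_le0 -[leRHS]/((0%R : R)%:E) -(h 0%R)//.
    by apply: le_measure; rewrite ?inE// => x [Zx /= xb]; split => //=; exact: lt_trans b0.
  have [bc|cb] := leP b%:E (lambda Z); first by rewrite leb_ray// h.
  have fZ : lambda Z \is a fin_num by rewrite ge0_fin_numE// (lt_trans cb)// ltry.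
  have cZ := fineK fZ; set c := fine _ in cZ.
  have c0 : (0 <= c)%R by exact: fine_ge0.
  have cE : (c%:E <= lambda Z)%E by rewrite cZ.
  rewrite (_ : _ `&` interval_from0 _ = `]-oo, c[%classic `&` interval_from0 (lambda Z)); last first.
    apply/seteqP; split=> t; rewrite /= !in_itv/= => -[tb [t0 tc]]; split => //.
      by rewrite -lte_fin cZ.
    by rewrite -lte_fin; apply: lt_trans cb.
  rewrite leb_ray//; apply/eqP; rewrite eq_le; apply/andP; split.
    by rewrite cZ; apply: le_measure; rewrite ?inE// => x [].
  rewrite -(h c)//; apply: le_measure; rewrite ?inE// => x [Zx /= xc]; split => //=.
  by apply: lt_trans xc _; rewrite -lte_fin cZ.
- move=> k; rewrite m1E; have [kZ|Zk] := leP (k%:R : R)%:E (lambda Z).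
    by rewrite h// ltry.
  apply: (@le_lt_trans _ _ (lambda Z)); last by rewrite (lt_trans Zk)// ltry.
  by apply: le_measure; rewrite ?inE// => x [].
Qed.

End Push.

(** * Standard measures are Lebesgue measures *)

(** Measurable choice of the least index; where no index qualifies the value is 0 by default. *)
Lemma measurable_first d (T : measurableType d) (P : nat -> T -> Prop) :
  (forall n, measurable [set t | P n t]) ->
  exists h : T -> nat, [/\ measurable_fun setT h,
    forall t, (exists n, P n t) -> P (h t) t &
    forall t n, P n t -> (forall m, (m < n)%N -> ~ P m t) -> h t = n].
Proof.
move=> mP; pose first t n := P n t /\ forall m, (m < n)%N -> ~ P m t.
have uniq t m n : first t m -> first t n -> m = n.
  move=> [Pm hm] [Pn hn]; case: (ltngtP m n) => // h; first by case: (hn m h).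
  by case: (hm n h).
have ex t n : P n t -> exists m, first t m.
  elim/ltn_ind: n => n ih Pn; have [[m [mn Pm]]|nm] := pselect (exists m, (m < n)%N /\ P m t).
    exact: ih mn Pm.
  by exists n; split => // m mn Pm; apply: nm; exists m.
have /choice[h hh] : forall t, exists n, first t n \/ (n = 0%N /\ forall m, ~ P m t).
  move=> t; have [[n Pn]|nP] := pselect (exists n, P n t).
    by have [m hm] := ex t n Pn; exists m; left.
  by exists 0%N; right; split => // m Pm; apply: nP; exists m.
have mfirst n : measurable [set t | first t n].
  rewrite (_ : [set _ | _] = [set t | P n t] `&` \bigcap_(m in `I_n) ~` [set t | P m t]).
    by apply: measurableI => //; apply: bigcap_measurableType => m _; exact: measurableC.
  by apply/seteqP; split=> t [Pn hn]; split => // m mn; exact: hn.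
exists h; split.
- move=> _ S mS; rewrite setTI.
  rewrite (_ : h @^-1` S = (\bigcup_(n in S) [set t | first t n]) `|`
    ([set _ | S 0%N] `&` \bigcap_m ~` [set t | P m t])).
    apply: measurableU; first by apply: bigcup_measurable => n _.
    have [S0|nS0] := pselect (S 0%N).
      rewrite (_ : [set _ | _] = setT); last by apply/seteqP; split.
      rewrite setTI; apply: bigcap_measurableType => m _; exact: measurableC.
    by rewrite (_ : [set _ | _] = set0) ?set0I//; apply/seteqP; split.
  apply/seteqP; split=> t /=.
    by move=> Sh; case: (hh t) => [ht|[h0 nP]]; [left; exists (h t)|right; split; [rewrite -h0|move=> m _; exact: nP]].
  move=> [[n Sn ft]|[S0 nP]]; case: (hh t) => [ht|[h0 nP']].
  + by rewrite (uniq _ _ _ ht ft).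
  + by case: ft => /nP'.
  + by case: ht => /(nP (h t) I).
  + by rewrite h0.
- move=> t [n Pn]; case: (hh t) => [[]//|[_ nP]]; by case: (nP n).
- move=> t n Pn hn; case: (hh t) => [ht|[_ nP]]; last by case: (nP n).
  exact: uniq ht (conj Pn hn).
Qed.

(** * From binary words to positions in an interval *)

Section Words.
Context (R : realType) (d : measure_display) (Y : measurableType d).
Variable lambda : {measure set Y -> \bar R}.
Local Notation leb := (@lebesgue_measure R).
Local Notation RR := (measurableTypeR R).

Lemma measure_bigcup_le (F : nat -> set Y) (b : \bar R) : (forall n, measurable (F n)) ->
  (forall n, F n `<=` F n.+1) -> (forall n, (lambda (F n) <= b)%E) -> (lambda (\bigcup_n F n) <= b)%E.
Proof.
move=> mF inc hb; have h : lambda \o F @ \oo --> lambda (\bigcup_n F n).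
  apply: nondecreasing_cvg_mu => //; first exact: bigcupT_measurable.
  by apply/nondecreasing_seqP => n; apply/subsetPset; exact: inc.
rewrite -(cvg_lim _ h)//; apply: lime_le; [by apply/cvg_ex; eexists; exact: h|exact: nearW].
Qed.

Lemma le_measure_bigcap (F : nat -> set Y) (b : \bar R) : (forall n, measurable (F n)) ->
  (forall n, F n.+1 `<=` F n) -> (lambda (F 0%N) < +oo)%E ->
  (forall n, (b <= lambda (F n))%E) -> (b <= lambda (\bigcap_n F n))%E.
Proof.
move=> mF dec fin hb; have h : lambda \o F @ \oo --> lambda (\bigcap_n F n).
  apply: nonincreasing_cvg_mu => //; first exact: bigcapT_measurable.
  by apply/nonincreasing_seqP => n; apply/subsetPset; exact: dec.
rewrite -(cvg_lim _ h)//; apply: lime_ge; [by apply/cvg_ex; eexists; exact: h|exact: nearW].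
Qed.

Variables (A : set Y) (ka : Y -> nat) (bit : nat -> Y -> bool).
Hypothesis mA : measurable A.
Hypothesis mka : measurable_fun setT ka.
Hypothesis fka : forall k, (lambda (A `&` [set y | ka y = k]) < +oo)%E.
Hypothesis mbit : forall n, measurable [set y | bit n y].

(** An integer rather than a list of digits: [ka y] is an unbounded leading digit, appending a bit
    doubles the number, and the lexicographic order on words of equal length is the order of
    [nat]. *)
Fixpoint word N y := if N is n.+1 then ((word n y).*2 + bit n y)%N else ka y.

Hypothesis null : forall y, lambda (A `&` [set y' | forall N, word N y' = word N y]) = 0%E.

Lemma measurable_word N : measurable_fun setT (word N).
Proof.
elim: N => [//|N ih] _ S mS; rewrite setTI.
have mb : measurable_fun setT (fun y => nat_of_bool (bit N y)).
  move=> _ B mB; rewrite setTI.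
  rewrite (_ : _ @^-1` B = ([set _ | B 1%N] `&` [set y | bit N y]) `|`
     ([set _ | B 0%N] `&` ~` [set y | bit N y])).
    have cst (Q : Prop) : measurable [set _ : Y | Q].
      have [q|nq] := pselect Q; first by rewrite (_ : [set _ | _] = setT)//; apply/seteqP; split.
      by rewrite (_ : [set _ | _] = set0)//; apply/seteqP; split.
    by apply: measurableU; apply: measurableI => //; exact: measurableC.
  apply/seteqP; split=> y /=; case: (bit N y) => /=; [by left|by right; split| |].
    by move=> [[]|[_ /(_ isT)]].
  by move=> [[]|[]].
exact: (measurable_rel (fun a b => S (a.*2 + b)%N) ih mb).
Qed.

Let mlt N k : measurable [set y | (word N y < k)%N].
Proof.
by apply: (@preimage_measurable _ _ _ _ (word N) [set i | (i < k)%N]) => //; exact: measurable_word.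
Qed.

Let mAlt N k : measurable (A `&` [set y | (word N y < k)%N]).
Proof. exact: measurableI. Qed.

Lemma word_ge N y : (ka y <= word N y)%N.
Proof. by elim: N => [//|N ih] /=; lia. Qed.

(** [word N y < k] forces [ka y < k], and only finitely many pieces of finite measure are left. *)
Lemma fin_word N k : lambda (A `&` [set y | (word N y < k)%N]) \is a fin_num.
Proof.
rewrite ge0_fin_numE//; apply: (@le_lt_trans _ _ (lambda (A `&` [set y | (word 0 y < k)%N]))).
  by apply: le_measure; rewrite ?inE// => y [Ay /= h]; split => //=; exact: leq_ltn_trans (word_ge N y) h.
elim: k => [|k ih]; first by rewrite (_ : _ `&` _ = set0) ?measure0//; apply/seteqP; split=> // y [].
have m1 : measurable (A `&` [set y | ka y = k]) by apply: measurableI => //; exact: label_measurable.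
apply: (@le_lt_trans _ _ (lambda ((A `&` [set y | (word 0 y < k)%N]) `|` (A `&` [set y | ka y = k])))).
  apply: le_measure; rewrite ?inE//; first exact: measurableU.
  move=> y [Ay /=]; rewrite ltnS leq_eqVlt => /orP[/eqP e|lt]; [by right|by left].
apply: (le_lt_trans (measureU2 _ (mAlt 0 k) m1)).
by apply: lte_add_pinfty; [exact: ih|exact: fka].
Qed.

(** The pieces of a level are laid side by side on the half-line in the order of their words;
    [lo N k] is the left end of the interval given to the word [k]. *)
Definition lo N k : R := fine (lambda (A `&` [set y | (word N y < k)%N])).

Lemma loE N k : (lo N k)%:E = lambda (A `&` [set y | (word N y < k)%N]).
Proof. by rewrite fineK// fin_word. Qed.

Lemma lo_le N k k' : (k <= k')%N -> (lo N k <= lo N k')%R.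
Proof.
move=> kk; rewrite -lee_fin !loE; apply: le_measure; rewrite ?inE// => y [Ay /= h].
by split => //=; exact: leq_trans kk.
Qed.

Lemma lo_double N k : lo N.+1 k.*2 = lo N k.
Proof.
congr (fine (lambda _)); apply/seteqP; split=> y [Ay /= h]; split => //=; case: (bit N y) h => /=; lia.
Qed.

Lemma lo_S N k : (lo N k.+1)%:E = ((lo N k)%:E + lambda (A `&` [set y | word N y = k]))%E.
Proof.
rewrite !loE -measureU//.
- congr (lambda _); apply/seteqP; split=> y /=.
    by rewrite ltnS leq_eqVlt => -[Ay /orP[/eqP e|lt]]; [right|left].
  by move=> [[Ay h]|[Ay ->]]; split => //; exact: ltnW.
- by apply: measurableI => //; apply: label_measurable; exact: measurable_word.
- by apply/seteqP; split=> // y [[_ /= +] [_ /= e]]; rewrite e ltnn.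
Qed.

Let f N y : R := lo N (word N y).
Let g N y : R := lo N (word N y).+1.

Let fS N y : (f N y <= f N.+1 y)%R.
Proof. by rewrite /f -lo_double; apply: lo_le => /=; lia. Qed.

Let gS N y : (g N.+1 y <= g N y)%R.
Proof. by rewrite /g -(lo_double N); apply: lo_le => /=; case: (bit N y); lia. Qed.

Let f_le N M y : (N <= M)%N -> (f N y <= f M y)%R.
Proof. by move=> /subnK <-; elim: (M - N)%N => // k ih; exact: le_trans ih (fS _ _). Qed.

Let g_le N M y : (N <= M)%N -> (g M y <= g N y)%R.
Proof. by move=> /subnK <-; elim: (M - N)%N => // k ih; exact: le_trans (gS _ _) ih. Qed.

Let fg N M y : (f N y <= g M y)%R.
Proof.
apply: (le_trans (f_le y (leq_maxl N M))); apply: le_trans (g_le y (leq_maxr N M)).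
exact: lo_le.
Qed.

(** [g N y - f N y] is the measure of the piece of [y] at level [N]. These pieces decrease, have
    finite measure, and meet in a set that is null by hypothesis. *)
Let gap y (e : R) : (0 < e)%R -> exists N, (g N y < f N y + e)%R.
Proof.
move=> e0; pose F N := A `&` [set y' | forall n, (n <= N)%N -> word n y' = word n y].
have mF N : measurable (F N).
  apply: measurableI => //; rewrite (_ : [set _ | _] = \bigcap_(n in `I_N.+1) [set y' | word n y' = word n y]).
    by apply: bigcap_measurableType => n _; apply: label_measurable; exact: measurable_word.
  by apply/seteqP; split=> y' h n; exact: h.
have FE N : F N = A `&` [set y' | word N y' = word N y].
  apply/seteqP; split=> y' [Ay h]; split => //=; first exact: h.
  move=> n nN; move: h => /=; rewrite -(subnK nN); elim: (N - n)%N => // k ih.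
  by rewrite addSn /= => h; apply: ih; move: h; case: (bit _ y'); case: (bit _ y); lia.
apply: contrapT => h; have : (e%:E <= lambda (\bigcap_N F N))%E.
  apply: le_measure_bigcap => //.
  - by move=> n y' [Ay h']; split => // m mn; apply: h'; exact: leqW.
  - apply: (@le_lt_trans _ _ (lambda (A `&` [set y' | ka y' = ka y]))) => //.
    apply: le_measure; rewrite ?inE//; last by move=> y' [Ay /(_ 0%N (leqnn _))].
    by apply: measurableI => //; exact: label_measurable.
  - move=> N; have gN : (f N y + e <= g N y)%R.
      by rewrite leNgt; apply/negP => h'; apply: h; exists N.
    rewrite FE; have := lo_S N (word N y); rewrite -/(g N y) -/(f N y).
    have fin : lambda (A `&` [set y' | word N y' = word N y]) \is a fin_num.
      rewrite ge0_fin_numE//; apply: (@le_lt_trans _ _ (lambda (A `&` [set y' | (word N y' < (word N y).+1)%N]))).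
        apply: le_measure; rewrite ?inE//; last by move=> y' [Ay /= ->].
        by apply: measurableI => //; apply: label_measurable; exact: measurable_word.
      by rewrite -ge0_fin_numE// fin_word.
    by rewrite -(fineK fin) -EFinD => -[e1]; rewrite lee_fin -(lerD2l (f N y)) -e1.
rewrite (_ : \bigcap_N F N = A `&` [set y' | forall N, word N y' = word N y]) ?null ?lee_fin ?leNgt ?e0//.
apply/seteqP; split=> y' h'; last by case: h' => Ay h' N _; split => // n _; exact: h'.
by split => [|N /=]; [case: (h' 0%N I)|have [_] := h' N I; exact].
Qed.

(** The common point of the nested intervals attached to the words of [y], as the supremum of their
    left ends; the form [sups] gives measurability at once. *)
Definition position y : RR := sups (f ^~ y) 0.

Let posE y : position y = sup (range (f ^~ y)).
Proof. by rewrite /position /sups /sdrop; congr sup; apply/seteqP; split=> t [n _ <-]; exists n. Qed.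

Let fub y : has_ubound (range (f ^~ y)).
Proof. by exists (g 0%N y) => _ [n _ <-]; exact: fg. Qed.

Lemma lo_position N y : (lo N (word N y) <= position y)%R.
Proof. by rewrite posE; apply: ub_le_sup => //; exists N. Qed.

Lemma position_lo N y : ((position y : R) <= lo N (word N y).+1)%R.
Proof.
rewrite posE; apply: ge_sup; first by exists (f 0%N y), 0%N.
by move=> _ [n _ <-]; exact: fg.
Qed.

Lemma measurable_position : measurable_fun setT position.
Proof.
apply: measurable_fun_sups => // n _ S mS; rewrite setTI.
exact: (preimage_measurable (A := [set k | S (lo n k)]) (measurable_word n)).
Qed.

Lemma lo_unbounded N (b : R) : (b%:E < lambda A)%E -> exists k, (b < lo N k)%R.
Proof.
move=> bA; apply: contrapT => h; move: bA; apply/negP; rewrite -leNgt.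
rewrite (_ : A = \bigcup_k (A `&` [set y | (word N y < k)%N])); last first.
  apply/seteqP; split=> [y Ay|y [k _ []]//].
  by exists (word N y).+1 => //; split => //=.
apply: measure_bigcup_le => [k|k y [Ay /= yk]|k].
- exact: mAlt.
- by split => //=; exact: leqW.
- by rewrite -loE lee_fin leNgt; apply/negP => bk; apply: h; exists k.
Qed.

(** Upper bound: by [gap], the points below [b] are exhausted by those whose interval ends below [b]
    at some level, and at one level these fill intervals ending below [b]. Lower bound: for
    [b' < b], the points whose left end is at most [b'] have measure at least [b'] at each level,
    and those for which this holds at all levels have position at most [b']. *)
Lemma measure_position (b : R) : (0 <= b)%R -> (b%:E <= lambda A)%E ->
  lambda (A `&` [set y | ((position y : R) < b)%R]) = b%:E.
Proof.
move=> b0 bA.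
have mp : measurable (A `&` [set y | ((position y : R) < b)%R]).
  apply: measurableI => //; rewrite (_ : [set _ | _] = position @^-1` `]-oo, b[%classic).
    by apply: preimage_measurable; [exact: measurable_position|exact: measurable_itv].
  by apply/seteqP; split=> y /=; rewrite in_itv.
have mw N (Q : nat -> Prop) : measurable (A `&` [set y | Q (word N y)]).
  by apply: measurableI => //; exact: (preimage_measurable (A := [set k | Q k]) (measurable_word N)).
apply/eqP; rewrite eq_le; apply/andP; split.
  pose U N := A `&` [set y | (g N y < b)%R].
  have mU N : measurable (U N) by exact: (mw N (fun k => lo N k.+1 < b)%R).
  apply: (@le_trans _ _ (lambda (\bigcup_N U N))).
    apply: le_measure; rewrite ?inE//; first exact: bigcupT_measurable.
    move=> y [Ay /= yb]; have e0 : (0 < b - position y)%R by rewrite subr_gt0.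
    have [N hN] := gap y e0; exists N => //; split => //=.
    apply: (lt_le_trans hN); rewrite -lerBrDr; have := lo_position N y; rewrite -/(f N y); lra.
  apply: measure_bigcup_le => //.
    by move=> N y [Ay /= h]; split => //=; exact: le_lt_trans (gS N y) h.
  move=> N; rewrite (_ : U N = \bigcup_n (A `&` [set y | (g N y < b)%R /\ (word N y < n)%N])); last first.
    apply/seteqP; split=> [y [Ay h]|y [n _ [Ay []]]//].
    by exists (word N y).+1 => //; split.
  apply: measure_bigcup_le => [n|n y [Ay /= [h1 h2]]|].
  - exact: (mw N (fun k => (lo N k.+1 < b)%R /\ (k < n)%N)).
  - by split => //; split => //; exact: leqW.
  elim=> [|n ih].
    by rewrite (_ : _ `&` _ = set0) ?measure0 ?lee_fin//; apply/seteqP; split=> // y [_ []].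
  have [lt|ge] := ltP (lo N n.+1) b.
    apply: (@le_trans _ _ (lo N n.+1)%:E); last by rewrite lee_fin ltW.
    rewrite loE; apply: le_measure; rewrite ?inE//.
      exact: (mw N (fun k => (lo N k.+1 < b)%R /\ (k < n.+1)%N)).
    by move=> y [Ay /= []].
  apply: le_trans ih; apply: le_measure; rewrite ?inE//.
  - exact: (mw N (fun k => (lo N k.+1 < b)%R /\ (k < n.+1)%N)).
  - exact: (mw N (fun k => (lo N k.+1 < b)%R /\ (k < n)%N)).
  - move=> y [Ay [/= h1]]; rewrite ltnS leq_eqVlt => /orP[/eqP e|lt]; last by split.
    by move: h1; rewrite /g e ltNge ge.
have low (b' : R) : (0 <= b')%R -> (b' < b)%R ->
    (b'%:E <= lambda (A `&` [set y | ((position y : R) < b)%R]))%E.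
  move=> b'0 b'b; have unb N : exists k, (b' < lo N k)%R.
    by apply: lo_unbounded; apply: lt_le_trans bA; rewrite lte_fin.
  pose V N := A `&` [set y | (f N y <= b')%R].
  have mV N : measurable (V N) by exact: (mw N (fun k => lo N k <= b')%R).
  apply: (@le_trans _ _ (lambda (\bigcap_N V N))); last first.
    apply: le_measure; rewrite ?inE//; first exact: bigcapT_measurable.
    move=> y h; split; first by case: (h 0%N I).
    apply: le_lt_trans b'b; rewrite posE; apply: ge_sup; first by exists (f 0%N y), 0%N.
    by move=> _ [n _ <-]; have [] := h n I.
  apply: le_measure_bigcap => //.
  - by move=> N y [Ay /= h]; split => //=; exact: le_trans (fS N y) h.
  - have [k hk] := unb 0%N.
    apply: (@le_lt_trans _ _ (lambda (A `&` [set y | (word 0 y < k)%N]))); last first.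
      by rewrite -ge0_fin_numE// fin_word.
    apply: le_measure; rewrite ?inE// => y [Ay /= h]; split => //=.
    rewrite ltnNge; apply/negP => h'; have := lt_le_trans hk (le_trans (lo_le 0 h') h).
    by rewrite ltxx.
  - move=> N; have ex := unb N; case: (ex_minnP ex) => k hk kmin.
    apply: (@le_trans _ _ (lo N k)%:E); first by rewrite lee_fin ltW.
    rewrite loE; apply: le_measure; rewrite ?inE// => y [Ay /= yk]; split => //=.
    rewrite leNgt; apply/negP => /kmin; by rewrite leqNgt yk.
have [/eqP b00|bn0] := boolP (b == 0)%R; first by rewrite b00.
have b_gt0 : (0 < b)%R by rewrite lt_neqAle eq_sym bn0.
apply/lee_addgt0Pr => e e0.
have [be|eb] := leP b e.
  by apply: (@le_trans _ _ e%:E); [rewrite lee_fin|rewrite leeDr].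
rewrite -leeBlDr// -EFinB; apply: low; first by rewrite subr_ge0 ltW.
by rewrite ltrBlDr ltrDl.
Qed.

Lemma position_push S : measurable S ->
  lambda (A `&` position @^-1` S) = leb (S `&` interval_from0 (lambda A)).
Proof.
apply: push_interval => //; first exact: measurable_position.
by move=> b b0 bA; exact: measure_position.
Qed.

(** The countably many ends [lo N k] are Lebesgue-null, so almost no point sits on one. Strictness
    on the right is what lets the position determine the words. *)
Lemma position_generic : \forall y \ae lambda, A y -> forall N,
  (lo N (word N y) < position y < lo N (word N y).+1)%R.
Proof.
have : \forall y \ae lambda, forall N k, A y -> position y <> lo N k.
  apply: ae_foralln => N; apply: ae_foralln => k.
  have ms : measurable ([set lo N k] : set RR) by exact: measurable_set1.
  exists (A `&` position @^-1` [set lo N k]); split.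
  - by apply: measurableI => //; apply: preimage_measurable => //; exact: measurable_position.
  - rewrite position_push//; apply/eqP; rewrite -measure_le0.
    apply: (@le_trans _ _ (leb [set lo N k])); last by rewrite (lebesgue_measure_set1 (lo N k)).
    apply: le_measure; rewrite ?inE//.
    by apply: measurableI => //; exact: measurable_interval_from0.
  - by move=> y /= /not_implyP[Ay /contrapT].
apply: filterS => y h Ay N; rewrite !lt_neqAle lo_position position_lo !andbT.
by apply/andP; split; apply/eqP => e; [apply: (h N (word N y) Ay)|apply: (h N (word N y).+1 Ay)].
Qed.

Lemma decode_word : exists K : nat -> RR -> nat, (forall N, measurable_fun setT (K N)) /\
  \forall y \ae lambda, A y -> forall N, K N (position y) = word N y.
Proof.
have /choice[K hK] : forall N, exists K : RR -> nat, measurable_fun setT K /\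
    forall t n, ((t : R) < lo N n.+1)%R -> (forall m, (m < n)%N -> ~ ((t : R) < lo N m.+1)%R) -> K t = n.
  move=> N; have [|K [mK _ hK]] := @measurable_first _ RR (fun n (t : RR) => ((t : R) < lo N n.+1)%R).
    move=> n; rewrite (_ : [set _ | _] = `]-oo, (lo N n.+1)[%classic); first exact: measurable_itv.
    by apply/seteqP; split=> t /=; rewrite in_itv.
  by exists K.
exists K; split; first by move=> N; case: (hK N).
apply: filterS position_generic => y hy Ay N; have [_ h] := hK N.
have /andP[h1 h2] := hy Ay N; apply: h => // m mw; apply/negP; rewrite -leNgt.
exact: le_trans (lo_le N mw) (ltW h1).
Qed.

End Words.

(** * Recovering a point of a Polish space from small balls *)

Section Polish.
Context (R : realType) (X : completePseudoMetricType R).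
Hypothesis hausX : hausdorff_space X.
Variable p : nat -> X.
Hypothesis pdense : forall O : set X, open O -> O !=set0 -> exists i, O (p i).

Let e (j : nat) : R := (1 / 2 ^+ j)%R.

Let e_gt0 j : (0 < e j)%R. Proof. by rewrite /e divr_gt0// exprn_gt0. Qed.

Let eS j : e j = (2%:R * e j.+1)%R.
Proof. by rewrite /e exprS; field; rewrite expf_neq0. Qed.

Let e_small (r : R) : (0 < r)%R -> exists j, (e j < r)%R.
Proof.
move=> r0; exists (Num.truncn (1 / r)).+1; rewrite /e ltr_pdivrMr ?exprn_gt0//.
rewrite mulrC -ltr_pdivrMr//; apply: lt_le_trans (truncnS_gt _) _.
by rewrite -natrX ler_nat; apply: ltnW; apply: ltn_expl.
Qed.

(** The steps [2 * e j], [2 * e j.+1], ... add up to at most [4 * e j], and one more [e j] is spent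
    on reaching the limit. *)
Lemma fast_limit (x : nat -> X) : (forall j, ball (x j) (2%:R * e j)%R (x j.+1)) ->
  exists z, forall j, ball (x j) (5%:R * e j)%R z.
Proof.
move=> hx; have far k j : ball (x j) (4%:R * e j)%R (x (k + j)%N).
  elim: k j => [|k ih] j; first by apply: ballxx; rewrite mulr_gt0.
  have -> : (4%:R * e j = 2%:R * e j + 4%:R * e j.+1)%R by rewrite eS; lra.
  by apply: (ball_triangle (hx j)); rewrite addSnnS.
have cx : cvg (x @ \oo).
  apply: cauchy_cvg; apply: cauchy_exP => r r0.
  have r4 : (0 < r / 4%:R)%R by rewrite divr_gt0.
  have [j hj] := e_small r4; exists (x j); exists j => // n /= jn.
  apply: (le_ball (e1 := (4%:R * e j)%R)); first by move: hj; rewrite ltr_pdivlMr// mulrC => /ltW.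
  by rewrite -(subnK jn); exact: far.
exists (lim (x @ \oo)) => j; have [n _ hn] := cvg_ball cx (e_gt0 j).
have -> : (5%:R * e j = 4%:R * e j + e j)%R by lra.
apply: (ball_triangle (y := x (n + j)%N)); first exact: far.
by apply: ball_sym; apply: hn; exact: leq_addr.
Qed.

(** Interiors are taken because a [ball] need not be open, while these sets must be Borel. *)
Definition small_ball i j : set X := interior (ball (p i) (e j)).

Lemma small_ball_cover x j : exists i, small_ball i j x.
Proof.
have e2 : (0 < e j / 2)%R by rewrite divr_gt0.
have [||i hi] := @pdense (interior (ball x (e j / 2))); first exact: open_interior.
  by exists x; exact: nbhsx_ballx.
exists i; apply: (@filterS _ _ _ (ball x (e j / 2)) (ball (p i) (e j)) _ (nbhsx_ballx x _ e2)) => y xy.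
rewrite [e j]splitr; apply: (ball_triangle (y := x)) => //.
by apply: ball_sym; exact: interior_subset hi.
Qed.

Lemma ball_eq (x y : X) : (forall j, ball x (10%:R * e j)%R y) -> x = y.
Proof.
move=> h; apply: (close_eq hausX); rewrite ball_close => r.
have r10 : (0 < r%:num / 10%:R)%R by rewrite divr_gt0.
have [j hj] := e_small r10; apply: le_ball (h j).
by move: hj; rewrite ltr_pdivlMr// mulrC => /ltW.
Qed.

Lemma small_ball_separates x y :
  (forall i j, small_ball i j x -> small_ball i j y) -> x = y.
Proof.
move=> h; apply: ball_eq => j; have [i hi] := small_ball_cover x j.
have hi' := h i j hi; apply: (le_ball (e1 := (e j + e j)%R)).
  by have := e_gt0 j; lra.
apply: (ball_triangle (y := p i)); last exact: interior_subset hi'.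
by apply: ball_sym; exact: interior_subset hi.
Qed.

(* A point is a Borel function of the sequence of the small balls around it. *)
Lemma point_of_small_balls d (T : measurableType d) (c : nat -> T -> nat) :
  (forall j, measurable_fun setT (c j)) ->
  exists xi : T -> X, (forall B, <<s open >> B -> measurable (xi @^-1` B)) /\
    forall t x, (forall j, small_ball (c j t) j x) -> xi t = x.
Proof.
move=> mc; pose C := [set t | forall j, ball (p (c j t)) (2%:R * e j)%R (p (c j.+1 t))].
have mC : measurable C.
  rewrite (_ : C = \bigcap_j [set t | ball (p (c j t)) (2%:R * e j)%R (p (c j.+1 t))]).
    apply: bigcapT_measurable => j.
    exact: (measurable_rel (fun a b => ball (p a) (2%:R * e j)%R (p b)) (mc j) (mc j.+1)).
  by apply/seteqP; split=> t h j; [move=> _; exact: h|exact: (h j I)].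
have /choice[xi hxi] : forall t, exists z, (C t -> forall j, ball (p (c j t)) (5%:R * e j)%R z) /\
    (~ C t -> z = point).
  move=> t; have [Ct|nC] := pselect (C t); last by exists point.
  by have [z hz] := fast_limit Ct; exists z.
exists xi; split; last first.
  move=> t x hx; have b j : ball (p (c j t)) (e j) x by exact: interior_subset (hx j).
  have Ct : C t.
    move=> j; apply: (le_ball (e1 := (e j + e j.+1)%R)).
      by have := e_gt0 j.+1; have := eS j; lra.
    by apply: (ball_triangle (b j)); apply: ball_sym; exact: b.
  apply: ball_eq => j; apply: (le_ball (e1 := (5%:R * e j + e j)%R)).
    by have := e_gt0 j; lra.
  by apply: (ball_triangle (y := p (c j t))); [apply: ball_sym; exact: (hxi t).1|exact: b].
have mO (O : set X) : open O -> measurable (xi @^-1` O).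
  (* The radius [8 * e j] exceeds [5 * e j], so such a ball contains [xi t]; conversely it lies in
     the ball of radius [13 * e j] around [xi t], which is inside [O] for large [j]. *)
  move=> oO; rewrite (_ : xi @^-1` O =
     (C `&` \bigcup_j [set t | ball (p (c j t)) (8%:R * e j)%R `<=` O]) `|` (~` C `&` [set t | O point])).
    apply: measurableU; apply: measurableI => //.
    - apply: bigcupT_measurable => j.
      exact: (measurable_rel (fun a _ => ball (p a) (8%:R * e j)%R `<=` O) (mc j) (mc j)).
    - exact: measurableC.
    - have [q|nq] := pselect (O point); first by rewrite (_ : [set _ | _] = setT)//; apply/seteqP; split.
      by rewrite (_ : [set _ | _] = set0)//; apply/seteqP; split.
  apply/seteqP; split=> t /=.
    move=> Ot; have [Ct|nC] := pselect (C t); last by right; split => //; rewrite -((hxi t).2 nC).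
    left; split => //; have /nbhs_ballP[r /= r0 hr] : nbhs (xi t) O by exact: open_nbhs_nbhs.
    have r13 : (0 < r / 13%:R)%R by rewrite divr_gt0.
    have [j hj] := e_small r13; exists j => // z hz; apply: hr.
    apply: (le_ball (e1 := (5%:R * e j + 8%:R * e j)%R)).
      by move: hj; rewrite ltr_pdivlMr//; lra.
    by apply: ball_triangle hz; apply: ball_sym; exact: (hxi t).1.
  move=> [[Ct [j _ h]]|[nC Op]]; last by rewrite (hxi t).2.
  by apply: h; apply: le_ball ((hxi t).1 Ct j); rewrite ler_pM2r// ler_nat.
move=> B hB; suff : <<s open >> `<=` [set B | measurable (xi @^-1` B)] by apply.
apply: smallest_sub; last by move=> O /mO.
split.
- by rewrite /= preimage_set0.
- by move=> A /= mA; rewrite setTD preimage_setC; exact: measurableC.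
- by move=> F hF /=; rewrite preimage_bigcup; exact: bigcupT_measurable.
Qed.

End Polish.

(** A point is coded by the piece of a sigma-finite cover in which it lies, followed by its
    memberships in countably many basic open sets. Its position in the interval gives back the
    digits, the digits give small balls around the point, and these give the point in a Borel
    way. *)
Lemma standard_lebesgue_like (R : realType) (d : measure_display) (Y : measurableType d)
    (lambda : {measure set Y -> \bar R}) : standard_borel R Y -> nonatomic lambda ->
  sigma_finite setT lambda -> lebesgue_like lambda.
Proof.
move=> [X [f [hausX [D cD dD] [g fK gK] mf]]] na [F FT hF] A mA.
have [p pD] : exists p : nat -> X, forall O : set X, open O -> O !=set0 -> exists i, O (p i).
  have [D0|[q]] := pfcard_geP cD.
    by have [|x []] := dD setT _ openT; [exists point|rewrite D0].
  exists q => O oO O0; have [x [Ox Dx]] := dD O O0 oO.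
  by have [i _ qi] := 'surj_q Dx; exists i; rewrite qi.
pose code (ij : nat * nat) : nat := pickle ij.
pose U n : set X := if @unpickle (nat * nat)%type n is Some ij then small_ball p ij.1 ij.2 else set0.
have UE i j : U (code (i, j)) = small_ball p i j by rewrite /U pickleK.
have oU n : open (U n).
  by rewrite /U; case: (unpickle n) => [ij|]; [exact: open_interior|exact: open0].
pose bit n y := `[< U n (g y) >].
have mbit n : measurable [set y | bit n y].
  apply/mf; apply: sub_sigma_algebra; rewrite (_ : _ @^-1` _ = U n)//.
  by apply/seteqP; split=> x; rewrite /bit /= fK => /asboolP.
have mF n : measurable (F n) by case: (hF n).
have [|ka [mka kaF _]] := @measurable_first _ Y (fun n y => F n y); first exact: mF.
have fka k : (lambda (A `&` [set y | ka y = k]) < +oo)%E.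
  have [_] := hF k; apply: le_lt_trans; apply: le_measure; rewrite ?inE//.
    by apply: measurableI => //; exact: label_measurable.
  move=> y [_ /= <-]; apply: kaF.
  by have : setT y by []; rewrite FT => -[n _ Fn]; exists n.
(* The words separate points, so this set has at most one element and no proper nonempty subset;
   non-atomicity then forbids positive measure. *)
have null y : lambda (A `&` [set y' | forall N, word ka bit N y' = word ka bit N y]) = 0%E.
  set S := A `&` _; have mS : measurable S.
    apply: measurableI => //; rewrite (_ : [set _ | _] = \bigcap_N [set y' | word ka bit N y' = word ka bit N y]).
      by apply: bigcapT_measurable => N; apply: label_measurable; exact: measurable_word.
    by apply/seteqP; split=> y' h N; [move=> _; exact: h|exact: (h N I)].
  have Sy y' : S y' -> y' = y.
    move=> [_ h]; apply: (can_inj gK); apply: (small_ball_separates hausX pD) => i j.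
    rewrite -UE => /asboolP; rewrite -/(bit _ _) => b.
    have := h (code (i, j)).+1; rewrite /= b (h (code (i, j))) => e.
    by apply/asboolP; rewrite -/(bit _ _); move: e; case: (bit _ y) => //=; lia.
  apply/eqP; rewrite -measure_le0 leNgt; apply/negP => S0.
  have [B [mB BS B0 lt]] := na S mS S0.
  have [z Bz] : B !=set0 by apply/set0P/eqP => e; rewrite e measure0 ltxx in B0.
  suff e : S = B by rewrite e ltxx in lt.
  by apply/seteqP; split=> // y' Sy'; rewrite (Sy _ Sy') -(Sy _ (BS _ Bz)).
have [K [mK hK]] := decode_word mA mka fka mbit null.
(* The last digit of a word is its parity; here it tells whether the point lies in
   [small_ball p i j]. *)
pose P j i (t : measurableTypeR R) := odd (K (code (i, j)).+1 t).
have /choice[c hc] j : exists c, measurable_fun setT c /\ forall t, (exists i, P j i t) -> P j (c t) t.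
  have [|c [mc h _]] := @measurable_first _ _ (P j); last by exists c.
  by move=> i; exact: (preimage_measurable (A := [set k | odd k]) (mK _)).
have [xi [mxi hxi]] := point_of_small_balls hausX p (fun j => (hc j).1).
exists (position lambda A ka bit), (f \o xi); split.
- exact: measurable_position.
- by move=> _ S mS; rewrite setTI comp_preimage; apply: mxi; exact/(mf S).
- by move=> S mS; exact: position_push.
- apply: filterS hK => y hy Ay; rewrite /= -[RHS]gK; congr f; apply: hxi => j.
  have Pbit i : P j i (position lambda A ka bit y) = bit (code (i, j)) y.
    by rewrite /P hy//= oddD odd_double addFb; case: (bit _ y).
  have [i hi] := small_ball_cover pD (g y) j.
  have [_ /(_ (position lambda A ka bit y))] := hc j; rewrite Pbit => h.
  rewrite -UE; apply/asboolP; rewrite -/(bit _ _); apply: h; exists i.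
  by rewrite Pbit; apply/asboolP; rewrite UE.
Qed.

(** * Subgroups absorbed by powers of a syndetic set *)

Section Powers.
Context (G : groupType).
Implicit Types (W : set G) (x y : G).

Fixpoint pw W n : set G :=
  if n is m.+1 then [set x | exists2 a, W a & exists2 b, pw W m b & x = a * b]
  else [set 1].

Definition syndetic W := [/\ W 1, forall x, W x -> W x^-1 &
  exists k : nat -> G, forall x, exists i, W ((k i)^-1 * x)].

Lemma pw1 W x : W x -> pw W 1 x.
Proof. by move=> Wx; exists x => //; exists 1 => //; rewrite mulg1. Qed.

Lemma pwM W m n x y : pw W m x -> pw W n y -> pw W (m + n) (x * y).
Proof.
elim: m x => [x ->|m ih x [a Wa [b hb ->]] hy]; first by rewrite mul1g.
by exists a => //; exists (b * y); [exact: ih|rewrite mulgA].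
Qed.

Lemma pwV W n x : (forall x, W x -> W x^-1) -> pw W n x -> pw W n x^-1.
Proof.
move=> WV; elim: n x => [x ->|n ih x [a Wa [b hb ->]]]; first by rewrite invg1.
by rewrite invgM -addn1; apply: pwM; [exact: ih|apply/pw1/WV].
Qed.

Lemma pw_le W m n x : W 1 -> (m <= n)%N -> pw W m x -> pw W n x.
Proof.
move=> W1 /subnK <- hx; elim: (n - m)%N => [//|k ih].
by rewrite addSn -[x]mul1g; exists 1 => //; exists x; rewrite ?mul1g.
Qed.

(** Two of the continuum many values of [f] lie in one translate. The two sequences are compared at
    their first difference and exchanged if needed, which symmetry of [W] permits. *)
Lemma syndetic_pigeonhole W (f : (nat -> bool) -> G) : syndetic W ->
  exists al be n, [/\ forall i, (i < n)%N -> al i = be i, al n = false, be n = true &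
    pw W 2 ((f al)^-1 * f be)].
Proof.
move=> [W1 WV [k hk]].
have /choice[c hc] al : exists i, W ((k i)^-1 * f al) by exact: hk.
have [al [be [E ne]]] : exists al be, c al = c be /\ al <> be.
  apply: contrapT => h.
  have inj al be : c al = c be -> al = be.
    by move=> e; apply: contrapT => ne; apply: h; exists al, be.
  (* Cantor's diagonal sequence: were [c] injective, [de] would contradict itself at the index
     [c de]. *)
  pose de n := `[< forall al, c al = n -> al n = false >].
  have [/asboolP h1|/negP h1] := boolP (de (c de)).
    by move: (h1 de erefl); rewrite /de => /negP; apply; apply/asboolP.
  by apply: (h1); apply/asboolP => al /inj ->; exact/negbTE/negP.
have {ne} ex : exists n, al n != be n.
  by apply: contrapT => h; apply: ne; apply/funext => n; apply/eqP/negPn/negP => ?; apply: h; exists n.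
have key a b : c a = c b -> pw W 2 ((f a)^-1 * f b).
  move=> e; rewrite (_ : _ * _ = ((k (c a))^-1 * f a)^-1 * ((k (c b))^-1 * f b)).
    by apply: (@pwM _ 1 1); apply: pw1 => //; exact: WV.
  by rewrite e invgM invgK mulgA mulgK.
case: (ex_minnP ex) => n ne mn.
have lt i : (i < n)%N -> al i = be i.
  by move=> lin; apply/eqP/negPn/negP => /mn; rewrite leqNgt lin.
case an : (al n) ne; case bn : (be n) => // _.
  by exists be, al, n; split => // [i /lt //|]; exact: key.
by exists al, be, n; split => //; exact: key.
Qed.

End Powers.

(** * A set of infinite measure all of whose automorphisms are absorbed *)

Section Main1.
Context (R : realType) (d : measure_display) (Y : measurableType d).
Variable lambda : {measure set Y -> \bar R}.
Local Notation G := (Aut lambda).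
Hypothesis iso : lebesgue_like lambda.
Hypothesis infY : lambda setT = +oo%E.

Lemma fix_inv (A : set Y) (u : G) : (\forall x \ae lambda, A x -> u $ x = x) ->
  \forall x \ae lambda, A x -> u^-1 $ x = x.
Proof.
by apply: filterS2 (autVK u) => x E h Ax; rewrite -[in LHS](h Ax).
Qed.

Lemma commute_fix (A : set Y) (u s : G) : (\forall x \ae lambda, A x -> u $ x = x) ->
  supp A s -> u * s = s * u.
Proof.
move=> uA sA; apply: aut_ext.
ae_use (autM u s); ae_use (autM s u); ae_use uA; ae_use sA.
ae_use (ae_map u sA); ae_use (ae_map s uA); ae_use (supp_stable sA).
ae_use (ae_map u (fix_inv uA)); ae_use (autVK u).
apply: aeW => x h1 h2 h3 h4 h5 h6 h7 -> ->.
have [Ax|nAx] := pselect (A x); first by rewrite h7// h4//; apply/h3.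
rewrite h6// h5//; move=> Aux; have := h2 Aux; rewrite h1 => E.
by rewrite -E in Aux.
Qed.

(** [H^-1 * w] fixes [A] pointwise, hence commutes with [s]. So an element of [pw W 2] known only on
    [A] may replace [H] in a conjugation, whatever it does elsewhere. *)
Lemma conj_agree (A : set Y) (w H s : G) : (\forall x \ae lambda, A x -> w $ x = H $ x) ->
  supp A s -> supp A H -> w * s * w^-1 = H * s * H^-1.
Proof.
move=> wH sA HA.
have uA : \forall x \ae lambda, A x -> (H^-1 * w) $ x = x.
  ae_use (autM H^-1 w); ae_use wH; ae_use (autVK H).
  by apply: aeW => x h1 h2 -> Ax; rewrite h2.
have := commute_fix uA sA => /(congr1 (fun t => H * t * w^-1)).
by rewrite !mulgA mulgV mul1g => ->; rewrite mulgK.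
Qed.

Lemma agree_inv (A : set Y) (s t : G) : supp A t ->
  (\forall x \ae lambda, A x -> s $ x = t $ x) ->
  \forall x \ae lambda, A x -> s^-1 $ x = t^-1 $ x.
Proof.
move=> tA st; apply: (ae_surj (T := t)).
ae_use (supp_stable tA); ae_use st; ae_use (autVK s); ae_use (autVK t).
by apply: aeW => x h1 h2 h3 h4 Atx; rewrite h1 -h3 ?h2//; apply/h4.
Qed.

(** Diagonal argument: if for each [n] some [hh n] agreed on [A n] with no element of the [n]-th
    translate, the union of the [hh n] would lie in no translate. Dividing by an element of the
    translate that is trivial on [A n] replaces the translate by [pw W 2]. *)
Lemma syndetic_full (W : set G) (A : nat -> set Y) : syndetic W ->
  (forall i, measurable (A i)) -> trivIset setT A ->
  exists n, forall h : G, supp (A n) h -> exists2 w : G, pw W 2 w &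
    \forall x \ae lambda, A n x -> w $ x = h $ x.
Proof.
move=> [W1 WV [k hk]] mA tA.
have [n hn] : exists n, forall h : G, supp (A n) h -> exists2 t : G, W ((k n)^-1 * t) &
    \forall x \ae lambda, A n x -> t $ x = h $ x.
  apply: contrapT => h.
  have /choice[hh hhP] n : exists h : G, supp (A n) h /\ ~ exists2 t : G, W ((k n)^-1 * t) &
      \forall x \ae lambda, A n x -> t $ x = h $ x.
    apply: contrapT => h'; apply: h; exists n => g sg; apply: contrapT => h''.
    by apply: h'; exists g.
  have [S _ hS] := glue_supp mA tA (fun i => (hhP i).1).
  have [i Wi] := hk S.
  by apply: (hhP i).2; exists S.
exists n => h sh.
have [t Wt th] := hn h sh.
have [u Wu uh] := hn 1 (supp1 _ _).
exists (u^-1 * t).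
  rewrite (_ : _ * _ = ((k n)^-1 * u)^-1 * ((k n)^-1 * t)).
    by apply: (@pwM _ _ 1 1); apply: pw1 => //; exact: WV.
  by rewrite invgM invgK mulgA mulgK.
have uA : \forall x \ae lambda, A n x -> u $ x = x.
  by ae_use uh; ae_use (aut1 lambda); apply: aeW => x h1 h2 Ax; rewrite h2.
ae_use (autM u^-1 t); ae_use th; ae_use (ae_map h (fix_inv uA)); ae_use (supp_stable sh).
by apply: aeW => x h1 h2 h3 -> Ax; rewrite h3// h2//; apply/h1.
Qed.

Definition wandering (s : G) (D : nat -> set Y) :=
  [/\ forall i, measurable (D i), trivIset setT D &
    forall i, \forall x \ae lambda, D i x <-> D i.+1 (s $ x)].

(** [H] acts on [D i] as the conjugate of [h] by the [i]-th power of [s]. Conjugating [H] by [s]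
    moves every factor one step on and only loses the one on [D 0], which is [h]. *)
Lemma wandering_commutator (s h : G) (D : nat -> set Y) : wandering s D ->
  supp (D 0%N) h -> exists2 H, supp (\bigcup_i D i) H & h = H * s * H^-1 * s^-1.
Proof.
move=> [mD tD sD] sh.
pose T i := iter i (fun t : G => s * t * s^-1) h.
have sT i : supp (D i) (T i).
  elim: i => [//|i ih] /=; apply: supp_conj ih.
  by apply: filterS (sD i) => x [].
have [H sH HT] := glue_supp mD tD sT.
exists H => //; suff -> : H * s = h * s * H by rewrite !mulgK.
apply: aut_ext.
have sT' := ae_foralln (fun i => supp_stable (sT i)).
have sD' := ae_foralln sD; have HT' := ae_foralln HT.
have TS := ae_foralln (fun i => ae_map s (autM (s * T i) s^-1)).
have TS' := ae_foralln (fun i => autM s (T i)).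
ae_use (autM H s); ae_use (ae_map H (autM h s)); ae_use (autM (h * s) H).
ae_use sT'; ae_use sD'; ae_use (ae_map s HT'); ae_use HT'.
ae_use sH; ae_use (ae_map s sH); ae_use TS; ae_use TS'; ae_use (autVK s).
ae_use (ae_map s sh); ae_use (ae_map H (ae_map s sh)); ae_use (ae_map H sD').
apply: aeW => x sDH hsH hs VK TS1 TS2 sHs sHx HTx HTs sDx sTx -> -> ->.
have dj i j y : D i y -> D j y -> i = j by move=> Di Dj; apply: tD => //; exists y.
have [[i Di]|nD] := pselect (exists i, D i x).
  have Hx := HTx i Di; have DT : D i (T i $ x) by apply/sTx.
  have Dsx := (sDx i).1 Di.
  rewrite (HTs i.+1 Dsx) /= TS2 VK TS1 hsH ?Hx// => D0.
  have := (sDH i).1; rewrite Hx => /(_ DT) Di1.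
  by have := dj _ _ _ D0 Di1.
have nU : ~ (\bigcup_i D i) x by move=> [i _ Di]; apply: nD; exists i.
rewrite (sHx nU).
have [D0|nD0] := pselect (D 0%N (s $ x)); first exact: (HTs 0%N D0).
rewrite hs// sHs// => -[[|i] _ Di]; first exact: nD0.
by apply: nD; exists i; apply/sDx.
Qed.

Lemma shift_exists (A : set Y) : measurable A -> lambda A = +oo%E ->
  exists (s : G) D, [/\ supp A s, wandering s D, forall i, D i `<=` A & lambda (D 0%N) = +oo%E].
Proof.
move=> mA Ay; have [D [mD tD DA Dy]] := cut_pinfty iso mA Ay.
(* The shift of the integers carried to [nat]: ... 5, 3, 1, 0, 2, 4, ... A two-sided shift is needed
   for an invertible map; the even indices are the wandering half. *)
pose zs k := if k == 1%N then 0%N else if odd k then k.-2 else k.+2.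
pose zp k := if k == 0%N then 1%N else if odd k then k.+2 else k.-2.
have zsK : cancel zs zp.
  move=> [|[|k]] //=; rewrite /zs /= negbK; case: ifP => ok; rewrite /zp /=.
    by case: k ok => //= k ok; rewrite ok.
  by rewrite !negbK ok.
have zpK : cancel zp zs.
  move=> [|[|k]] //=; rewrite /zp /= negbK; case: ifP => ok; rewrite /zs /=.
    by rewrite !negbK ok.
  by case: k ok => [|[|k]] //= ok; rewrite ok.
have zsne k : zs k <> k.
  by case: k => [|[|k]] //=; rewrite /zs /= negbK; case: ifP => _; lia.
have tD' : trivIset setT (D \o zs).
  by move=> i j _ _ [x [Di Dj]]; apply: (can_inj zsK); apply: tD => //; exists x.
have /choice[T hT] k : exists T : G, \forall x \ae lambda, D k x <-> D (zs k) (T $ x).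
  apply: homogeneous_disj => //; first by rewrite !Dy.
  apply/seteqP; split=> // x [Dk Dz]; apply: (zsne k).
  by apply: tD => //; exists x.
have [io mio hio] := family_label mD tD.
have [ka mka hka] := family_label (fun i => mD (zs i)) tD'.
pose U i : G := if i is j.+1 then T j else 1.
have io0 x : io x = 0%N <-> ka x = 0%N.
  split.
    case E : (ka x) => [//|n] i0; have /hka/= Dn := E.
    by have := (hio x (zs n)).2 Dn; rewrite i0.
  case E : (io x) => [//|n] i0; have /hio Dn := E.
  by have := (hka x (zp n)).2; rewrite /= zpK i0 => /(_ Dn).
have [|S hS] := @aut_glue _ _ _ lambda io ka U mio mka.
  case=> [|i] /=; first by have := aut1 lambda; apply: filterS => x ->.
  by apply: filterS (hT i) => x; rewrite hio hka.
have SD k : \forall x \ae lambda, D k x <-> D (zs k) (S $ x).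
  by apply: filterS hS => x [_ h]; rewrite -hio -hka h.
exists S, (fun i => D i.*2); split => //.
  ae_use hS; ae_use (aut1 lambda); apply: aeW => x h1 [+ _] nD.
  case E : (io x) => [|n] /=; first by move->.
  by case: nD; apply: (DA n); apply/hio.
split => //.
  by move=> i j _ _ [x [Di Dj]]; apply: double_inj; apply: tD => //; exists x.
move=> i; have := SD i.*2; rewrite /zs odd_double doubleS.
by case: eqP => // e; have := congr1 odd e; rewrite odd_double.
Qed.

(** The shift of the commutator must itself lie in a power of [W]. Each binary sequence gives an
    element acting on [C i] as a shift or trivially, according to its [i]-th digit; pigeonhole
    yields [t] in [pw W 2] that is a shift on one [C m]. In the commutator of [H] and [t], [H] is
    then replaced by an element of [pw W 2] using [syndetic_full]. *)
Lemma big_subgroup (W : set G) : syndetic W -> exists B, [/\ measurable B, lambda B = +oo%E &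
  forall h : G, supp B h -> pw W 8 h].
Proof.
move=> sW; have [W1 WV _] := sW.
have [A [mA tA _ Ay]] := cut_pinfty iso measurableT infY.
have [n full] := syndetic_full sW mA tA.
have [C [mC tC CA Cy]] := cut_pinfty iso (mA n) (Ay n).
have /choice[sD hsD] m : exists sD : G * (nat -> set Y),
    [/\ supp (C m) sD.1, wandering sD.1 sD.2, forall i, sD.2 i `<=` C m
      & lambda (sD.2 0%N) = +oo%E].
  by have [s [D]] := shift_exists (mC m) (Cy m); exists (s, D).
pose s m := (sD m).1; pose D m := (sD m).2.
have ss m : supp (C m) (s m) by case: (hsD m).
have /choice[f hf] (al : nat -> bool) : exists S : G, supp (\bigcup_i C i) S /\
    forall i, \forall x \ae lambda, C i x -> S $ x = (if al i then s i else 1) $ x.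
  have [|S] := @glue_supp _ _ _ lambda C (fun i => if al i then s i else 1) mC tC.
    by move=> i; case: (al i) => //; exact: supp1.
  by exists S.
have [al [be [m [_ alm bem W2]]]] := syndetic_pigeonhole f sW.
set t := _ * _ in W2.
have [wm [wd1 wd2 wd3] DC Dy] := hsD m; rewrite -/(s m) -/(D m) in wm wd1 wd2 wd3 DC Dy.
have tA' : supp (A n) t.
  have bC : \bigcup_i C i `<=` A n by move=> x [i _ /CA].
  by apply: suppM; [apply: suppV|]; apply: (suppS bC); case: (hf al); case: (hf be).
have ts : \forall x \ae lambda, C m x -> t $ x = s m $ x.
  have h1 := (hf al).2 m; have h2 := (hf be).2 m; rewrite alm bem in h1 h2.
  have h3 : \forall x \ae lambda, C m x -> f al $ x = x.
    by ae_use h1; ae_use (aut1 lambda); apply: aeW => x h3 h4 Ax; rewrite h4.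
  ae_use h2; ae_use (ae_map (s m) (fix_inv h3)); ae_use (autM (f al)^-1 (f be)).
  ae_use (supp_stable (ss m)); apply: aeW => x h4 h5 h6 h7 Cx.
  by rewrite h5 h7// h6//; apply/h4.
have tD : wandering t (D m).
  split => // i; ae_use ts; ae_use (ae_map t (agree_inv (ss m) ts)); ae_use (autVK t).
  ae_use (wd3 i); ae_use (ae_map (s m)^-1 (wd3 i)); ae_use (ae_map t (autKV (s m))).
  ae_use (ae_map t (ae_map (s m)^-1 (wd3 i))).
  apply: aeW => x h0 h1 _ h3 h4 h5 h6; split => [Dx|Dtx].
    by rewrite h6; [apply/h3|exact: DC Dx].
  have := h5 (DC _ _ Dtx); rewrite h4 => E.
  by rewrite E; apply/h0; rewrite h1.
exists (D m 0%N); split => // h sh.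
have [H sH ->] := wandering_commutator tD sh.
have sH' : supp (A n) H by apply: suppS sH => x [i _ /DC /CA].
have [w Ww wH] := full H sH'.
rewrite -(conj_agree wH tA' sH').
apply: (@pwM _ _ 6 2); last exact: pwV.
apply: (@pwM _ _ 4 2); last exact: pwV.
exact: (@pwM _ _ 2 2).
Qed.

End Main1.

(** * Conjugating into an absorbed set and joining two absorbed sets *)

Section Main2.
Context (R : realType) (d : measure_display) (Y : measurableType d).
Variable lambda : {measure set Y -> \bar R}.
Local Notation G := (Aut lambda).
Hypothesis iso : lebesgue_like lambda.
Hypothesis infY : lambda setT = +oo%E.

Lemma pw_conj (W : set G) a c (u T : G) : (forall x, W x -> W x^-1) ->
  pw W a u -> pw W c (u * T * u^-1) -> pw W (a + c + a) T.
Proof.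
move=> WV hu hT; rewrite (_ : T = u^-1 * (u * T * u^-1) * u).
  by apply: pwM => //; apply: pwM => //; exact: pwV.
by rewrite !mulgA mulVg mul1g -mulgA mulVg mulg1.
Qed.

(** Each [A m] has countably many disjoint copies in [B], and [u al] swaps [A m] with the copy named
    by the first digits of [al]. If [al] and [be] differ at [n], then for [m > n] the element [u be]
    sends [A m] to a copy that [u al] fixes, so [(u al)^-1 * u be] conjugates the tail into [B]. *)
Lemma tail_subgroup (W : set G) c B (A : nat -> set Y) : syndetic W ->
  measurable B -> lambda B = +oo%E -> (forall h : G, supp B h -> pw W c h) ->
  (forall m, measurable (A m)) -> trivIset setT A -> (forall m, A m `&` B = set0) ->
  exists n, forall T : G, supp (\bigcup_(m in [set m | (n <= m)%N]) A m) T ->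
    pw W (2 + c + 2) T.
Proof.
move=> sW mB By sB mA tA AB; have [W1 WV _] := sW.
have [D' [mD' tD' D'B D'y]] := cut_pinfty iso mB By.
pose pr (m j : nat) : nat := pickle (m, j).
have prI m j m' j' : pr m j = pr m' j' -> m = m' /\ j = j'.
  by move=> /(pcan_inj pickleK) [].
have /choice[D hD] (p : nat * nat) : exists D,
    [/\ measurable D, D `<=` D' (pr p.1 p.2) & lambda D = lambda (A p.1)].
  by apply: subset_measure_eq; rewrite ?D'y ?leey.
have AD m m' j x : A m x -> D (m', j) x -> False.
  move=> Ax Dx; rewrite -[False]/(set0 x) -(AB m); split => //.
  by apply: (D'B (pr m' j)); case: (hD (m', j)) => _ + _; exact.
have DD m j m' j' x : D (m, j) x -> D (m', j') x -> m = m' /\ j = j'.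
  move=> Dx Dx'; apply: prI; apply: tD' => //; exists x; split.
    by case: (hD (m, j)) => _ + _; exact.
  by case: (hD (m', j')) => _ + _; exact.
have /choice[ta hta] (p : nat * nat) : exists T : G, [/\ supp (A p.1 `|` D p) T,
    \forall x \ae lambda, A p.1 x -> D p (T $ x) & \forall x \ae lambda, D p x -> A p.1 (T $ x)].
  apply: swap_exists => //; first by case: (hD p).
    by case: (hD p).
  by apply/seteqP; split=> // x [Ax Dx]; case: p Ax Dx => m j; exact: AD.
(* [mkseq al m] holds the digits of index below [m], so it sees a difference at [n] only for
   [m > n]; hence the tail from [n.+1]. *)
pose code (al : nat -> bool) m : nat := pickle (mkseq al m).
pose E al m := A m `|` D (m, code al m).
have mE al m : measurable (E al m).
  by apply: measurableU => //; case: (hD (m, code al m)).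
have tE al : trivIset setT (E al).
  move=> i j _ _ [x [[Ai|Di] [Aj|Dj]]].
  - by apply: tA => //; exists x.
  - by case: (AD i j (code al j) x).
  - by case: (AD j i (code al i) x).
  - by case: (DD _ _ _ _ _ Di Dj).
have /choice[u hu] (al : nat -> bool) : exists u : G, supp (\bigcup_m E al m) u /\
    forall m, \forall x \ae lambda, E al m x -> u $ x = ta (m, code al m) $ x.
  have [|u] := @glue_supp _ _ _ lambda (E al) (fun m => ta (m, code al m)) (mE al) (tE al).
    by move=> m; case: (hta (m, code al m)).
  by exists u.
have [al [be [n [_ aln ben W2]]]] := syndetic_pigeonhole u sW.
exists n.+1 => T sT.
apply: (pw_conj (u := (u al)^-1 * u be)) => //; apply: sB.
apply: supp_conj sT.
have key m : (n < m)%N -> \forall x \ae lambda, A m x -> B (((u al)^-1 * u be) $ x).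
  move=> nm; have [_ h1 _] := hta (m, code be m); have h2 := (hu be).2 m.
  have h3 : \forall x \ae lambda, D (m, code be m) x -> u al $ x = x.
    apply: filterS (hu al).1 => x h Dx; apply: h => -[m' _ [Ax|Dx']].
      exact: AD Ax Dx.
    have [E1 E2] := DD _ _ _ _ _ Dx Dx'; subst m'.
    move: E2 => /(pcan_inj pickleK) /(congr1 (fun s => nth false s n)).
    by rewrite !nth_mkseq// aln ben.
  ae_use h1; ae_use h2; ae_use (ae_map (u be) (fix_inv h3)); ae_use (autM (u al)^-1 (u be)).
  apply: aeW => x -> h5 h6 h7 Ax.
  have e : u be $ x = ta (m, code be m) $ x by apply: h6; left.
  have Dx := h7 Ax; rewrite -e in Dx; rewrite h5//.
  by apply: (D'B (pr m (code be m))); case: (hD (m, code be m)) => _ + _; exact.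
have : \forall x \ae lambda, forall m, (n < m)%N -> A m x -> B (((u al)^-1 * u be) $ x).
  apply: ae_foralln => m; have [/key|nm] := boolP (n < m)%N.
    by apply: filterS => x h _.
  by apply: aeW.
by apply: filterS => x h [m nm Ax]; exact: h Ax.
Qed.

(** The rest of [U] in [M] can be sent to the rest of [V] by homogeneity: the complements of the two
    remainders both have measure [lambda U] plus that of the complement of [M]. *)
Lemma extend_in (M U V : set Y) (S : G) : measurable M -> measurable U -> measurable V ->
  U `<=` M -> V `<=` M -> (\forall x \ae lambda, U x <-> V (S $ x)) ->
  lambda (M `\` U) = lambda (M `\` V) ->
  exists b : G, supp M b /\ \forall x \ae lambda, U x -> b $ x = S $ x.
Proof.
move=> mM mU mV UM VM UV MUV.
have mMU : measurable (M `\` U) by exact: measurableD.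
have mMV : measurable (M `\` V) by exact: measurableD.
have UV' : lambda U = lambda V.
  by rewrite -(aut_preserving S mV); apply: eq_measure_ae => //; exact: aut_preimage_measurable.
have cE (P : set Y) : measurable P -> P `<=` M -> lambda (~` (M `\` P)) = (lambda P + lambda (~` M))%E.
  move=> mP PM; rewrite -measureU//; last 2 first.
  - exact: measurableC.
  - by apply/seteqP; split=> // x [/PM].
  congr (lambda _); apply/seteqP; split=> x /=.
    by move=> h; have [Mx|nMx] := pselect (M x); [left; apply: contrapT => nP; apply: h|right].
  by move=> [Px|nMx] [].
have [T hT] : exists T : G, \forall x \ae lambda, (M `\` U) x <-> (M `\` V) (T $ x).
  by apply: homogeneous => //; rewrite !cE// UV'.
have lab P : measurable P -> P `<=` M -> exists2 io : Y -> nat, measurable_fun setT io &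
    forall x, [/\ io x = 1%N <-> P x, io x = 2%N <-> (M `\` P) x, io x = 0%N <-> ~ M x & (io x <= 2)%N].
  move=> mP PM.
  exists (fun x => if x \in P then 1%N else if x \in M then 2%N else 0%N).
    by do 2!(apply: measurable_label_if => //).
  move=> x; have [/set_mem Px|/negP nP] := boolP (x \in P).
    by have Mx := PM _ Px; split => //; split => // -[].
  have {}nP : ~ P x by move=> ?; apply: nP; rewrite inE.
  have [/set_mem Mx|/negP nM] := boolP (x \in M).
    by split => //; split.
  have {}nM : ~ M x by move=> ?; apply: nM; rewrite inE.
  by split => //; split => // -[].
have [io mio hio] := lab U mU UM; have [ka mka hka] := lab V mV VM.
pose F (i : nat) : G := if i == 1%N then S else if i == 2%N then T else 1.
have [|b hb] := @aut_glue _ _ _ lambda io ka F mio mka.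
  case=> [|[|[|i]]] /=.
  - have := aut1 lambda; apply: filterS => x ->.
    by have [_ _ -> _] := hio x; have [_ _ -> _] := hka x.
  - by apply: filterS UV => x h; have [-> _ _ _] := hio x; have [-> _ _ _] := hka (S $ x).
  - by apply: filterS hT => x h; have [_ -> _ _] := hio x; have [_ -> _ _] := hka (T $ x).
  - have := aut1 lambda; apply: filterS => x ->.
    have [_ _ _ h1] := hio x; have [_ _ _ h2] := hka x.
    by split => e; [rewrite e in h1|rewrite e in h2].
exists b; split.
  ae_use hb; ae_use (aut1 lambda); apply: aeW => x h1 [+ _] nM.
  by have [_ _ [_ /(_ nM) ->] _] := hio x; rewrite h1.
by apply: filterS hb => x [+ _] Ux; have [[_ /(_ Ux) ->] _ _ _] := hio x.
Qed.

(** [T] is corrected until it is trivial on [Q], the part of [X2] outside [X1]. [b0] makes the image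
    [R1] of [Q] leave an infinite part of [X1] free; [a], inside [X1], pushes the part of the image
    lying in [X1] into [X2]; [b], inside [X2], then brings the image back to [Q] pointwise. What
    remains, [b * a * b0 * T], is supported on [X1]. *)
Lemma join_subgroups (W : set G) c1 c2 X1 X2 : (forall x, W x -> W x^-1) ->
  measurable X1 -> measurable X2 ->
  (forall h : G, supp X1 h -> pw W c1 h) -> (forall h : G, supp X2 h -> pw W c2 h) ->
  lambda (X1 `&` X2) = +oo%E -> lambda (X2 `\` X1) = +oo%E ->
  forall h : G, supp (X1 `|` X2) h -> pw W (c2 + c1 + c2 + c1) h.
Proof.
move=> WV mX1 mX2 s1 s2 Cy Qy T sT.
set C := X1 `&` X2 in Cy; set Q := X2 `\` X1 in Qy.
have mC : measurable C by exact: measurableI.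
have mQ : measurable Q by exact: measurableD.
pose R0 := [set y | Q (T^-1 $ y)].
have mR0 : measurable R0 by exact: aut_preimage_measurable.
have yle (P P' : set Y) : measurable P -> measurable P' -> lambda P = +oo%E ->
    (\forall x \ae lambda, P x -> P' x) -> lambda P' = +oo%E.
  by move=> mP mP' Py /(le_measure_ae mP mP'); rewrite Py leye_eq => /eqP.
have preimV (U : G) P : measurable P -> lambda [set y | P (U $ y)] = lambda P.
  exact: aut_preserving.
(* Since [T] sends [C] off [R0], infinite room is left outside [R0]. If it is not in [X1], then it
   is in [Q], and exchanging [Q] with [C] moves it into [X1]. *)
have [b0 sb0 hb0] : exists2 b0 : G, supp X2 b0 &
    lambda (X1 `\` [set y | R0 (b0^-1 $ y)]) = +oo%E.
  have [/eqP h|h] := boolP (lambda (X1 `\` R0) == +oo%E).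
    exists 1; first exact: supp1.
    apply: yle h _; [exact: measurableD|apply: measurableD => //; exact: aut_preimage_measurable|].
    by have := aut1 lambda; apply: filterS => y E [? nR]; split => //=; rewrite invg1 E.
  have [||b0 [sb0 QC CQ]] := @swap_exists _ _ _ lambda iso infY Q C mQ mC.
  - by rewrite Cy Qy.
  - by apply/seteqP; split=> // x [[]] ? ? [].
  have QR : lambda (Q `\` R0) = +oo%E.
    have mX : measurable ((X1 `|` X2) `\` R0) by apply: measurableD => //; exact: measurableU.
    have : lambda ((X1 `|` X2) `\` R0) = +oo%E.
      apply: (@yle [set y | C (T^-1 $ y)]) => //.
      - exact: aut_preimage_measurable.
      - by rewrite preimV.
      - apply: filterS (supp_stable (suppV sT)) => y hy [Cy1 Cy2]; split.
          by apply/hy; left.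
        by move=> [].
    rewrite (_ : (X1 `|` X2) `\` R0 = (X1 `\` R0) `|` (Q `\` R0)); last first.
      apply/seteqP; split=> x /=.
        move=> [[X1x|X2x] nR]; first by left.
        by have [?|?] := pselect (X1 x); [left|right].
      by move=> [[? ?]|[[? ?] ?]]; split => //; [left|right].
    rewrite measureU//; [|exact: measurableD|exact: measurableD|]; last first.
      by apply/seteqP; split=> // x [[? _] [[_]]].
    move: h; rewrite -ltey => h e; apply: contrapT => /eqP; rewrite -ltey => h2.
    by have := lte_add_pinfty h h2; rewrite ltNge leye_eq => /eqP; apply; exact: e.
  exists b0; first by apply: suppS sb0 => x [[]|[]].
  apply: (@yle [set y | (Q `\` R0) (b0^-1 $ y)]).
  - by apply: aut_preimage_measurable; exact: measurableD.
  - by apply: measurableD => //; exact: aut_preimage_measurable.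
  - by rewrite preimV//; exact: measurableD.
  - ae_use (ae_map b0^-1 QC); ae_use (autKV b0); apply: aeW => y E h1 [Qy' nR].
    by have := h1 Qy'; rewrite E => -[].
pose R1 := [set y | R0 (b0^-1 $ y)].
have mR1 : measurable R1 by exact: aut_preimage_measurable.
have R1X : \forall y \ae lambda, R1 y -> (X1 `|` X2) y.
  have sb0' : supp (X1 `|` X2) b0 by apply: suppS sb0 => x; right.
  ae_use (supp_stable (suppV sb0')); ae_use (ae_map b0^-1 (supp_stable (suppV sT))).
  by apply: aeW => y h1 h2 [Xy _]; apply/h2/h1; right.
have [K [mK tK KC Ky]] := cut_pinfty iso mC Cy.
have [C1 [mC1 C1K C1e]] : exists C1, [/\ measurable C1, C1 `<=` K 0%N & lambda C1 = lambda (R1 `&` X1)].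
  by apply: subset_measure_eq; rewrite ?Ky ?leey.
have mRX : measurable (R1 `&` X1) by exact: measurableI.
have C1X x : C1 x -> C x by move=> /C1K /KC.
have CC1 : lambda (C `\` C1) = +oo%E.
  apply: (yle (K 1%N)) => //; first exact: measurableD.
  apply: aeW => x Kx; split; first exact: KC Kx.
  by move=> /C1K K0; have : 0%N = 1%N by apply: tK => //; exists x.
have XC1 : lambda (X1 `\` C1) = +oo%E.
  apply: (yle (C `\` C1)) => //; [exact: measurableD|exact: measurableD|].
  by apply: aeW => x [[]].
have XR1 : lambda (X1 `\` (R1 `&` X1)) = +oo%E.
  apply: yle hb0 _; [exact: measurableD|exact: measurableD|].
  by apply: aeW => x [X1x nR]; split => // -[].
have [a0 ha0] : exists a0 : G, \forall x \ae lambda, (R1 `&` X1) x <-> C1 (a0 $ x).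
  apply: homogeneous => //.
  transitivity (+oo%E : \bar R); last symmetry.
    apply: yle XR1 _; [exact: measurableD|exact: measurableC|].
    by apply: aeW => x [].
  apply: yle XC1 _; [exact: measurableD|exact: measurableC|].
  by apply: aeW => x [].
have [|||a [sa ha]] := extend_in mX1 mRX mC1 _ _ ha0.
- by move=> x [].
- by move=> x /C1X [].
- by rewrite XR1 XC1.
pose S : G := a * b0 * T.
have SV : \forall y \ae lambda, S^-1 $ y = T^-1 $ (b0^-1 $ (a^-1 $ y)).
  rewrite /S !invgM; ae_use (autM T^-1 (b0^-1 * a^-1)).
  by ae_use (autM b0^-1 a^-1); apply: aeW => y -> ->.
have SQ : \forall y \ae lambda, Q (S^-1 $ y) -> (C1 `|` Q) y.
  ae_use SV; ae_use (ae_map a^-1 ha); ae_use (ae_map a^-1 ha0); ae_use (autKV a).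
  ae_use (ae_map a^-1 R1X); ae_use (ae_map a^-1 sa).
  apply: aeW => y h1 h2 h3 h4 h5 -> Qy'.
  have R1y : R1 (a^-1 $ y) by [].
  have [X1y|nX1y] := pselect (X1 (a^-1 $ y)).
    left; have := h5 (conj R1y X1y); rewrite h3 => ->.
    exact/h4.
  by right; have := h1 nX1y; rewrite h3 => ->; case: (h2 R1y).
pose U := [set y | Q (S^-1 $ y)] `&` X2.
have mU : measurable U by apply: measurableI => //; exact: aut_preimage_measurable.
have [||||b [sb hb]] := @extend_in X2 U Q S^-1 mX2 mU mQ.
- by move=> x [].
- by move=> x [].
- apply: filterS SQ => y h; split=> [[]//|Qy']; split => //.
  by case: (h Qy') => [/C1X []|[]].
- transitivity (+oo%E : \bar R); last symmetry.
    apply: (yle (C `\` C1)) => //; [exact: measurableD|exact: measurableD|].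
    apply: filterS SQ => y h [[X1y X2y] nC1]; split => // -[/h[//|[]]] //.
  apply: yle Cy _ => //; first exact: measurableD.
  by apply: aeW => x [X1x X2x]; split => // -[].
have sbS : supp X1 (b * S).
  have sX : supp (X1 `|` X2) (b * S).
    apply: suppM; first by apply: suppS sb => x; right.
    apply: suppM => //; apply: suppM; first by apply: suppS sa => x; left.
    by apply: suppS sb0 => x; right.
  ae_use sX; ae_use (autM b S); ae_use (ae_map S hb); ae_use (autVK S); ae_use (ae_map S SQ).
  apply: aeW => x h1 h2 h3 h4 h5 nX1.
  have [X2x|nX2] := pselect (X2 x); last by apply: h5 => -[].
  have QS : Q (S^-1 $ (S $ x)) by rewrite h2.
  rewrite h4 h3//; split => //.
  by case: (h1 QS) => [/C1X []|[]].
rewrite (_ : T = b0^-1 * a^-1 * b^-1 * (b * S)); last first.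
  by rewrite /S !mulgA (mulgVK b) (mulgVK a) mulVg mul1g.
by apply: pwM; [apply: pwM; [apply: pwM|]|]; try apply: pwV; auto.
Qed.

End Main2.

(** * Small supports and supports avoiding a set of finite measure *)

Section Main2.
Context (R : realType) (d : measure_display) (Y : measurableType d).
Variable lambda : {measure set Y -> \bar R}.
Local Notation G := (Aut lambda).
Hypothesis iso : lebesgue_like lambda.
Hypothesis infY : lambda setT = +oo%E.

(** Counterexamples [E n] of summable measures have a null upper limit. Keeping each point only in
    the last [E n] containing it gives disjoint sets [A n]; a tail of these is absorbed by
    [tail_subgroup], and it contains [E n] up to a null set. *)
Lemma small_supports_disj (W : set G) B' : syndetic W -> measurable B' ->
  lambda B' = +oo%E -> (forall h : G, supp B' h -> pw W 8 h) ->
  exists2 eps : R, (0 < eps)%R & forall E, measurable E -> E `&` B' = set0 ->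
    (lambda E < eps%:E)%E -> forall T : G, supp E T -> pw W 12 T.
Proof.
move=> sW mB' B'y sB'; apply: contrapT => h.
pose e n : R := (1 / (2 ^ n.+1)%:R)%R.
have e0 n : (0 < e n)%R by rewrite /e divr_gt0// ltr0n expn_gt0.
have /choice[E hE] n : exists E, [/\ measurable E, E `&` B' = set0,
    (lambda E < (e n)%:E)%E & ~ forall T : G, supp E T -> pw W 12 T].
  apply: contrapT => h'; apply: h; exists (e n) => // E mE EB Ee T sT.
  by apply: contrapT => nT; apply: h'; exists E; split => // /(_ T sT).
have mE n : measurable (E n) by case: (hE n).
pose F n := \bigcup_(k in [set k | (n <= k)%N]) E k.
have mF n : measurable (F n) by exact: bigcup_measurable.
pose A n := E n `\` F n.+1.
have mA n : measurable (A n) by exact: measurableD.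
have tA : trivIset setT A.
  have lt i j x : (i < j)%N -> A i x -> A j x -> False.
    by move=> ij [_ nF] [Ej _]; apply: nF; exists j.
  move=> i j _ _ [x [Ai Aj]]; case: (ltngtP i j) => // ij.
    by have := lt i j x ij Ai Aj.
  by have := lt j i x ij Aj Ai.
have AB n : A n `&` B' = set0.
  have [_ EB _ _] := hE n; apply/seteqP; split=> // x [[Ex _] Bx].
  by rewrite -EB.
have [n hn] := tail_subgroup iso infY sW mB' B'y sB' mA tA AB.
have [_ _ _ ] := hE n; apply => T sT; apply: hn.
have lim0 : lambda (lim_sup_set E) = 0%E.
  apply: lim_sup_set_cvg0 => //; apply: (@le_lt_trans _ _ 1%E); last exact: ltry.
  apply: le_trans (epsilon_trick0 xpredT ler01).
  by apply: lee_nneseries => // i _; have [_ _ /ltW] := hE i.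
have ml : measurable (lim_sup_set E) by apply: bigcap_measurable => // k _; exact: bigcup_measurable.
have {}lim0 : \forall x \ae lambda, ~ lim_sup_set E x.
  by exists (lim_sup_set E); split => // x /contrapT.
ae_use sT; ae_use lim0; apply: aeW => x nl sTx nA; apply: sTx => Ex.
apply: nA.
have [m [hm Em]] : exists m, ~ F m.+1 x /\ ((n <= m)%N /\ E m x).
  have [N hN] : exists N, ~ F N x.
    by apply: contrapT => h'; apply: nl => N _; apply: contrapT => nF; apply: h'; exists N.
  elim: N hN => [|N ih] hN; first by case: hN; exists n.
  have [FN|/ih//] := pselect (F N x).
  case: FN => k /= Nk Ek; exists k.
  have kN : k = N.
    by apply/eqP; rewrite eqn_leq Nk andbT leqNgt; apply/negP => kN; apply: hN; exists k.
  rewrite kN in Ek *; split => //; split => //.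
  by rewrite leqNgt; apply/negP => Nn; apply: hN; exists n.
by exists m; [case: Em|split; [case: Em|]].
Qed.

(** The part of [E] inside [K 0] is moved to [K 1] by a swap [v] supported in [B], hence in
    [pw W 8]; the moved set is no larger and is disjoint from [K 0]. *)
Lemma small_supports (W : set G) : syndetic W ->
  exists2 eps : R, (0 < eps)%R & forall E, measurable E ->
    (lambda E < eps%:E)%E -> forall T : G, supp E T -> pw W 28 T.
Proof.
move=> sW; have [W1 WV _] := sW.
have [B [mB By sB]] := big_subgroup iso infY sW.
have [K [mK tK KB Ky]] := cut_pinfty iso mB By.
have sB' (h : G) : supp (K 0%N) h -> pw W 8 h by move=> sh; apply: sB; exact: suppS sh.
have [eps eps0 heps] := small_supports_disj sW (mK 0%N) (Ky 0%N) sB'.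
exists eps => // E mE Ee T sT.
have mE1 : measurable (E `&` K 0%N) by exact: measurableI.
have mKE : measurable (K 1%N `\` E) by exact: measurableD.
have fE : (lambda E < +oo)%E by rewrite (lt_trans Ee)// ltry.
have KEy : lambda (K 1%N `\` E) = +oo%E.
  apply: contrapT => /eqP; rewrite -ltey => fK.
  have := Ky 1%N; rewrite (measureDI _ (mK 1%N) mE) => e.
  suff : (lambda (K 1%N `\` E) + lambda (K 1%N `&` E) < +oo)%E by rewrite e ltxx.
  apply: lte_add_pinfty => //; apply: le_lt_trans fE.
  by apply: le_measure; rewrite ?inE//; exact: measurableI.
have [|Q [mQ QK Qe]] := @subset_measure_eq _ _ _ lambda iso _ (lambda (E `&` K 0%N)) mKE (measure_ge0 _ _).
  by rewrite KEy leey.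
have dQ x : Q x -> K 0%N x -> False.
  by move=> /QK [K1 _] K0; have : 0%N = 1%N by apply: tK => //; exists x.
have [||v [sv EQ QE]] := @swap_exists _ _ _ lambda iso infY (E `&` K 0%N) Q mE1 mQ.
- by rewrite Qe.
- by apply/seteqP; split=> // x [[_ K0] Qx]; exact: dQ Qx K0.
pose E' := (E `\` K 0%N) `|` Q.
have mD := measurableD mE (mK 0%N).
have mE' : measurable E' by apply: measurableU.
have hv : pw W 8 v.
  by apply: sB; apply: suppS sv => x [[_ /KB]|/QK [/KB]].
apply: (pw_conj (a := 8) (c := 12) (u := v)) => //.
apply: (heps E') => //.
- by apply/seteqP; split=> // x [[[_ nK]//|Qx] K0]; exact: dQ Qx K0.
- apply: le_lt_trans Ee.
  have -> : lambda E = (lambda (E `\` K 0%N) + lambda (E `&` K 0%N))%E by exact: measureDI.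
  rewrite -Qe.
  exact: measureU2.
- apply: supp_conj sT; ae_use sv; ae_use EQ; apply: aeW => x h1 h2 Ex.
  have [K0|nK0] := pselect (K 0%N x); first by right; exact: h1.
  rewrite h2; first by left.
  by move=> [[//]|/QK []].
Qed.

(** Pieces of finite measure exhaust the complement of [K 0]. A tail of them is absorbed, and [Z]
    collects the finitely many others; the tail and the part of [B] outside [Z] cover the complement
    of [Z] and overlap in infinite measure through [K 1], so they can be joined. *)
Lemma cofinite_subgroup (W : set G) : sigma_finite setT lambda -> syndetic W ->
  exists Z, [/\ measurable Z, (lambda Z < +oo)%E &
    forall T : G, supp (~` Z) T -> pw W 40 T].
Proof.
move=> [F FT hF] sW; have [W1 WV _] := sW.
have [B [mB By sB]] := big_subgroup iso infY sW.
have [K [mK tK KB Ky]] := cut_pinfty iso mB By.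
have sB' (h : G) : supp (K 0%N) h -> pw W 8 h by move=> sh; apply: sB; exact: suppS sh.
have mF n : measurable (F n) by case: (hF n).
pose A n := seqDU F n `\` K 0%N.
have mA n : measurable (A n) by apply: measurableD => //; exact: seqDU_measurable.
have fA n : (lambda (A n) < +oo)%E.
  have [_] := hF n; apply: le_lt_trans; apply: le_measure; rewrite ?inE//.
  by move=> x [[]].
have tA : trivIset setT A.
  by move=> i j _ _ [x [[Ai _] [Aj _]]]; apply: (@trivIset_seqDU _ F) => //; exists x.
have AB n : A n `&` K 0%N = set0 by apply/seteqP; split=> // x [[_]].
have [n hn] := tail_subgroup iso infY sW (mK 0%N) (Ky 0%N) sB' mA tA AB.
pose Z := \big[setU/set0]_(i < n) A i.
have ZE x : Z x <-> exists2 i, (i < n)%N & A i x.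
  by rewrite /Z -bigcup_mkord; split => [[i /= ? ?]|[i ? ?]]; exists i.
have mZ : measurable Z by exact: bigsetU_measurable.
have AT x : ~ K 0%N x -> exists i, A i x.
  move=> nK; have : (\bigcup_i seqDU F i) x by rewrite -seqDU_bigcup_eq -FT.
  by move=> [i _ Di]; exists i.
have fZ : (lambda Z < +oo)%E.
  apply: le_lt_trans (Boole_inequality lambda _) _; first by move=> i _; exact: mA.
  by apply/lte_sum_pinfty => i _; exact: fA.
exists Z; split => // T sT.
pose X1 := \bigcup_(m in [set m | (n <= m)%N]) A m.
pose X2 := B `\` Z.
have mX1 : measurable X1 by exact: bigcup_measurable.
have mX2 : measurable X2 by exact: measurableD.
have K1X : K 1%N `&` ~` Z `<=` X1 `&` X2.
  move=> x [K1 nZ]; split; last by split => //; exact: KB K1.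
  have [|m Am] := AT x; first by move=> K0; have : 0%N = 1%N by apply: tK => //; exists x.
  by exists m => //=; rewrite leqNgt; apply/negP => mn; apply: nZ; apply/ZE; exists m.
have K0X : K 0%N `<=` X2 `\` X1.
  move=> x K0; split; last by move=> [m _ [_]].
  by split; [exact: KB K0|move=> /ZE [m _ [_]]].
apply: (join_subgroups (X1 := X1) (X2 := X2) iso infY (c1 := 12) (c2 := 8)) => //.
- by move=> h sh; apply: sB; apply: suppS sh => x [].
- have mKZ : measurable (K 1%N `&` ~` Z) by apply: measurableI => //; exact: measurableC.
  suff h : lambda (K 1%N `&` ~` Z) = +oo%E.
    apply/eqP; rewrite -leye_eq -h; apply: le_measure; rewrite ?inE//.
    exact: measurableI.
  apply: contrapT => /eqP; rewrite -ltey => fK.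
  have e : lambda (K 1%N) = (lambda (K 1%N `\` Z) + lambda (K 1%N `&` Z))%E.
    exact: measureDI.
  suff : (lambda (K 1%N `\` Z) + lambda (K 1%N `&` Z) < +oo)%E by rewrite -e Ky ltxx.
  apply: lte_add_pinfty => //; apply: le_lt_trans fZ.
  by apply: le_measure; rewrite ?inE//; exact: measurableI.
- apply/eqP; rewrite -leye_eq -(Ky 0%N); apply: le_measure; rewrite ?inE//.
  exact: measurableD.
- apply: suppS sT => x nZ.
  have [K0|nK0] := pselect (K 0%N x); first by right; case: (K0X _ K0).
  left; have [m Am] := AT _ nK0; exists m => //=; rewrite leqNgt; apply/negP => mn.
  by apply: nZ; apply/ZE; exists m.
Qed.

End Main2.

(** * Dyadic cells *)

Record chart (R : realType) (d : measure_display) (Y : measurableType d)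
    (lambda : {measure set Y -> \bar R}) := Chart {
  ch_dom : set Y;
  ch_map : Y -> measurableTypeR R;
  ch_inv : measurableTypeR R -> Y;
  ch_size : R;
  ch_dom_measurable : measurable ch_dom;
  ch_iso : interval_iso lambda ch_dom ch_map ch_inv;
  ch_size_gt0 : (0 < ch_size)%R;
  ch_domE : lambda ch_dom = ch_size%:E
}.

Section Cells.
Context (R : realType) (d : measure_display) (Y : measurableType d).
Variable lambda : {measure set Y -> \bar R}.
Local Notation G := (Aut lambda).
Local Notation leb := (@lebesgue_measure R).
Local Notation RR := (measurableTypeR R).
Variable ch : chart lambda.
Local Notation Z := (ch_dom ch).
Local Notation phi := (ch_map ch).
Local Notation psi := (ch_inv ch).
Local Notation c := (ch_size ch).
Let mZ := ch_dom_measurable ch.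
Let isoZ := ch_iso ch.
Let c0 := ch_size_gt0 ch.
Let Zc := ch_domE ch.

(** Defined on the whole space to avoid partial functions; only for almost every point of [Z] is the
    number a genuine index below [2 ^ n]. *)
Definition cell n (x : Y) : nat := Num.truncn ((phi x : R) / (c / 2 ^+ n))%R.

Definition mesh n : R := (c / 2 ^+ n)%R.

Lemma mesh_gt0 n : (0 < mesh n)%R.
Proof. by rewrite divr_gt0// exprn_gt0. Qed.

Lemma meshE n m : (m <= n)%N -> mesh m = ((2 ^ (n - m))%:R * mesh n)%R.
Proof.
move=> mn; rewrite /mesh -{2}(subnK mn) exprD natrX; field.
by rewrite !expf_neq0.
Qed.

Lemma mesh_total n : ((2 ^ n)%:R * mesh n = c)%R.
Proof. by rewrite /mesh natrX mulrCA mulfV ?mulr1// expf_neq0. Qed.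

Lemma cell_le n k x : (cell n x <= k)%N = ((phi x : R) < k.+1%:R * mesh n)%R.
Proof. by rewrite /cell truncn_le_nat -/(mesh n) ltr_pdivrMr// mesh_gt0. Qed.

Lemma cell_lt n k x : (0 < k)%N -> (cell n x < k)%N = ((phi x : R) < k%:R * mesh n)%R.
Proof. by case: k => // k _; rewrite ltnS cell_le. Qed.

Lemma cell_prj n m x : (m <= n)%N -> cell m x = prj n m (cell n x).
Proof.
move=> mn; have h k : (cell m x <= k)%N = (prj n m (cell n x) <= k)%N.
  rewrite cell_le /prj -[RHS]ltnS ltn_divLR ?expn_gt0// cell_lt ?muln_gt0 ?expn_gt0//.
  by rewrite natrM -mulrA -meshE.
by apply/eqP; rewrite eqn_leq h leqnn -h leqnn.
Qed.

Lemma mesh_small (e : R) : (0 < e)%R -> exists n, (mesh n < e)%R.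
Proof.
move=> e0; exists (Num.truncn (c / e)).+1; rewrite /mesh ltr_pdivrMr ?exprn_gt0//.
rewrite mulrC -ltr_pdivrMr//; apply: lt_le_trans (truncnS_gt _) _.
by rewrite -natrX ler_nat; apply: ltnW; apply: ltn_expl.
Qed.

Lemma ch_map_measurable : measurable_fun setT phi. Proof. by case: isoZ. Qed.
Lemma ch_inv_measurable : measurable_fun setT psi. Proof. by case: isoZ. Qed.
Lemma ch_map_measure : forall S, measurable S -> lambda (Z `&` phi @^-1` S) =
       leb (S `&` interval_from0 c%:E).
Proof. by case: isoZ => _ _ + _; rewrite Zc. Qed.
Lemma ch_mapK : \forall x \ae lambda, Z x -> psi (phi x) = x. Proof. by case: isoZ. Qed.

Lemma ch_preimage_measurable S : measurable S -> measurable (phi @^-1` S).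
Proof. by move=> mS; apply: preimage_measurable mS; exact: ch_map_measurable. Qed.

Lemma leb_Ico (a b : R) : (0 <= a)%R -> (a <= b)%R -> (b <= c)%R ->
  leb ([set t | (a <= t < b)%R] `&` interval_from0 c%:E) = (b - a)%:E.
Proof.
move=> a0 ab bc; rewrite -(leb_interval a0 ab); congr (leb _).
apply/seteqP; split=> t [] /= /[dup] /andP[at' tb] h _; split => //; split.
- exact: le_trans at'.
- exact: ltry.
- exact: le_trans at'.
- by rewrite lte_fin; exact: lt_le_trans bc.
Qed.

Lemma phi_range : \forall x \ae lambda, Z x -> (0 <= (phi x : R) < c)%R.
Proof.
pose S : set RR := [set t | (0 <= t < c)%R].
have mS : measurable S by exact: measurable_Ico.
exists (Z `&` phi @^-1` (~` S)); split.
- by apply: measurableI => //; apply: ch_preimage_measurable; exact: measurableC.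
- rewrite (ch_map_measure (measurableC mS)).
  rewrite (_ : _ `&` _ = set0) ?measure0//; apply/seteqP; split=> // t [/= + [t0 tc]].
  by apply; apply/andP; split => //; move: tc; rewrite lte_fin.
- by move=> x /= /not_implyP [].
Qed.

Lemma cell_set_le_measurable n k : measurable [set x | (cell n x <= k)%N].
Proof.
rewrite (_ : [set _ | _] = phi @^-1` `]-oo, (k.+1%:R * mesh n)%R[%classic).
  by apply: ch_preimage_measurable; exact: measurable_itv.
by apply/seteqP; split=> x /=; rewrite cell_le in_itv.
Qed.

Lemma cell_measurable n : measurable_fun setT (cell n).
Proof.
move=> _ A mA; rewrite setTI.
have -> : cell n @^-1` A = \bigcup_(k in A) [set x | cell n x = k].
  by apply/seteqP; split=> [x Ax|x [k Ak /= e]] /=; [exists (cell n x)|rewrite e].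
apply: bigcup_measurable => -[|k] _.
  rewrite (_ : [set _ | _] = [set x | (cell n x <= 0)%N]).
    exact: cell_set_le_measurable.
  by apply/seteqP; split=> x /=; rewrite leqn0 => /eqP.
rewrite (_ : [set _ | _] = [set x | (cell n x <= k.+1)%N] `\` [set x | (cell n x <= k)%N]).
  by apply: measurableD; exact: cell_set_le_measurable.
apply/seteqP; split=> x /=; first by move=> ->; rewrite ltnn.
by move=> [h1 /negP]; rewrite -ltnNge => h2; apply/eqP; rewrite eqn_leq h1.
Qed.

Lemma cell_pred_measurable n (p : pred nat) : measurable [set x | p (cell n x)].
Proof.
rewrite (_ : [set _ | _] = cell n @^-1` [set k | p k])//.
by apply: preimage_measurable => //; exact: cell_measurable.
Qed.

Lemma cell_bound : \forall x \ae lambda, forall n, Z x -> (cell n x < 2 ^ n)%N.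
Proof.
apply: filterS phi_range => x h n /h /andP[_ xc].
by rewrite cell_lt ?expn_gt0// mesh_total.
Qed.

Lemma measure_cell n k : (k < 2 ^ n)%N ->
  lambda (Z `&` [set x | cell n x = k]) = (mesh n)%:E.
Proof.
move=> kn; pose S : set RR := [set t | (k%:R * mesh n <= t < k.+1%:R * mesh n)%R].
have m0 := mesh_gt0 n.
have -> : (mesh n)%:E = leb (S `&` interval_from0 c%:E).
  rewrite leb_Ico.
  - by rewrite -mulrBl -natrB// subSnn mul1r.
  - by rewrite mulr_ge0// ltW.
  - by rewrite ler_pM2r// ler_nat.
  - by rewrite -(mesh_total n) ler_pM2r// ler_nat.
have mS : measurable S by exact: measurable_Ico.
rewrite -(ch_map_measure mS); apply: eq_measure_ae.
- by apply: measurableI => //; apply: (label_measurable k); exact: cell_measurable.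
- by apply: measurableI => //; exact: ch_preimage_measurable.
- apply: filterS phi_range => x h; split=> -[Zx] /= e; split => //=.
    have /andP[x0 _] := h Zx; rewrite /S /= -cell_le e leqnn andbT.
    case: (k) e => [|j] e; first by rewrite mul0r.
    by rewrite leNgt -cell_le e ltnn.
  move: e; rewrite /S /= => /andP[e1 e2]; apply/eqP; rewrite eqn_leq cell_le e2 /=.
  case: (k) e1 => // j; rewrite leNgt => /negP e1.
  by rewrite ltnNge; apply/negP; rewrite cell_le.
Qed.

Lemma measure_cells n (p : pred nat) :
  lambda (Z `&` [set x | p (cell n x)]) = ((count p (iota 0 (2 ^ n)))%:R * mesh n)%:E.
Proof.
have key q : (q <= 2 ^ n)%N -> lambda (Z `&` [set x | (cell n x < q)%N && p (cell n x)]) =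
    ((count p (iota 0 q))%:R * mesh n)%:E.
  elim: q => [_|q ih qn].
    by rewrite (_ : _ `&` _ = set0) ?measure0 ?mul0r//; apply/seteqP; split=> // x [].
  rewrite -addn1 iotaD count_cat /= addn0 natrD mulrDl EFinD -ih; last exact: ltnW.
  have mq : measurable (Z `&` [set x | (cell n x < q)%N && p (cell n x)]).
    by apply: measurableI => //; exact: (cell_pred_measurable _ (fun k => (k < q)%N && p k)).
  have mq' : measurable (Z `&` [set x | cell n x = q]).
    by apply: measurableI => //; apply: label_measurable; exact: cell_measurable.
  case pq : (p q); last first.
    rewrite mul0r adde0; congr (lambda (_ `&` _)); apply/seteqP; split=> x /=.
      rewrite addn1 ltnS leq_eqVlt => /andP[/orP[/eqP ->|->//]]; by rewrite pq.
    by rewrite addn1 ltnS => /andP[/ltnW -> ->].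
  rewrite mul1r -(measure_cell qn) -measureU//; last first.
    by apply/seteqP; split=> // x [[_ /= /andP[+ _]] [_ /= e]]; rewrite e ltnn.
  congr (lambda _); apply/seteqP; split=> x /=.
    rewrite addn1 ltnS leq_eqVlt => -[Zx /andP[/orP[/eqP e|lt] px]]; [by right|left].
    by rewrite lt px.
  rewrite addn1 ltnS => -[[Zx /andP[/ltnW -> ->]//]|[Zx ->]].
  by rewrite leqnn pq.
rewrite -key//; apply: eq_measure_ae.
- by apply: measurableI => //; exact: cell_pred_measurable.
- by apply: measurableI => //; exact: (cell_pred_measurable _ (fun k => (k < 2 ^ n)%N && p k)).
- by apply: filterS cell_bound => x /(_ n) h /=; split => [[Zx ->]|[Zx /andP[_ ->]]//]; rewrite h.
Qed.

Lemma cell_separates x y : (0 <= (phi x : R))%R -> (0 <= (phi y : R))%R ->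
  (forall n, cell n x = cell n y) -> phi x = phi y.
Proof.
suff key a b : (0 <= (phi a : R))%R -> (forall n, cell n a = cell n b) -> ~~ ((phi a : R) < phi b)%R.
  move=> x0 y0 h; apply/eqP; rewrite eq_le !leNgt; apply/andP; split.
    by apply: (key y x) => // n; rewrite h.
  exact: (key x y).
move=> a0 h; apply/negP => ab; have ba : (0 < (phi b : R) - phi a)%R by rewrite subr_gt0.
have [n] := mesh_small ba; have := leqnn (cell n b); rewrite cell_le.
have : ((cell n a)%:R * mesh n <= phi a)%R.
  case E : (cell n a) => [|k]; first by rewrite mul0r.
  by rewrite leNgt -cell_le E ltnn.
by rewrite h -natr1 mulrDl mul1r; lra.
Qed.

Lemma aut_eq_cells (S T : G) : supp Z S -> supp Z T ->
  (forall n, \forall x \ae lambda, Z x -> cell n (S $ x) = cell n (T $ x)) -> S = T.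
Proof.
move=> sS sT h; apply: aut_ext; have h' := ae_foralln h.
ae_use sS; ae_use sT; ae_use h'; ae_use (ae_map S phi_range); ae_use (ae_map T phi_range).
ae_use (supp_stable sS); ae_use (supp_stable sT); ae_use (ae_map S ch_mapK); ae_use (ae_map T ch_mapK).
apply: aeW => x pT pS tT tS rT rS hx h1 h2.
have [Zx|nZ] := pselect (Z x); last by rewrite h1// h2.
rewrite -pS ?tS// -1?pT -?tT//; last by apply/tS.
congr psi; apply: cell_separates => [||n]; last exact: hx.
  by have /andP[] := rS ((tS).1 Zx).
by have /andP[] := rT ((tT).1 Zx).
Qed.

End Cells.

(** * Automorphisms described by maps between cells *)

Section Local.
Context (R : realType) (d : measure_display) (Y : measurableType d).
Variable lambda : {measure set Y -> \bar R}.
Local Notation G := (Aut lambda).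
Variable ch : chart lambda.
Local Notation Z := (ch_dom ch).
Local Notation cell := (cell ch).
Hypothesis iso : lebesgue_like lambda.
Hypothesis infY : lambda setT = +oo%E.

Let mZ : measurable Z := ch_dom_measurable ch.

(** Continuity for the topology of the cells in quantified form: [N] is a modulus at level [n], and
    [th] is the induced finite map. *)
Definition loc n N (x : G) (th : nat -> nat) :=
  \forall z \ae lambda, Z z -> cell n (x $ z) = th (cell N z).

Lemma loc1 n : loc n n 1 id.
Proof. by have := aut1 lambda; apply: filterS => z ->. Qed.

Lemma loc_prj n m N x th : (m <= n)%N -> loc n N x th -> loc m N x (prj n m \o th).
Proof. by move=> mn; apply: filterS => z h Zz; rewrite (cell_prj ch _ mn) /= h. Qed.

Lemma loc_up n N M x th : (N <= M)%N -> loc n N x th -> loc n M x (th \o prj M N).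
Proof. by move=> NM; apply: filterS => z h Zz; rewrite /= -cell_prj// h. Qed.

Lemma loc_ext n N x th th' : eqn_on N th th' -> loc n N x th -> loc n N x th'.
Proof.
move=> e; apply: filterS2 (cell_bound ch) => z hb h Zz.
by rewrite h// e//; exact: hb.
Qed.

Lemma loc_mul n N M x y th eta : supp Z y -> loc n N x th -> loc N M y eta ->
  loc n M (x * y) (th \o eta).
Proof.
move=> sy hx hy; ae_use (autM x y); ae_use (ae_map y hx); ae_use hy; ae_use (supp_stable sy).
by apply: aeW => z h1 h2 h3 -> Zz; rewrite h3 /= ?h2//; apply/h1.
Qed.

Lemma loc_measure n N x th p : supp Z x -> loc n N x th ->
  ((count (p \o th) (iota 0 (2 ^ N)))%:R * mesh ch N =
  (count p (iota 0 (2 ^ n)))%:R * mesh ch n)%R.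
Proof.
move=> sx hx; have : ((count (p \o th) (iota 0 (2 ^ N)))%:R * mesh ch N)%R%:E =
   ((count p (iota 0 (2 ^ n)))%:R * mesh ch n)%R%:E; last by case.
rewrite -!measure_cells -(aut_preserving x (A := Z `&` [set z | p (cell n z)])); last first.
  by apply: measurableI => //; exact: cell_pred_measurable.
apply: eq_measure_ae.
- by apply: measurableI => //; exact: (cell_pred_measurable ch N (p \o th)).
- apply: aut_preimage_measurable; apply: measurableI => //.
  exact: cell_pred_measurable.
- ae_use hx; ae_use (supp_stable sx); apply: aeW => z h1 h2 /=.
  by split=> -[Zz] pz; split; [apply/h1|rewrite h2|apply/h1|rewrite -h2//; apply/h1].
Qed.

Lemma loc_bal n N x th : supp Z x -> (n <= N)%N -> loc n N x th -> bal N n th.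
Proof.
move=> sx nN hx; apply: bal_of_count => // y.
have := loc_measure (pred1 y) sx hx.
rewrite (eq_count (a2 := fun z => th z == y))// (meshE ch nN) mulrA.
move=> /(mulIf (lt0r_neq0 (mesh_gt0 ch N))) /eqP.
rewrite -natrM eqr_nat => /eqP ->.
by rewrite mulnC (count_uniq_mem _ (iota_uniq _ _)) mem_iota.
Qed.

Lemma loc_uniq n N x th th' : loc n N x th -> loc n N x th' -> eqn_on N th th'.
Proof.
move=> h1 h2 k kN; apply: contrapT => ne.
have := measure_cell ch kN; rewrite (ae_measure0 _ _).
- by move=> [e]; have := mesh_gt0 ch N; rewrite -e ltxx.
- by apply: measurableI => //; apply: label_measurable; exact: cell_measurable.
- by apply: filterS2 h1 h2 => z e1 e2 [Zz /= ck]; apply: ne; rewrite -ck -e1// -e2.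
Qed.

Lemma perm_exists N th : bal N N th -> exists2 x : G, supp Z x & loc N N x th.
Proof.
move=> hth; have [si [bsi thsi sith]] := bal_inv hth.
pose D := Z `&` [set z | (cell N z < 2 ^ N)%N].
have mD : measurable D.
  by apply: measurableI => //; exact: (cell_pred_measurable ch N (fun k => (k < 2 ^ N)%N)).
pose E k := Z `&` [set z | cell N z = k].
have mE k : measurable (E k).
  by apply: measurableI => //; apply: label_measurable; exact: cell_measurable.
have /choice[T hT] k : exists T : G, ((k < 2 ^ N)%N -> \forall z \ae lambda, E k z <-> E (th k) (T $ z)).
  have [kN|_] := boolP (k < 2 ^ N)%N; last by exists 1.
  have [||T hT] := homogeneous_fin iso infY (mE k) (mE (th k)).
  - by rewrite /E !measure_cell//; exact: bal_lt hth kN.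
  - by rewrite /E measure_cell// ltry.
  by exists T.
have lab (f : nat -> nat) : exists2 io : Y -> nat, measurable_fun setT io &
    forall z, (D z -> io z = (f (cell N z)).+1) /\ (~ D z -> io z = 0%N).
  exists (fun z => if z \in D then (f (cell N z)).+1 else 0%N).
    apply: measurable_fun_ifT => //.
      by apply: (measurable_fun_bool true); rewrite setTI preimage_mem_true.
    move=> _ A mA; rewrite setTI.
    by apply: (preimage_measurable (A := [set k | A (f k).+1]) (cell_measurable ch N)).
  by move=> z; split => [Dz|nD]; [rewrite ifT// inE|rewrite ifF//; apply/negP; rewrite inE].
have [io mio hio] := lab id; have [ka mka hka] := lab si.
pose U i : G := if i is j.+1 then T j else 1.
have io0 z : io z = 0%N <-> ~ D z.
  by split=> [i0 Dz|]; [have := (hio z).1 Dz; rewrite i0|exact: (hio z).2].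
have ka0 z : ka z = 0%N <-> ~ D z.
  by split=> [i0 Dz|]; [have := (hka z).1 Dz; rewrite i0|exact: (hka z).2].
have [|x hx] := @aut_glue _ _ _ lambda io ka U mio mka.
  case=> [|i] /=.
    by have := aut1 lambda; apply: filterS => z ->; rewrite io0 ka0.
  have [iN|iN] := boolP (i < 2 ^ N)%N; last first.
    apply: aeW => z; split => e; exfalso; apply: (negP iN).
      have [Dz|/(hio z).2 e'] := pselect (D z); last by rewrite e' in e.
      by have := (hio z).1 Dz; rewrite e => -[->]; case: Dz.
    have [Dz|/(hka _).2 e'] := pselect (D (T i $ z)); last by rewrite e' in e.
    have := (hka _).1 Dz; rewrite e => -[->]; apply: bal_lt bsi _; by case: Dz.
  apply: filterS (hT i iN) => z hz; split.
    move=> e; have Dz : D z by apply: contrapT => /(hio z).2 e'; rewrite e' in e.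
    have [Zz _] := Dz; have := (hio z).1 Dz; rewrite e => -[] /= ci.
    have /hz[ZT cT] : E i z by split.
    rewrite (hka _).1; last by split => //; rewrite /= cT; exact: bal_lt hth iN.
    by rewrite /= cT; congr S; exact: sith iN.
  move=> e; have Dz : D (T i $ z) by apply: contrapT => /(hka _).2 e'; rewrite e' in e.
  have [ZT bT] := Dz; have := (hka _).1 Dz; rewrite e => -[] /= ci.
  have /hz[Zz cz] : E (th i) (T i $ z).
    by split => //=; have := thsi _ bT; rewrite /= -ci => ->.
  by rewrite (hio z).1 /= ?cz//; split => //=; rewrite cz.
exists x.
  ae_use hx; ae_use (aut1 lambda); apply: aeW => z h1 [+ _] nZ.
  by rewrite (io0 z).2 ?h1//; move=> [].
ae_use hx; ae_use (cell_bound ch); apply: aeW => z hb [_ e] Zz.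
have Dz : D z by split => //; exact: hb.
have := e; rewrite ((hio z).1 Dz) => e'.
have Dx : D (x $ z) by apply: contrapT => /(hka _).2 e2; rewrite e2 in e'.
have := (hka _).1 Dx; rewrite e' => -[] /= ->.
by symmetry; apply: thsi; case: Dx.
Qed.

End Local.

(** * Limits of sequences that stabilize on cells *)

Section Limit.
Context (R : realType) (d : measure_display) (Y : measurableType d).
Variable lambda : {measure set Y -> \bar R}.
Local Notation G := (Aut lambda).
Local Notation leb := (@lebesgue_measure R).
Local Notation RR := (measurableTypeR R).
Variable ch : chart lambda.
Local Notation Z := (ch_dom ch).
Local Notation phi := (ch_map ch).
Local Notation psi := (ch_inv ch).
Local Notation c := (ch_size ch).
Local Notation cell := (cell ch).
Local Notation mesh := (mesh ch).
Local Notation loc := (loc ch).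

Let mZ : measurable Z := ch_dom_measurable ch.

Lemma count_leq i q : count (fun k => (k <= i)%N) (iota 0 q) = minn i.+1 q.
Proof.
elim: q => [|q ih]; first by rewrite minn0.
rewrite -addn1 iotaD count_cat ih /= add0n addn0; case: (leqP q i) => h /=; lia.
Qed.

Lemma chart_inv_push (E : Y -> RR) : measurable_fun setT E ->
  (forall S, measurable S -> lambda (Z `&` E @^-1` S) = leb (S `&` interval_from0 c%:E)) ->
  \forall z \ae lambda, Z z -> Z (psi (E z)) /\ phi (psi (E z)) = E z.
Proof.
move=> mE hE.
pose S := [set t | Z (psi t)] `&` [set t | phi (psi t) = t].
have mpsi := ch_inv_measurable ch; have mphi := ch_map_measurable ch.
have mS : measurable S.
  apply: measurableI; first exact: preimage_measurable.
  have mEq : measurable_fun setT (fun t : RR => phi (psi t) == t).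
    by apply: measurable_fun_eqr => //; exact: measurableT_comp.
  have := mEq measurableT [set true] I; rewrite setTI; congr measurable.
  by apply/seteqP; split=> t /= /eqP.
have mSC := measurableC mS.
have z : lambda (Z `&` phi @^-1` (~` S)) = 0%E.
  apply: ae_measure0; first by apply: measurableI => //; exact: preimage_measurable.
  by apply: filterS (ch_mapK ch) => x h [Zx] /=; rewrite /S/= (h Zx); apply.
rewrite (ch_map_measure ch mSC) -hE// in z.
exists (Z `&` E @^-1` (~` S)); split => //.
  by apply: measurableI => //; exact: preimage_measurable.
by move=> x /= /not_implyP[Zx h]; split => // -[/= h1 h2]; exact: h.
Qed.

(** The eventual cells [e n z] are nested, so they single out a point [E z] of the interval. Each
    [e n] spreads the mass of [Z] evenly over the cells, hence [E] pushes it to Lebesgue measure; so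
    almost every [E z] has a preimage in [Z] under the chart and is not an end point of a cell. *)
Lemma limit_map (x : nat -> G) (K N : nat -> nat) (th : nat -> nat -> nat) :
  (forall k, supp Z (x k)) ->
  (forall n k, (K n <= k)%N -> loc n (N n) (x k) (th n)) ->
  exists f : Y -> Y, [/\ measurable_fun setT f, forall z, ~ Z z -> f z = z,
    \forall z \ae lambda, Z z -> Z (f z),
    forall S, measurable S -> lambda (Z `&` f @^-1` S) = lambda (Z `&` S) &
    forall n, \forall z \ae lambda, Z z -> cell n (f z) = th n (cell (N n) z)].
Proof.
move=> sx hx.
pose e n z := th n (cell (N n) z).
have me n (p : pred nat) : measurable [set z | p (e n z)].
  exact: (cell_pred_measurable ch (N n) (p \o th n)).
have cons : \forall z \ae lambda, Z z -> forall n m, (m <= n)%N -> e m z = prj n m (e n z) /\ (e n z < 2 ^ n)%N.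
  suff h : \forall z \ae lambda, forall n m, Z z -> (m <= n)%N ->
      e m z = prj n m (e n z) /\ (e n z < 2 ^ n)%N.
    by apply: filterS h => z h Zz n m; exact: h.
  apply: ae_foralln => n; apply: ae_foralln => m.
  pose k := maxn (K n) (K m).
  have hn := hx n k (leq_maxl _ _); have hm := hx m k (leq_maxr _ _).
  ae_use hn; ae_use hm; ae_use (supp_stable (sx k)); ae_use (ae_map (x k) (cell_bound ch)).
  apply: aeW => z hb hs h1 h2 Zz mn.
  by rewrite /e -h1// -h2// -cell_prj//; split => //; apply: hb; apply/hs.
have e_measure n i : lambda (Z `&` [set z | (e n z <= i)%N]) = ((minn i.+1 (2 ^ n))%:R * mesh n)%R%:E.
  have -> := measure_cells ch (N n) (fun k => (th n k <= i)%N).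
  have := loc_measure (fun k => (k <= i)%N) (sx (K n)) (hx n _ (leqnn _)).
  by rewrite count_leq => <-.
(* The truncation by [2 ^ n] makes the supremum below that of a bounded set at every point; almost
   everywhere on [Z] it changes nothing. *)
pose h n z : R := ((minn (e n z) (2 ^ n))%:R * mesh n)%R.
have m0 n := mesh_gt0 ch n.
have hc n z : (h n z <= c)%R.
  by rewrite /h -(mesh_total ch n) ler_pM2r// ler_nat geq_minr.
have h0 n z : (0 <= h n z)%R by rewrite /h mulr_ge0// ltW.
have mh n : measurable_fun setT (h n : Y -> RR).
  move=> _ A mA; rewrite setTI.
  have := me n (fun k => `[< A ((minn k (2 ^ n))%:R * mesh n)%R >]).
  by congr measurable; apply/seteqP; split=> z /= /asboolP.
pose E z : RR := sups (h ^~ z) 0.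
have hub z : has_ubound (range (h ^~ z)) by exists c => _ [n _ <-]; exact: hc.
have Edef z : E z = sup (range (h ^~ z)).
  by rewrite /E /sups /sdrop; congr sup; apply/seteqP; split=> t [n _ <-]; exists n.
have mE : measurable_fun setT E by apply: measurable_fun_sups => // t _.
have E1 n z : (h n z <= E z)%R.
  by rewrite Edef; apply: ub_le_sup => //; exists n.
have E2 : \forall z \ae lambda, Z z -> forall n,
    ((e n z)%:R * mesh n <= (E z : R) <= (e n z).+1%:R * mesh n)%R.
  apply: filterS cons => z hz Zz n.
  have hE m : h m z = ((e m z)%:R * mesh m)%R.
    by rewrite /h (minn_idPl _)//; apply: ltnW; have [] := hz Zz m m (leqnn _).
  rewrite -hE E1 /= Edef; apply: ge_sup; first by exists (h 0%N z), 0%N.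
  move=> _ [m _ <-]; have [mn|nm] := leqP m n.
    apply: (@le_trans _ _ (h n z)); last by rewrite hE ler_pM2r// ler_nat.
    rewrite !hE; have [-> _] := hz Zz n m mn.
    rewrite (meshE ch mn) mulrA ler_pM2r// -natrM ler_nat; exact: leq_trunc_div.
  rewrite hE; have [-> _] := hz Zz m n (ltnW nm).
  rewrite (meshE ch (ltnW nm)) mulrA ler_pM2r// -natrM ler_nat.
  by apply: ltnW; rewrite -ltn_divLR ?expn_gt0// ltnS.
have push b : (0 <= b)%R -> (b <= c)%R -> lambda (Z `&` [set z | ((E z : R) < b)%R]) = b%:E.
  move=> b0 bc.
  have mray : measurable (Z `&` [set z | ((E z : R) < b)%R]).
    apply: measurableI => //; rewrite (_ : [set _ | _] = E @^-1` `]-oo, b[%classic).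
      by apply: preimage_measurable => //; exact: measurable_itv.
    by apply/seteqP; split=> z /=; rewrite in_itv.
  have mei n i : measurable (Z `&` [set z | (e n z <= i)%N]).
    by apply: measurableI => //; exact: (me n (fun k => (k <= i)%N)).
  have fin : lambda (Z `&` [set z | ((E z : R) < b)%R]) \is a fin_num.
    rewrite ge0_fin_numE//; apply: (@le_lt_trans _ _ (lambda Z)).
      by apply: le_measure; rewrite ?inE// => z [].
    by rewrite (ch_domE ch) ltry.
  rewrite -(fineK fin); congr EFin; set r := fine _.
  have up n : (r <= b + mesh n)%R.
    have jb : ((Num.truncn (b / mesh n)%R)%:R * mesh n <= b)%R.
      by rewrite -ler_pdivlMr// truncn_le divr_ge0// ltW.
    rewrite -lee_fin /r fineK//.
    apply: (@le_trans _ _ (lambda (Z `&` [set z | (e n z <= Num.truncn (b / mesh n)%R)%N]))).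
      apply: le_measure_ae => //; apply: filterS E2 => z h2 [Zz /= Eb]; split => //=.
      have /andP[h3 _] := h2 Zz n.
      rewrite truncn_ge_nat; last by rewrite divr_ge0// ltW.
      by rewrite ler_pdivlMr//; exact: ltW (le_lt_trans h3 Eb).
    rewrite e_measure lee_fin; apply: (@le_trans _ _ ((Num.truncn (b / mesh n)%R).+1%:R * mesh n)%R).
      by rewrite ler_pM2r// ler_nat geq_minl.
    by rewrite -natr1 mulrDl mul1r lerD2r.
  have lo n : (b - 2%:R * mesh n <= r)%R.
    have r0 : (0 <= r)%R by exact: fine_ge0.
    have jb : (b < (Num.truncn (b / mesh n)%R).+1%:R * mesh n)%R.
      by rewrite -ltr_pdivrMr//; exact: truncnS_gt.
    set j := Num.truncn _ in jb.
    have [j2|j2] := leqP j 1.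
      have : (b <= 2%:R * mesh n)%R.
        by apply/ltW/(lt_le_trans jb); rewrite ler_pM2r// ler_nat.
      by rewrite -subr_le0 => /le_trans; apply.
    (* The cell of index [j.-1] is given up too: [E2] bounds [E z] by the right end only weakly,
       while [E z < b] is needed. This is the second [mesh n] in the bound. *)
    have [i ji] : exists i, j = i.+2 by exists j.-2; lia.
    apply: (@le_trans _ _ (i.+1%:R * mesh n)%R).
      move: jb; rewrite ji -(addn2 i.+1) natrD mulrDl => /ltW; lra.
    rewrite -lee_fin /r fineK//.
    apply: (@le_trans _ _ (lambda (Z `&` [set z | (e n z <= i)%N]))).
      rewrite e_measure lee_fin ler_pM2r// ler_nat leq_min leqnn /=.
      have : (j%:R * mesh n <= (2 ^ n)%:R * mesh n)%R.
        rewrite mesh_total; apply: le_trans bc; rewrite -ler_pdivlMr//.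
        by rewrite /j truncn_le divr_ge0// ltW.
      by rewrite ler_pM2r// ler_nat ji => /ltnW.
    apply: le_measure_ae => //; apply: filterS E2 => z h2 [Zz /= ei]; split => //=.
    have /andP[_ h3] := h2 Zz n; apply: (le_lt_trans h3).
    apply: (@lt_le_trans _ _ (j%:R * mesh n)%R).
      by rewrite ltr_pM2r// ltr_nat ji !ltnS.
    by rewrite -ler_pdivlMr// truncn_le divr_ge0// ltW.
  apply/eqP; rewrite eq_le; apply/andP; split; apply/ler_addgt0Pr => eps eps0.
    by have [n /ltW hn] := mesh_small ch eps0; apply: (le_trans (up n)); rewrite lerD2l.
  have eps2 : (0 < eps / 2)%R by rewrite divr_gt0.
  have [n hn] := mesh_small ch eps2; have := lo n; move: hn; lra.
have pushE S : measurable S -> lambda (Z `&` E @^-1` S) = leb (S `&` interval_from0 c%:E).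
  rewrite -(ch_domE ch); apply: push_interval => // b b0; rewrite (ch_domE ch) lee_fin; exact: push.
have inv := chart_inv_push mE pushE.
have strict : \forall z \ae lambda, Z z -> forall n, ((E z : R) < (e n z).+1%:R * mesh n)%R.
  have : \forall z \ae lambda, forall n i, Z z -> E z <> (i%:R * mesh n)%R.
    apply: ae_foralln => n; apply: ae_foralln => i.
    have ms : measurable ([set (i%:R * mesh n)%R] : set RR) by exact: measurable_set1.
    exists (Z `&` E @^-1` [set (i%:R * mesh n)%R]); split.
    - by apply: measurableI => //; exact: preimage_measurable.
    - rewrite pushE//; apply/eqP; rewrite -measure_le0.
      apply: (@le_trans _ _ (leb [set (i%:R * mesh n)%R])); last by rewrite (lebesgue_measure_set1 (i%:R * mesh n)%R).
      apply: le_measure; rewrite ?inE//.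
      by apply: measurableI => //; exact: measurable_interval_from0.
    - by move=> z /= /not_implyP[Zz /contrapT].
  apply: filterS2 E2 => z h2 h3 Zz n; have /andP[_] := h2 Zz n.
  by rewrite le_eqVlt => /orP[/eqP /(h3 _ _ Zz)|].
pose f z := if z \in Z then psi (E z) else z.
have fZ z : Z z -> f z = psi (E z) by move=> Zz; rewrite /f ifT// inE.
have mpE : measurable_fun setT (psi \o E).
  by apply: measurableT_comp => //; exact: ch_inv_measurable.
have mf : measurable_fun setT f.
  apply: measurable_fun_ifT => //.
  by apply: (measurable_fun_bool true); rewrite setTI preimage_mem_true.
exists f; split => //.
- by move=> z nZ; rewrite /f ifF//; apply/negP; rewrite inE.
- by apply: filterS inv => z hz Zz; rewrite fZ//; have [] := hz Zz.
- move=> S mS.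
  rewrite (_ : _ `&` _ = Z `&` (psi \o E) @^-1` S); last first.
    by apply/seteqP; split=> z [Zz] /=; rewrite fZ.
  have mS' := preimage_measurable (ch_inv_measurable ch) mS.
  rewrite comp_preimage pushE// -(ch_map_measure ch mS'); apply: eq_measure_ae.
  + by apply: measurableI => //; exact: ch_preimage_measurable.
  + exact: measurableI.
  + by apply: filterS (ch_mapK ch) => z hz /=; split=> -[Zz]; rewrite hz.
- move=> n; ae_use inv; ae_use E2; ae_use strict; apply: aeW => z h1 h2 h3 Zz.
  have [_ e3] := h3 Zz; have /andP[e2 _] := h2 Zz n; have e1 := h1 Zz n.
  rewrite fZ//; apply/eqP; rewrite eqn_leq cell_le e3 e1 /=.
  rewrite leqNgt; apply/negP => lt.
  have [i ei] : exists i, e n z = i.+1 by exists (e n z).-1; rewrite /e; lia.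
  move: lt; rewrite -/(e n z) ei ltnS cell_le e3 -ei => lt.
  by have := lt_le_trans lt e2; rewrite ltxx.
Qed.

End Limit.

Section LimitAut.
Context (R : realType) (d : measure_display) (Y : measurableType d).
Variable lambda : {measure set Y -> \bar R}.
Local Notation G := (Aut lambda).
Variable ch : chart lambda.
Local Notation Z := (ch_dom ch).
Local Notation phi := (ch_map ch).
Local Notation psi := (ch_inv ch).
Local Notation c := (ch_size ch).
Local Notation cell := (cell ch).
Local Notation loc := (loc ch).

Let mZ : measurable Z := ch_dom_measurable ch.

Lemma ae_pullback (f : Y -> Y) (P : Y -> Prop) : measurable_fun setT f ->
  (forall S, measurable S -> lambda (Z `&` f @^-1` S) = lambda (Z `&` S)) ->
  (\forall z \ae lambda, P z) -> \forall z \ae lambda, Z z -> P (f z).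
Proof.
move=> mf hf [M [mM M0 hM]]; exists (Z `&` f @^-1` M); split.
- by apply: measurableI => //; exact: preimage_measurable.
- rewrite hf//; apply: (@subset_measure0 _ _ _ _ _ M) => //; exact: measurableI.
- by move=> z /= /not_implyP[Zz nP]; split => //; exact: hM.
Qed.

Lemma limit_cancel (x : nat -> G) (f g : Y -> Y) (K N K' N' : nat -> nat) (th th' : nat -> nat -> nat) :
  (forall k, supp Z (x k)) ->
  (forall n k, (K n <= k)%N -> loc n (N n) (x k) (th n)) ->
  (forall n k, (K' n <= k)%N -> loc n (N' n) (x k)^-1 (th' n)) ->
  measurable_fun setT f -> (\forall z \ae lambda, Z z -> Z (f z)) ->
  (forall S, measurable S -> lambda (Z `&` f @^-1` S) = lambda (Z `&` S)) ->
  measurable_fun setT g -> (\forall z \ae lambda, Z z -> Z (g z)) ->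
  (forall S, measurable S -> lambda (Z `&` g @^-1` S) = lambda (Z `&` S)) ->
  (forall n, \forall z \ae lambda, Z z -> cell n (f z) = th n (cell (N n) z)) ->
  (forall n, \forall z \ae lambda, Z z -> cell n (g z) = th' n (cell (N' n) z)) ->
  \forall z \ae lambda, Z z -> g (f z) = z.
Proof.
move=> sx hx hx' mf Zf pf mg Zg pg fE gE.
have key : \forall z \ae lambda, forall n, Z z -> cell n (g (f z)) = cell n z.
  apply: ae_foralln => n; pose k := maxn (K (N' n)) (K' n).
  have h1 := hx (N' n) k (leq_maxl _ _); have h2 := hx' n k (leq_maxr _ _).
  ae_use (ae_pullback mf pf (gE n)); ae_use (fE (N' n)); ae_use h1; ae_use (ae_map (x k) h2).
  ae_use (supp_stable (sx k)); ae_use (autVK (x k)); ae_use Zf.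
  apply: aeW => z hZ e1 e2 h3 h4 h5 h6 Zz.
  by rewrite (h6 Zz (hZ Zz)) h5// -h4// -h3 ?e1//; exact/e2.
have rg : \forall z \ae lambda, Z z -> Z (f z) -> (Z (g (f z)) -> (0 <= (phi (g (f z)) : R) < c)%R) /\ (Z (g (f z)) -> psi (phi (g (f z))) = g (f z)).
  exact: (ae_pullback mf pf (ae_pullback mg pg (filterI (phi_range ch) (ch_mapK ch)))).
have rg' : \forall z \ae lambda, Z z -> Z (f z) -> Z (g (f z)) by exact: ae_pullback mf pf Zg.
ae_use rg; ae_use rg'; ae_use key; ae_use Zf; ae_use (phi_range ch); ae_use (ch_mapK ch).
apply: aeW => z h1 h2 h3 h4 h5 h6 Zz.
have Zfz := h3 Zz; have Zgz := h5 Zz Zfz; have [h7 h8] := h6 Zz Zfz.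
rewrite -[RHS](h1 Zz) -[LHS](h8 Zgz); congr psi; apply: cell_separates => [||n]; last exact: h4.
  by have /andP[] := h7 Zgz.
by have /andP[] := h2 Zz.
Qed.

(** The inverses have to stabilize as well: the limit of the maps alone preserves the measure but
    could fail to be invertible. *)
Lemma limit_aut (x : nat -> G) : (forall k, supp Z (x k)) ->
  (forall n, exists K N th, forall k, (K <= k)%N -> loc n N (x k) th) ->
  (forall n, exists K N th, forall k, (K <= k)%N -> loc n N (x k)^-1 th) ->
  exists T : G, [/\ supp Z T,
    forall n N th K, (forall k, (K <= k)%N -> loc n N (x k) th) -> loc n N T th &
    forall n N th K, (forall k, (K <= k)%N -> loc n N (x k)^-1 th) -> loc n N T^-1 th].
Proof.
move=> sx /choice[K /choice[N /choice[th hx]]] /choice[K' /choice[N' /choice[th' hx']]].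
have sxV k : supp Z (x k)^-1 by exact/suppV.
have [f [mf fid Zf pf fE]] := limit_map sx hx.
have [g [mg gid Zg pg gE]] := limit_map sxV hx'.
have gf := limit_cancel sx hx hx' mf Zf pf mg Zg pg fE gE.
have hxV n k : (K n <= k)%N -> loc n (N n) ((x k)^-1)^-1 (th n) by rewrite invgK; exact: hx.
have fg := limit_cancel sxV hx' hxV mg Zg pg mf Zf pf gE fE.
have gfa : \forall z \ae lambda, g (f z) = z.
  by apply: filterS gf => z h; have [/h//|nZ] := pselect (Z z); rewrite fid// gid.
have fga : \forall z \ae lambda, f (g z) = z.
  by apply: filterS fg => z h; have [/h//|nZ] := pselect (Z z); rewrite gid// fid.
have pfa A : measurable A -> lambda (f @^-1` A) = lambda A.
  move=> mA; have mfA := preimage_measurable mf mA.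
  have e1 : lambda (f @^-1` A) = (lambda (f @^-1` A `\` Z) + lambda (f @^-1` A `&` Z))%E.
    exact: measureDI.
  have e2 : lambda A = (lambda (A `\` Z) + lambda (A `&` Z))%E by exact: measureDI.
  rewrite e1 e2 (setIC _ Z) pf// (setIC _ A); congr (lambda _ + _)%E.
  by apply/seteqP; split=> z [/= h nZ]; rewrite ?fid// in h *; split; rewrite /= ?fid.
have [T hT] := realize mf mg gfa fga pfa.
have hTV : \forall z \ae lambda, T^-1 $ z = g z.
  apply: (ae_surj (T := T)); ae_use (autVK T); ae_use gfa; ae_use hT.
  by apply: aeW => z -> -> ->.
exists T; split.
- by apply: filterS hT => z -> nZ; exact: fid.
- move=> n M t L ht; pose k := maxn L (K n).
  have h1 := ht k (leq_maxl _ _); have h2 := hx n k (leq_maxr _ _).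
  ae_use h1; ae_use h2; ae_use hT; ae_use (fE n); apply: aeW => z e1 -> e3 e4 Zz.
  by rewrite e1// -e3// e4.
- move=> n M t L ht; pose k := maxn L (K' n).
  have h1 := ht k (leq_maxl _ _); have h2 := hx' n k (leq_maxr _ _).
  ae_use h1; ae_use h2; ae_use hTV; ae_use (gE n); apply: aeW => z e1 -> e3 e4 Zz.
  by rewrite e1// -e3// e4.
Qed.

End LimitAut.

(** * Generic conjugates *)

Section Baire.
Context (R : realType) (d : measure_display) (Y : measurableType d).
Variable lambda : {measure set Y -> \bar R}.
Local Notation G := (Aut lambda).
Variable ch : chart lambda.
Local Notation Z := (ch_dom ch).
Local Notation loc := (loc ch).

Let mZ : measurable Z := ch_dom_measurable ch.

Lemma loc_invE N (x : G) th th' : supp Z x -> loc N N x th -> eqn_on N (th' \o th) id ->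
  loc N N x^-1 th'.
Proof.
move=> sx hx e2; apply: (ae_surj (T := x)).
ae_use hx; ae_use (autVK x); ae_use (supp_stable sx); ae_use (cell_bound ch).
apply: aeW => z hb h1 -> h2 /h1 Zz; rewrite h2//.
by rewrite -[RHS]/((th' \o th) _) e2//; exact: hb.
Qed.

Lemma loc_down N n (x : G) t1 t0 : (n <= N)%N -> loc N N x t1 ->
  eqn_on N (prj N n \o t1) (t0 \o prj N n) -> loc n n x t0.
Proof.
move=> nN h1 e; have h := loc_prj nN h1; ae_use (loc_ext e h).
by apply: aeW => z hz Zz; rewrite hz//= -cell_prj.
Qed.

Lemma loc_factor N n (x : G) t1 t0 : (n <= N)%N -> loc N N x t1 -> loc n n x t0 ->
  eqn_on N (prj N n \o t1) (t0 \o prj N n).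
Proof. by move=> nN h1 h0; apply: loc_uniq (loc_prj nN h1) (loc_up nN h0). Qed.

Definition level (xs : seq G) N :=
  forall i, (i < size xs)%N -> exists s, loc N N (nth 1 xs i) s.

(* every balanced extension of the action of [xs] on the cells of a level is
   realized inside a finer level *)
Definition realizes (xs : seq G) M L r sL :=
  bal L M r ->
  (forall i, (i < size xs)%N -> bal L L (sL i) /\
    exists2 s, loc M M (nth 1 xs i) s & eqn_on L (r \o sL i) (s \o r)) ->
  exists N th, [/\ (M < N)%N, bal N L th, eqn_on N (r \o th) (prj N M) &
    forall i, (i < size xs)%N ->
      exists2 s, loc N N (nth 1 xs i) s & eqn_on N (th \o s) (sL i \o th)].

(** Over all finite extension problems this is the extension property of a projective Fraisse limit,
    the combinatorial form of genericity that a back-and-forth between two sequences consumes. *)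
Definition good xs := forall M L r sL, realizes xs M L r sL.

Lemma good_nil : good [::].
Proof.
move=> M L r sL br _; have [ML _] := br.
have MN : (M <= (maxn L M).+1)%N by rewrite leqW// leq_maxr.
have LN : (L <= (maxn L M).+1)%N by rewrite leqW// leq_maxl.
have [th bth e] := bal_lift (bal_prj MN) br LN.
by exists (maxn L M).+1, th; split => //; rewrite ltnS leq_maxr.
Qed.

Lemma bal_lift_prj N n t : (n <= N)%N -> bal n n t ->
  exists2 t', bal N N t' & eqn_on N (prj N n \o t') (t \o prj N n).
Proof.
move=> nN bt.
exact: (bal_lift (bal_comp (bal_prj nN) bt) (bal_prj nN) (leqnn N)).
Qed.

(** Goodness is fed a lift of the action to level [maxn N B]; a solution is balanced onto that
    level, hence at least as fine as [B]. *)
Lemma good_level xs N B : (forall x, x \in xs -> supp Z x) -> good xs -> level xs N ->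
  exists N', [/\ (N < N')%N, (B <= N')%N & level xs N'].
Proof.
move=> sxs gxs lN; pose L := maxn N B.
have NL : (N <= L)%N by exact: leq_maxl.
have /choice[sL hsL] : forall i, exists s', (i < size xs)%N -> bal L L s' /\
    exists2 s, loc N N (nth 1 xs i) s & eqn_on L (prj L N \o s') (s \o prj L N).
  move=> i; have [il|] := boolP (i < size xs)%N; last by exists id.
  have [s hs] := lN i il.
  have bs := loc_bal (sxs _ (mem_nth _ il)) (leqnn _) hs.
  by have [s' bs' e] := bal_lift_prj NL bs; exists s' => _; split => //; exists s.
have [N' [th [lt bth _ h]]] := gxs N L (prj L N) sL (bal_prj NL) hsL.
exists N'; split => //.
  by case: bth => /(leq_trans _) + _; apply; exact: leq_maxr.
by move=> i /h[s hs _]; exists s.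
Qed.

Lemma realize_step xs N0 t0 M L r sL : (forall x, x \in xs -> supp Z x) ->
  good xs -> level xs N0 -> bal N0 N0 t0 ->
  exists N1 t1, [/\ (N0 < N1)%N, level xs N1, bal N1 N1 t1,
    eqn_on N1 (prj N1 N0 \o t1) (t0 \o prj N1 N0) &
    forall y, supp Z y -> loc N1 N1 y t1 -> realizes (rcons xs y) M L r sL].
Proof.
move=> sxs gxs lN bt0.
wlog MN : N0 t0 lN bt0 / (M <= N0)%N.
  move=> W; have [N' [lt BN' lN']] := good_level M sxs gxs lN.
  have [t' bt' e'] := bal_lift_prj (ltnW lt) bt0.
  have [N1 [t1 [lt1 l1 b1 e1 h1]]] := W _ _ lN' bt' BN'.
  exists N1, t1; split => //; first exact: ltn_trans lt1.
  move=> k kN /=; rewrite -(prj_prj _ (ltnW lt) (ltnW lt1)).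
  rewrite -(prj_prj k (ltnW lt) (ltnW lt1)) -[RHS]/((t0 \o prj N' N0) _) -e' /=.
    by congr prj; exact: e1.
  exact: prj_lt (ltnW lt1) kN.
have [[br [hxs [bn [s [e1 e2]]]]]|nh] := pselect (bal L M r /\
   (forall i, (i < size xs)%N -> bal L L (sL i) /\
      exists2 s, loc M M (nth 1 xs i) s & eqn_on L (r \o sL i) (s \o r)) /\
   bal L L (sL (size xs)) /\ exists s, eqn_on N0 (prj N0 M \o t0) (s \o prj N0 M) /\
     eqn_on L (r \o sL (size xs)) (s \o r)); last first.
  have [N1 [lt _ lN1]] := good_level 0 sxs gxs lN.
  have [t1 bt1 et1] := bal_lift_prj (ltnW lt) bt0.
  exists N1, t1; split => // y sy hy br hd; exfalso; apply: nh; split => //; split.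
    by move=> i il; have := hd i; rewrite nth_rcons il; apply; rewrite size_rcons ltnW.
  have := hd (size xs); rewrite size_rcons nth_rcons ltnn eqxx => -[//|bn [s hs es]].
  split => //; exists s; split => //.
  by apply: (loc_factor (x := y)) => //; exact: loc_down (ltnW lt) hy et1.
have [P [Q [bP bQ PQ fib]]] := fibre_product (bal_prj MN) br.
set q := (N0 + (L - M))%N in bP bQ PQ fib.
have /choice[W hW] : forall i, exists w, (i < size xs)%N -> bal q q w /\
    (exists2 s, loc N0 N0 (nth 1 xs i) s & eqn_on q (P \o w) (s \o P)) /\
    eqn_on q (Q \o w) (sL i \o Q).
  move=> i; have [il|] := boolP (i < size xs)%N; last by exists id.
  have [bi [si hsi esi]] := hxs i il; have [s0 hs0] := lN i il.
  have bs0 := loc_bal (sxs _ (mem_nth _ il)) (leqnn _) hs0.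
  have [|w bw [w1 w2]] := fib s0 (sL i) bs0 bi.
    move=> a b aN bL ab; have := loc_factor MN hs0 hsi aN; rewrite /= => ->.
    by rewrite ab -[RHS]/((r \o sL i) b) esi.
  by exists w => _; split => //; split => //; exists s0.
have [|w bw [w1 w2]] := fib t0 (sL (size xs)) bt0 bn.
  move=> a b aN bL ab; have := e1 a aN; rewrite /= => ->.
  by rewrite ab -[RHS]/((r \o sL (size xs)) b) e2.
have [|N1 [th [lt bth eth hth]]] := gxs N0 q P W bP.
  by move=> i il; have [bi [h _]] := hW i il; split.
have [t1 bt1 et1] := bal_lift (bal_comp bth bw) bth (leqnn N1).
have lt_th k : (k < 2 ^ N1)%N -> (th k < 2 ^ q)%N by exact: bal_lt bth.
exists N1, t1; split => //.
- by move=> i /hth[s' hs' _]; exists s'.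
- move=> k kN; have k1 := bal_lt bt1 kN; rewrite /= -(eth _ k1) /=.
  rewrite -(eth _ kN); have /= -> := et1 k kN; exact: w1 (lt_th k kN).
move=> y sy hy _ hd; exists N1, (Q \o th); split.
- exact: leq_ltn_trans lt.
- exact: bal_comp bth bQ.
- move=> k kN /=; rewrite -[LHS]/((r \o Q) _) -PQ ?lt_th//= -[P _]/((P \o th) k) eth//.
  by rewrite prj_prj// ltnW.
- move=> i; rewrite size_rcons ltnS leq_eqVlt nth_rcons => /orP[/eqP ->|il].
    rewrite ltnn eqxx; exists t1 => // k kN /=.
    have /= -> := et1 k kN; exact: w2 (lt_th k kN).
  rewrite il; have [s' hs' es'] := hth i il; exists s' => // k kN /=.
  have [_ [_ e]] := hW i il.
  have /= -> := es' k kN; exact: e (lt_th k kN).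
Qed.

(* automorphisms of [Z] that are continuous, with their inverse, for the
   topology generated by the cells *)
Definition tame (a : G) := [/\ supp Z a, forall n, exists N th, loc n N a th &
  forall n, exists N th, loc n N a^-1 th].

Lemma tame1 : tame 1.
Proof.
split; first exact: supp1.
  by move=> n; exists n, id; exact: loc1.
by move=> n; exists n, id; rewrite invg1; exact: loc1.
Qed.

Lemma tameV a : tame a -> tame a^-1.
Proof. by move=> [sa h1 h2]; split => //; [exact: suppV|rewrite invgK]. Qed.

Lemma tameM a b : tame a -> tame b -> tame (a * b).
Proof.
move=> [sa a1 a2] [sb b1 b2]; split; first exact: suppM.
  move=> n; have [N [th h]] := a1 n; have [M [eta h']] := b1 N.
  by exists M, (th \o eta); exact: loc_mul h h'.
move=> n; have [N [th h]] := b2 n; have [M [eta h']] := a2 N.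
by exists M, (th \o eta); rewrite invgM; apply: loc_mul h h'; exact: suppV.
Qed.

(** Tameness of [b] turns a condition on [b * y] into one on [y] at a finer level: [t'] lifts [t]
    through the map induced by [b]. *)
Lemma translate_step xs N t b : (forall x, x \in xs -> supp Z x) ->
  good xs -> level xs N -> bal N N t -> tame b ->
  exists N' t', [/\ (N < N')%N, level xs N', bal N' N' t' &
    forall y, supp Z y -> loc N' N' y t' -> loc N N (b * y) t].
Proof.
move=> sxs gxs lN bt [sb tb _]; have [N0 [be hbe]] := tb N.
have [N1 [lt BN lN1]] := good_level N0 sxs gxs lN.
have h1 := loc_up BN hbe; have b1 := loc_bal sb (ltnW lt) h1.
have [t' bt' e] := bal_lift (bal_comp (bal_prj (ltnW lt)) bt) b1 (leqnn N1).
exists N1, t'; split => // y sy hy.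
have := loc_ext e (loc_mul sy h1 hy); apply: filterS => z hz Zz.
by rewrite hz//= -cell_prj// ltnW.
Qed.

(** Only values below [2 ^ L] matter, so the extension problems can be given by finite sequences and
    there are countably many. *)
Lemma realizes_ext xs M L r r' sL sL' : eqn_on L r r' ->
  (forall i, (i < size xs)%N -> eqn_on L (sL i) (sL' i)) ->
  realizes xs M L r sL -> realizes xs M L r' sL'.
Proof.
move=> er es h br hd; have [||N [th [lt bth e1 e2]]] := h.
- by apply: eq_bal br => k kL; rewrite er.
- move=> i il; have [bi [s hs e]] := hd i il; split.
    by apply: eq_bal bi => k kL; rewrite es.
  exists s => // k kL /=; rewrite es// !er//; first exact: e.
  exact: bal_lt bi kL.
exists N, th; split => //.
  by move=> k kN; rewrite -e1//= er//; exact: bal_lt bth kN.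
move=> i il; have [s hs e] := e2 i il; exists s => // k kN /=.
by have /= -> := e k kN; rewrite es//; exact: bal_lt bth kN.
Qed.

Hypothesis iso : lebesgue_like lambda.
Hypothesis infY : lambda setT = +oo%E.

Lemma generic xs m (a : nat -> G) : (forall x, x \in xs -> supp Z x) ->
  good xs -> level xs m -> (forall j, tame (a j)) ->
  exists x, [/\ tame x, loc m m x id & forall j, good (rcons xs (a j * x))].
Proof.
move=> sxs gxs lm ta.
pose st_ok (st : nat * (nat -> nat)) := level xs st.1 /\ bal st.1 st.1 st.2.
pose acts (x : G) (st : nat * (nat -> nat)) := loc st.1 st.1 x st.2.
pose datum := (nat * nat * nat * seq nat * seq (seq nat))%type.
pose meets (k : nat) (x : G) := forall j M L r sL,
  unpickle k = Some ((j, M, L, r, sL) : datum) ->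
  realizes (rcons xs (a j * x)) M L (nth 0%N r) (fun i => nth 0%N (nth [::] sL i)).
have step k st : exists st', st_ok st -> [/\ (st.1 < st'.1)%N, st_ok st' &
    forall x, supp Z x -> acts x st' -> acts x st /\ meets k x].
  have [ok|nok] := pselect (st_ok st); last by exists st.
  case: st ok => N t [/= lN bt].
  have [j [M [L [r [sL hk]]]]] : exists j M L r sL, forall x,
      realizes (rcons xs (a j * x)) M L (nth 0%N r) (fun i => nth 0%N (nth [::] sL i)) ->
      meets k x.
    rewrite /meets; case: (unpickle k) => [[[[[j M] L] r] sL]|].
      by exists j, M, L, r, sL => x hx _ _ _ _ _ [<- <- <- <- <-].
    by exists 0%N, 0%N, 0%N, [::], [::].
  (* The condition on [x] is carried to [a j * x], refined there to meet the requirement, and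
     carried back to [x]. *)
  have [N1 [t1 [lt1 l1 b1 h1]]] := translate_step sxs gxs lN bt (tameV (ta j)).
  have [N2 [t2 [lt2 l2 b2 e2 h2]]] := realize_step M L (nth 0%N r)
    (fun i => nth 0%N (nth [::] sL i)) sxs gxs l1 b1.
  have [N3 [t3 [lt3 l3 b3 h3]]] := translate_step sxs gxs l2 b2 (ta j).
  exists (N3, t3) => _; split => //=.
    exact: ltn_trans lt1 (ltn_trans lt2 lt3).
  move=> x sx /(h3 _ sx) hx; have [sa _ _] := ta j.
  have say : supp Z (a j * x) by exact: suppM.
  split; last by apply/hk/h2.
  have := h1 _ say (loc_down (ltnW lt2) hx e2); rewrite mulgA mulVg mul1g; exact.
have /choice[next hnext] := fun p : nat * (nat * (nat -> nat)) => step p.1 p.2.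
pose fix seq_st k := if k is i.+1 then next (i, seq_st i) else (m, id).
have ok k : st_ok (seq_st k).
  elim: k => [|k ih]; first by split => //; exact: bal_id.
  by have [] := hnext (k, seq_st k) ih.
have lt k : ((seq_st k).1 < (seq_st k.+1).1)%N.
  by have [] := hnext (k, seq_st k) (ok k).
have /choice[y hy] : forall k, exists y : G, supp Z y /\ acts y (seq_st k).
  by move=> k; have [y sy hy] := perm_exists ch iso infY (ok k).2; exists y.
have desc x k i : supp Z x -> acts x (seq_st (i + k)%N) -> acts x (seq_st k).
  move=> sx; elim: i => [//|i ih] h; apply: ih.
  by have [_ _ hn] := hnext ((i + k)%N, seq_st (i + k)%N) (ok _); have [] := hn x sx h.
have desc' k l : (k <= l)%N -> acts (y l) (seq_st k).
  move=> kl; have [sy hl] := hy l; apply: (desc _ _ (l - k)%N) => //.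
  by rewrite subnK.
have ge k : (k <= (seq_st k).1)%N.
  by elim: k => [//|k ih]; exact: leq_ltn_trans ih (lt k).
have /choice[ti hti] : forall k, exists t, bal (seq_st k).1 (seq_st k).1 t /\
    eqn_on (seq_st k).1 (t \o (seq_st k).2) id.
  by move=> k; have [t [bt _ e]] := bal_inv (ok k).2; exists t.
have [|||x [sx hx hx']] := @limit_aut _ _ _ lambda ch y.
- by move=> k; case: (hy k).
- move=> n; exists n, (seq_st n).1, (prj (seq_st n).1 n \o (seq_st n).2) => k nk.
  by apply: (loc_prj (ge n)); exact: desc'.
- move=> n; exists n, (seq_st n).1, (prj (seq_st n).1 n \o ti n) => k nk.
  apply: (loc_prj (ge n)); apply: (loc_invE _ (desc' _ _ nk)); last by case: (hti n).
  by case: (hy k).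
have ax k : acts x (seq_st k) by apply: (hx _ _ _ k) => l; exact: desc'.
exists x; split.
- split => // n.
    exists (seq_st n).1, (prj (seq_st n).1 n \o (seq_st n).2).
    exact: (loc_prj (ge n) (ax n)).
  exists (seq_st n).1, (prj (seq_st n).1 n \o ti n).
  apply: (loc_prj (ge n)); apply: (loc_invE sx (ax n)); by case: (hti n).
- exact: (ax 0%N).
- move=> j M L r sL; pose r' := map r (iota 0 (2 ^ L)).
  pose sL' := [seq map (sL i) (iota 0 (2 ^ L)) | i <- iota 0 (size xs).+1].
  pose k := pickle ((j, M, L, r', sL') : datum).
  have [_ _ /(_ x sx (ax k.+1))[_ mk]] := hnext (k, seq_st k) (ok k).
  have := mk j M L r' sL' (pickleK _); apply: realizes_ext.
    by move=> i il; rewrite (nth_map 0%N) ?size_iota// nth_iota.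
  move=> i; rewrite size_rcons => il q qL.
  rewrite (nth_map 0%N) ?size_iota// nth_iota// add0n.
  by rewrite (nth_map 0%N) ?size_iota// nth_iota.
Qed.

End Baire.

(** * The back-and-forth game and its outcome *)

Section Game.
Context (R : realType) (d : measure_display) (Y : measurableType d).
Variable lambda : {measure set Y -> \bar R}.
Local Notation G := (Aut lambda).
Variable ch : chart lambda.
Local Notation Z := (ch_dom ch).
Local Notation loc := (loc ch).
Local Notation tame := (tame ch).
Local Notation good := (good ch).
Local Notation level := (level ch).
Hypothesis iso : lebesgue_like lambda.
Hypothesis infY : lambda setT = +oo%E.

(** [eta] is the trace of the inverse one step later, from level [m k.+1] to level [l k]. It makes
    the inverses stabilize, as [limit_aut] demands. *)
Lemma coherent_limit (m l : nat -> nat) (th : nat -> nat -> nat) :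
  (forall k, bal (l k) (m k) (th k)) ->
  (forall k, (m k < m k.+1)%N) -> (forall k, (l k < l k.+1)%N) ->
  (forall k, exists eta, eqn_on (l k.+1) (eta \o th k.+1) (prj (l k.+1) (l k)) /\
    eqn_on (l k.+1) (prj (m k.+1) (m k) \o th k.+1) (th k \o prj (l k.+1) (l k))) ->
  exists T, tame T /\ forall k, loc (m k) (l k) T (th k).
Proof.
move=> bth mlt llt /choice[eta heta].
have mge k : (k <= m k)%N by elim: k => // k ih; exact: leq_ltn_trans ih (mlt k).
have lge k : (k <= l k)%N by elim: k => // k ih; exact: leq_ltn_trans ih (llt k).
have /choice[y hy] : forall k, exists y, supp Z y /\ loc (m k) (l k) y (th k).
  move=> k; have [mk _] := bth k.
  have [t bt e] := bal_lift (bth k) (bal_prj mk) (leqnn _).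
  have [y sy hy] := perm_exists ch iso infY bt; exists y; split => //.
  exact: loc_ext e (loc_prj mk hy).
have desc k j y0 : loc (m (j + k)%N) (l (j + k)%N) y0 (th (j + k)%N) -> loc (m k) (l k) y0 (th k).
  elim: j => [//|j ih] h; apply: ih; have [_ e] := heta (j + k)%N.
  have := loc_ext e (loc_prj (ltnW (mlt _)) h); apply: filterS => z hz Zz.
  by rewrite hz//= -cell_prj// ltnW.
have desc' k j : (k <= j)%N -> loc (m k) (l k) (y j) (th k).
  by move=> kj; apply: (desc _ (j - k)%N); rewrite subnK//; case: (hy j).
have descV k y0 : supp Z y0 -> loc (m k.+1) (l k.+1) y0 (th k.+1) -> loc (l k) (m k.+1) y0^-1 (eta k).
  move=> sy h; have [e _] := heta k; apply: (ae_surj (T := y0)).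
  ae_use h; ae_use (autVK y0); ae_use (supp_stable sy); ae_use (cell_bound ch).
  apply: aeW => z hb h1 -> h2 /h1 Zz; rewrite h2// -[RHS]/((eta k \o th k.+1) _) e; last exact: hb.
  by rewrite -cell_prj// ltnW.
have [|||T [sT hT hTV]] := @limit_aut _ _ _ lambda ch y.
- by move=> k; case: (hy k).
- move=> n; exists n, (l n), (prj (m n) n \o th n) => k nk.
  by apply: (loc_prj (mge n)); exact: desc'.
- move=> n; exists n.+1, (m n.+1), (prj (l n) n \o eta n) => k nk.
  by apply: (loc_prj (lge n)); apply: descV; [case: (hy k)|exact: desc'].
have Tth k : loc (m k) (l k) T (th k) by apply: (hT _ _ _ k) => j; exact: desc'.
exists T; split => //; split => // n.
  by exists (l n), (prj (m n) n \o th n); exact: loc_prj (mge n) (Tth n).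
exists (m n.+1), (prj (l n) n \o eta n); apply: (hTV _ _ _ n.+1) => k nk.
by apply: (loc_prj (lge n)); apply: descV; [case: (hy k)|exact: desc'].
Qed.

(* [p_th] is the map induced on cells by the conjugating automorphism under
   construction, which has to carry each element of [p_ss] to the one of [p_xs] *)
Record game_state := GameState {
  p_xs : seq G; p_ss : seq G; p_m : nat; p_l : nat; p_th : nat -> nat }.

Definition p_ok p := [/\ size (p_ss p) = size (p_xs p),
  (forall x, x \in p_xs p -> supp Z x) /\ (forall x, x \in p_ss p -> supp Z x),
  good (p_xs p) /\ good (p_ss p), bal (p_l p) (p_m p) (p_th p) &
  forall i, (i < size (p_xs p))%N -> exists s x,
    [/\ loc (p_l p) (p_l p) (nth 1 (p_ss p) i) s, loc (p_m p) (p_m p) (nth 1 (p_xs p) i) x &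
        eqn_on (p_l p) (p_th p \o s) (x \o p_th p)]].

Definition p_next p x s p' := [/\ p_xs p' = rcons (p_xs p) x, p_ss p' = rcons (p_ss p) s,
  (p_m p < p_m p')%N, (p_l p < p_l p')%N & exists eta, 
   eqn_on (p_l p') (eta \o p_th p') (prj (p_l p') (p_l p)) /\
   eqn_on (p_l p') (prj (p_m p') (p_m p) \o p_th p') (p_th p \o prj (p_l p') (p_l p))].

Lemma p_level p : p_ok p -> level (p_xs p) (p_m p) /\ level (p_ss p) (p_l p).
Proof.
move=> [e _ _ _ h]; split=> i; rewrite ?e => /h[s [x [hs hx _]]]; [by exists x|by exists s].
Qed.

(** One round: goodness of [xs'] lifts [th] to a map [eta] from level [m'] to level [l], then
    goodness of [ss1] lifts [eta] to [th'] from level [l'] to level [m']. The new elements fix the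
    current cells, so they are already intertwined by [th]. *)
Lemma p_step p x s : p_ok p -> tame x -> tame s -> loc (p_m p) (p_m p) x id ->
  loc (p_l p) (p_l p) s id -> good (rcons (p_xs p) x) -> good (rcons (p_ss p) s) ->
  exists p', p_ok p' /\ p_next p x s p'.
Proof.
case: p => xs ss m l th [/= es [sxs sss] _ bth h] [sx _ _] [ss' _ _] hx hs gx gs.
set xs' := rcons xs x in gx; set ss1 := rcons ss s in gs.
have mem_rc (u : seq G) v : (forall x, x \in u -> supp Z x) -> supp Z v ->
    forall x, x \in rcons u v -> supp Z x.
  by move=> hu hv y; rewrite mem_rcons inE => /orP[/eqP ->|/hu].
have sxs' : forall x, x \in xs' -> supp Z x by exact: mem_rc.
have sss1 : forall x, x \in ss1 -> supp Z x by exact: mem_rc.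
have e1 : size ss1 = size xs' by rewrite !size_rcons es.
have /choice[sl hsl] : forall i, exists s, (i < size xs')%N ->
    loc l l (nth 1 ss1 i) s /\ exists2 x, loc m m (nth 1 xs' i) x & eqn_on l (th \o s) (x \o th).
  move=> i; rewrite /xs' /ss1 !nth_rcons es size_rcons ltnS.
  have [il|il] := ltnP i (size xs).
    by have [s0 [x0 [? ? ?]]] := h i il; exists s0 => _; split => //; exists x0.
  exists id; case: eqP => [_ _|/eqP ne]; first by split => //; exists id.
  by rewrite leq_eqVlt (negbTE ne) ltnNge il.
have bsl i : (i < size xs')%N -> bal l l (sl i).
  move=> il; have [hl _] := hsl i il; apply: loc_bal hl => //.
  by apply: sss1; apply: mem_nth; rewrite e1.
have [|m' [eta [mm' be e_eta h1]]] := gx m l th sl bth.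
  by move=> i il; have [_ hl] := hsl i il; split => //; exact: bsl.
have /choice[sm hsm] : forall i, exists s, (i < size xs')%N ->
    loc m' m' (nth 1 xs' i) s /\ eqn_on m' (eta \o s) (sl i \o eta).
  move=> i; have [il|] := boolP (i < size xs')%N; last by exists id.
  by have [s0 hs0 e0] := h1 i il; exists s0.
have [|l' [th' [ll' bth' e_th' h2]]] := gs l m' eta sm be.
  rewrite e1 => i il; have [hl1 hl2] := hsm i il; split.
    by apply: loc_bal hl1 => //; apply: sxs'; exact: mem_nth.
  by exists (sl i) => //; have [] := hsl i il.
exists (GameState xs' ss1 m' l' th'); split.
  split => // i il; have [s0 hs0 e0] := h2 i (leq_trans il (eq_leq (esym e1))).
  by exists s0, (sm i); split => //; have [] := hsm i il.
split => //; exists eta; split; first exact: e_th'.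
move=> k kl; change (prj m' m (th' k) = th (prj l' l k)).
by rewrite -(e_eta _ (bal_lt bth' kl)) /= -[eta _]/((eta \o th') k) e_th'.
Qed.

Lemma game_won (K : nat -> set G) : (forall t, exists i, K i t) ->
  exists i xs m s, [/\ forall x, x \in xs -> supp Z x, good xs, level xs m &
    forall x, tame x -> loc m m x id -> good (rcons xs x) ->
    exists2 t, K i t & x = t * s * t^-1].
Proof.
move=> Kall; apply: contrapT => lost.
have bad i xs m s : (forall x, x \in xs -> supp Z x) -> good xs -> level xs m ->
    exists x, [/\ tame x, loc m m x id, good (rcons xs x) & forall t, K i t -> x <> t * s * t^-1].
  move=> h1 h2 h3; apply: contrapT => nx; apply: lost; exists i, xs, m, s; split => // x h4 h5 h6.
  apply: contrapT => nt; apply: nx; exists x; split => // t Kt e.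
  by apply: nt; exists t.
have step k p : exists p', p_ok p -> p_ok p' /\ exists x s,
    [/\ p_next p x s p' & forall t, K k t -> x <> t * s * t^-1].
  have [ok|] := pselect (p_ok p); last by exists p.
  have [lx ls] := p_level ok; have [_ [sxs sss] [gx gs] _ _] := ok.
  have [s [ts hs gs']] := generic iso infY sss gs ls (fun=> tame1 ch).
  have [x [tx hx gx' nx]] := bad k (p_xs p) (p_m p) s sxs gx lx.
  have := gs' 0%N; rewrite mul1g => {}gs'.
  by have [p' [ok' nxt]] := p_step ok tx ts hx hs gx' gs'; exists p' => _; split => //; exists x, s.
have /choice[next hnext] := fun p : nat * game_state => step p.1 p.2.
pose fix pos k := if k is i.+1 then next (i, pos i) else GameState [::] [::] 0 0 id.
have ok k : p_ok (pos k).
  elim: k => [|k ih]; last by have [] := hnext (k, pos k) ih.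
  by split => //; split; exact: good_nil.
pose xs k := p_xs (pos k); pose ss k := p_ss (pos k).
pose m k := p_m (pos k); pose l k := p_l (pos k); pose th k := p_th (pos k).
have /choice[x /choice[s nxt]] k : exists x s,
    p_next (pos k) x s (pos k.+1) /\ forall t, K k t -> x <> t * s * t^-1.
  by have [_ [x [s [h1 h2]]]] := hnext (k, pos k) (ok k); exists x, s.
have sz k : size (xs k) = k /\ size (ss k) = k.
  elim: k => [//|k [h1 h2]]; have [[e1 e2 _ _ _] _] := nxt k.
  by rewrite /xs /ss e1 e2 !size_rcons h1 h2.
have xsE i k : (i < k)%N -> nth 1 (xs k) i = x i /\ nth 1 (ss k) i = s i.
  elim: k => [//|k ih] ik; have [[e1 e2 _ _ _] _] := nxt k; have [s1 s2] := sz k.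
  rewrite /xs /ss e1 e2 !nth_rcons s1 s2.
  have [lt|ge] := ltnP i k; first exact: ih.
  have -> : i = k by apply/eqP; rewrite eqn_leq ge -ltnS ik.
  by rewrite eqxx.
have eqv i k : (i < k)%N -> exists a b,
    [/\ loc (l k) (l k) (s i) a, loc (m k) (m k) (x i) b & eqn_on (l k) (th k \o a) (b \o th k)].
  move=> ik; have [_ _ _ _ /(_ i)] := ok k; rewrite -/(xs k) (sz k).1 => /(_ ik).
  by have [-> ->] := xsE i k ik.
have bth k : bal (l k) (m k) (th k) by have [] := ok k.
have mlt k : (m k < m k.+1)%N by have [[]] := nxt k.
have llt k : (l k < l k.+1)%N by have [[]] := nxt k.
have heta k : exists eta, eqn_on (l k.+1) (eta \o th k.+1) (prj (l k.+1) (l k)) /\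
   eqn_on (l k.+1) (prj (m k.+1) (m k) \o th k.+1) (th k \o prj (l k.+1) (l k)).
  by have [[]] := nxt k.
have mge k : (k <= m k)%N by elim: k => // k ih; exact: leq_ltn_trans ih (mlt k).
have [T [[sT _ _] Tth]] := coherent_limit bth mlt llt heta.
have [i KT] := Kall T; have [_ /(_ T KT)] := nxt i; apply.
have tsx : supp Z (x i) /\ supp Z (s i).
  have [_ [h1 h2] _ _ _] := ok i.+1; have [<- <-] := xsE i _ (leqnn i.+1).
  have [e1 e2] := sz i.+1.
  by split; [apply: h1; rewrite mem_nth//|apply: h2; rewrite mem_nth//]; rewrite -/(xs _) -/(ss _) ?e1 ?e2.
have [sx s_s] := tsx.
suff -> : T * s i = x i * T by rewrite mulgK.
apply: (@aut_eq_cells _ _ _ _ ch); [exact: suppM|exact: suppM|move=> n].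
(* From stage [i.+1] on, [s i] and [x i] belong to the sequences intertwined by [th k]; equality is
   then checked at each level [n]. *)
pose k := maxn n i.+1.
have [a [b [ha hb e]]] := eqv i k (leq_maxr _ _).
have nk : (n <= m k)%N by apply: leq_trans (mge k); exact: leq_maxl.
have h1 := loc_prj nk (loc_ext e (loc_mul s_s (Tth k) ha)).
have h2 := loc_prj nk (loc_mul sT hb (Tth k)).
by apply: filterS2 h1 h2 => z e1 e2 Zz; rewrite e1// e2.
Qed.

(** Two conjugators [t], [t'] in one [K i] give [t' * t^-1] in [pw W 2], so all generic elements are
    in [pw W 6] once one is in [pw W 2]. To find that one, a tame [a j] is picked in each translate
    that has one fixing the cells, and [x] is chosen with all [(a j)^-1 * x] generic; [x] lies in
    the translate of some [a j]. Finally [g] is a quotient of the generic elements [x] and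
    [g^-1 * x]. *)
Lemma tame_subgroup (W : set G) : syndetic W ->
  exists m, forall a, tame a -> loc m m a id -> pw W 12 a.
Proof.
move=> [W1 WV [kk hkk]].
have [|i [xs [m [s [sxs gxs lm win]]]]] := @game_won (fun i => [set t | W (t * kk i)]).
  by move=> t; have [i hi] := hkk t^-1; exists i => /=; have := WV _ hi; rewrite invgM !invgK.
exists m; pose X x := [/\ tame x, loc m m x id & good (rcons xs x)].
have locM a b : tame b -> loc m m a id -> loc m m b id -> loc m m (a * b) id.
  by move=> [sb _ _] ha hb; exact: loc_mul sb ha hb.
have locV a : tame a -> loc m m a id -> loc m m a^-1 id.
  by move=> [sa _ _] ha; exact: loc_invE sa ha _.
have conjX x x' : X x -> X x' -> pw W 2 x -> pw W 6 x'.
  move=> [x1 x2 x3] [y1 y2 y3] hx; have [t ht e] := win _ x1 x2 x3.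
  have [t' ht' e'] := win _ y1 y2 y3.
  have hu : pw W 2 (t' * t^-1).
    have -> : t' * t^-1 = (t' * kk i) * (t * kk i)^-1 by rewrite invgM mulgA mulgK.
    by apply: (@pwM _ _ 1 1); apply: pw1 => //; exact: WV.
  have -> : x' = (t' * t^-1) * (x * (t' * t^-1)^-1).
    by rewrite e' e invgM invgK !mulgA !mulgVK.
  by apply: (@pwM _ _ 2 4) => //; apply: (@pwM _ _ 2 2) => //; exact: pwV.
have [x0 X0 hx0] : exists2 x, X x & pw W 2 x.
  have /choice[a ha] : forall j, exists a, [/\ tame a, loc m m a id &
     forall x, tame x -> loc m m x id -> W ((kk j)^-1 * x) -> W ((kk j)^-1 * a)].
    move=> j; have [[a [h1 h2 h3]]|na] := pselect (exists a,
      [/\ tame a, loc m m a id & W ((kk j)^-1 * a)]); first by exists a.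
    exists 1; split; [exact: tame1|exact: loc1|].
    by move=> x h1 h2 h3; exfalso; apply: na; exists x.
  have [|x [tx hx gx]] := generic iso infY sxs gxs lm (a := fun j => (a j)^-1).
    by move=> j; apply: tameV; case: (ha j).
  have [j hj] := hkk x; have [taj haj /(_ x tx hx hj) Wj] := ha j.
  exists ((a j)^-1 * x); first by split; [exact/tameM/tx/tameV|apply: locM => //; exact: locV|exact: gx].
  have -> : (a j)^-1 * x = ((kk j)^-1 * a j)^-1 * ((kk j)^-1 * x).
    by rewrite invgM invgK -mulgA mulVKg.
  by apply: (@pwM _ _ 1 1); apply: pw1 => //; exact: WV.
move=> g tg hg.
have [|x [tx hx gx]] := generic iso infY sxs gxs lm (a := fun j => if j is 0%N then 1 else g^-1).
  by case=> [|j]; [exact: tame1|exact: tameV].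
have Xx : X x by split => //; have := gx 0%N; rewrite mul1g.
have Xg : X (g^-1 * x).
  by split; [exact/tameM/tx/tameV|apply: locM => //; exact: locV|exact: (gx 1%N)].
have -> : g = x * (g^-1 * x)^-1 by rewrite invgM invgK mulgA mulgV mul1g.
apply: (@pwM _ _ 6 6); first exact: conjX X0 Xx hx0.
by apply: pwV => //; exact: conjX X0 Xg hx0.
Qed.

End Game.

(** * Approximation by tame automorphisms *)

Section Approx.
Context (R : realType) (d : measure_display) (Y : measurableType d).
Variable lambda : {measure set Y -> \bar R}.
Local Notation G := (Aut lambda).
Local Notation RR := (measurableTypeR R).
Variable ch : chart lambda.
Local Notation Z := (ch_dom ch).
Local Notation phi := (ch_map ch).
Local Notation cell := (cell ch).
Local Notation mesh := (mesh ch).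

Let mZ : measurable Z := ch_dom_measurable ch.

Lemma measure_cover2 (A B C : set Y) : measurable A -> measurable B -> measurable C ->
  A `<=` B `|` C -> (lambda A <= lambda B + lambda C)%E.
Proof.
move=> mA mB mC h; apply: (@le_trans _ _ (lambda (B `|` C))); last exact: measureU2.
by apply: le_measure; rewrite ?inE//; exact: measurableU.
Qed.

Let cells N (P : pred nat) := [set z | P (cell N z)].

Let mcells N P : measurable (cells N P). Proof. exact: cell_pred_measurable. Qed.

Let approx (A : set Y) := forall e : R, (0 < e)%R -> exists N P,
  (lambda (Z `&` (A `+` cells N P)) < e%:E)%E.

Let cells_up N N' P : (N <= N')%N -> cells N P = cells N' (P \o prj N' N).
Proof. by move=> NN; apply/seteqP; split=> z; rewrite /cells /= (cell_prj ch _ NN). Qed.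

Let fin_meas (A : set Y) : measurable A -> (lambda (Z `&` A) < +oo)%E.
Proof.
move=> mA; apply: (@le_lt_trans _ _ (lambda Z)); last by rewrite (ch_domE ch) ltry.
by apply: le_measure; rewrite ?inE//; exact: measurableI.
Qed.

Let approxU A B : measurable A -> measurable B -> approx A -> approx B -> approx (A `|` B).
Proof.
move=> mA mB hA hB e e0; have e2 : (0 < e / 2)%R by rewrite divr_gt0.
have [N [P hP]] := hA _ e2; have [M [Q hQ]] := hB _ e2.
exists (maxn N M), (fun k => P (prj (maxn N M) N k) || Q (prj (maxn N M) M k)).
have hN : (N <= maxn N M)%N by exact: leq_maxl.
have hM : (M <= maxn N M)%N by exact: leq_maxr.
rewrite (cells_up _ hN) in hP; rewrite (cells_up _ hM) in hQ.
apply: (@le_lt_trans _ _ (lambda (Z `&` (A `+` cells (maxn N M) (P \o prj (maxn N M) N))) +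
  lambda (Z `&` (B `+` cells (maxn N M) (Q \o prj (maxn N M) M))))%E); last first.
  by rewrite [e]splitr EFinD; exact: lteD.
apply: measure_cover2.
- by apply: measurableI => //; apply: measurable_setY => //; exact: measurableU.
- by apply: measurableI => //; exact: measurable_setY.
- by apply: measurableI => //; exact: measurable_setY.
- move=> z [Zz]; rewrite /cells /= => -[[[Az|Bz] /negP]|[/orP[Pz|Qz] /not_orP[nA nB]]].
  + by rewrite negb_or => /andP[/negP nP _]; left; split => //; left.
  + by rewrite negb_or => /andP[_ /negP nQ]; right; split => //; left.
  + by left; split => //; right.
  + by right; split => //; right.
Qed.

Let approxC A : approx A -> approx (~` A).
Proof.
move=> hA e e0; have [N [P h]] := hA e e0; exists N, (predC P).
suff -> : ~` A `+` cells N (predC P) = A `+` cells N P by [].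
apply/seteqP; split=> z; rewrite /cells /=.
  move=> [[nA /negP]|[/negP nP /contrapT Az]]; [rewrite negbK => Pz; by right|by left].
by move=> [[Az /negP nP]|[Pz nA]]; [right; split => //; exact|left; split => //; rewrite Pz].
Qed.

(** The Borel sets whose preimages can be approximated form a sigma-algebra, and a ray is
    approximated up to the single cell containing its end. The general case follows because the
    chart is injective almost everywhere. *)
Lemma cell_approx (C : set Y) (e : R) : measurable C -> (0 < e)%R ->
  exists N P, (lambda (Z `&` (C `+` cells N P)) < e%:E)%E.
Proof.
move=> mC.
pose good_sets := [set S : set RR | measurable S /\ approx (phi @^-1` S)].
have pre S : measurable S -> measurable (phi @^-1` S) by exact: ch_preimage_measurable.
have main (S : set RR) : measurable S -> approx (phi @^-1` S).
  have E : <<s @RGenInftyO.G R >> = <<s @ocitv R >> by exact: esym (RGenInftyO.measurableE R).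
  move=> mS; suff : <<s @RGenInftyO.G R >> `<=` good_sets by rewrite E => /(_ S mS)[].
  apply: smallest_sub; last first.
    move=> _ [b ->]; split; first exact: measurable_itv.
    move=> r r0; have [N hN] := mesh_small ch r0.
    have bN := mesh_gt0 ch N.
    exists N, (fun k => (k.+1%:R * mesh N <= b)%R).
    pose j := Num.truncn (b / mesh N)%R.
    apply: (@le_lt_trans _ _ (mesh N)%:E); last by rewrite lte_fin.
    apply: (@le_trans _ _ (lambda (Z `&` [set z | cell N z = j]))); last first.
      have [jN|jN] := ltnP j (2 ^ N); first by rewrite measure_cell.
      rewrite (@ae_measure0 _ _ _ _ _)//.
      - by rewrite lee_fin ltW.
      - by apply: measurableI => //; apply: label_measurable; exact: cell_measurable.
      - by apply: filterS (cell_bound ch) => z /(_ N) hz [/hz + /= ez]; rewrite ez ltnNge jN.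
    apply: le_measure_ae.
    - by apply: measurableI => //; apply: measurable_setY => //; apply: pre; exact: measurable_itv.
    - by apply: measurableI => //; apply: label_measurable; exact: cell_measurable.
    apply: filterS (phi_range ch) => z hz [Zz]; rewrite /cells /= in_itv /=.
    have /andP[z0 _] := hz Zz; set k := cell N z.
    have k1 : ((phi z : R) < k.+1%:R * mesh N)%R by rewrite -cell_le.
    have k2 : (k%:R * mesh N <= phi z)%R.
      by rewrite -ler_pdivlMr// truncn_le divr_ge0// ltW.
    move=> [[zb /negP]|[kb /negP]]; last first.
      by rewrite -leNgt => bz; have := lt_le_trans k1 (le_trans kb bz); rewrite ltxx.
    rewrite -ltNge => bk; split => //=; rewrite -/k /j; symmetry.
    have b0 : (0 <= b)%R by apply/ltW/(le_lt_trans z0 zb).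
    have bm : (0 <= b / mesh N)%R by rewrite divr_ge0// ltW.
    apply/eqP; rewrite truncn_eq//.
    by rewrite ler_pdivlMr// ltr_pdivrMr// bk andbT; exact: ltW (le_lt_trans k2 zb).
  split.
  - split => // r r0; exists 0%N, pred0; rewrite preimage_set0.
    by rewrite (_ : _ `&` _ = set0) ?measure0//; apply/seteqP; split=> // z [_ /= [[]|[]]].
  - move=> S0 [mS0 aS0]; rewrite setTD; split; first exact: measurableC.
    by rewrite preimage_setC; exact: approxC.
  - move=> F hF; have mF n : measurable (F n) by case: (hF n).
    split; first exact: bigcupT_measurable.
    pose B n := \big[setU/set0]_(i < n) F i.
    have mB n : measurable (B n) by apply: bigsetU_measurable => i _; exact: mF.
    have aB n : approx (phi @^-1` B n).
      rewrite /B; elim: n => [|n ih].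
        rewrite big_ord0 preimage_set0 => r r0; exists 0%N, pred0.
        by rewrite (_ : _ `&` _ = set0) ?measure0//; apply/seteqP; split=> // z [_ /= [[]|[]]].
      rewrite big_ord_recr /= preimage_setU; apply: approxU => //; [exact: (pre _ (mB n))|exact: (pre _ (mF n))|].
      by case: (hF n).
    move=> r r0; have r2 : (0 < r / 2)%R by rewrite divr_gt0.
    have mU : measurable (\bigcup_i F i) by exact: bigcupT_measurable.
    have mUB n : measurable (\bigcup_i F i `\` B n) by apply: measurableD; [exact: mU|exact: mB].
    (* What the partial unions miss decreases to the empty set inside [Z], whose measure is
       finite. *)
    pose D n := Z `&` phi @^-1` (\bigcup_i F i `\` B n).
    have mD n : measurable (D n) by apply: measurableI => //; apply: pre; exact: mUB.
    have : lambda \o D @ \oo --> lambda (\bigcap_n D n).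
      apply: nonincreasing_cvg_mu => //.
      - by apply: fin_meas; apply: pre; exact: mUB.
      - exact: bigcap_measurable.
      - move=> n m nm; apply/subsetPset => z [Zz [Uz nB]]; split => //; split => // h.
        by apply: nB; exact: (subset_bigsetU nm).
    rewrite (_ : \bigcap_n _ = set0) ?measure0; last first.
      apply/seteqP; split=> // z h; have [_ [[i _ Fi] _]] := h 0%N I.
      have [_ [_ nB]] := h i.+1 I; apply: nB; rewrite /B -bigcup_mkord.
      by exists i => //=.
    move=> /fine_cvgP[_ /cvgrPdist_lt/(_ _ r2)[n _ /(_ n (leqnn n))]].
    rewrite /= sub0r normrN ger0_norm ?fine_ge0// => hn.
    have fD : lambda (D n) \is a fin_num.
      by rewrite ge0_fin_numE//; apply: fin_meas; apply: pre; exact: mUB.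
    rewrite -lte_fin fineK// in hn.
    have [N [P hP]] := aB n _ r2; exists N, P.
    apply: (@le_lt_trans _ _ (lambda (D n) + lambda (Z `&` (phi @^-1` B n `+` cells N P)))%E); last first.
      by rewrite [r]splitr EFinD; exact: lteD.
    have BU : B n `<=` \bigcup_i F i.
      by rewrite /B -bigcup_mkord => z [i _ Fi]; exists i.
    apply: measure_cover2 => //.
    + by apply: measurableI => //; apply: measurable_setY => //; exact: pre.
    + by apply: measurableI => //; apply: measurable_setY => //; exact: (pre _ (mB n)).
    + move=> z [Zz [[Uz nP]|[Pz nU]]].
        have [Bz|nB] := pselect (B n (phi z)); last by left.
        by right; split => //; left.
      by right; split => //; right; split => // /BU.
move=> e0; have mS := preimage_measurable (ch_inv_measurable ch) mC.
have [N [P h]] := main _ mS e e0; exists N, P; move: h.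
congr (_ < _)%E; apply: eq_measure_ae.
- by apply: measurableI => //; apply: measurable_setY => //; exact: pre.
- by apply: measurableI => //; exact: measurable_setY.
- by apply: filterS (ch_mapK ch) => z hz; split=> -[Zz]; rewrite /setY /= hz.
Qed.

Lemma measure_finite_cover (p : nat) (A : nat -> set Y) (B : set Y) (e : R) :
  (forall j, measurable (A j)) -> measurable B ->
  (forall j, (j < p)%N -> (lambda (A j) <= e%:E)%E) ->
  (\forall w \ae lambda, B w -> exists2 j, (j < p)%N & A j w) ->
  (lambda B <= (p%:R * e)%:E)%E.
Proof.
move=> mA mB hA hB; pose U := \big[setU/set0]_(j < p) A j.
have mU : measurable U by apply: bigsetU_measurable => j _; exact: mA.
apply: (@le_trans _ _ (lambda U)).
  apply: le_measure_ae => //; apply: filterS hB => w h /h[j jp Aj].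
  by rewrite /U -bigcup_mkord; exists j.
rewrite /U; elim: p hA {U mU hB} => [|p ih] hA; first by rewrite big_ord0 measure0 mul0r.
rewrite big_ord_recr /= -natr1 mulrDl mul1r EFinD.
apply: (le_trans (measureU2 _ _ _)) => //; last first.
  by apply: leeD; [apply: ih => j jp; apply: hA; exact: ltnW|exact: hA].
by apply: bigsetU_measurable => j _; exact: mA.
Qed.

(* [zeta] approximates [x^-1] on cells as well as [eta] approximates [x] *)
Lemma refine (x : G) n l eta N0 (e : R) : supp Z x -> bal l n eta -> (0 < e)%R ->
  exists N zeta, [/\ (N0 < N)%N, bal N l zeta, eqn_on N (eta \o zeta) (prj N n) &
    (lambda (Z `&` [set z | cell n (x $ z) = eta (cell l z) /\
       zeta (cell N (x $ z)) <> cell l z]) < e%:E)%E].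
Proof.
move=> sx be e0; have sxV := suppV sx.
pose C j := [set w | cell l (x^-1 $ w) = j].
have mcl : measurable_fun setT (fun w => cell l (x^-1 $ w)).
  by apply: measurableT_comp; [exact: cell_measurable|exact: mpb_measurable].
have mC j : measurable (C j) by exact: label_measurable.
(* The [2 ^ l] exceptional sets found below have measure at most [e' + e'] each, in total
   [e / 2]. *)
pose e' : R := (e / (2 ^ l.+2)%:R)%R.
have e'0 : (0 < e')%R by rewrite divr_gt0// ltr0n expn_gt0.
have /choice[M /choice[P hP]] j := cell_approx (mC j) e'0.
pose N := maxn (maxn l N0.+1) (\max_(j < 2 ^ l) M j).
have lN : (l <= N)%N by rewrite /N -maxnA leq_maxl.
have N0N : (N0 < N)%N by rewrite /N (leq_trans _ (leq_maxl _ _))// leq_maxr.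
have MN (j : nat) : (j < 2 ^ l)%N -> (M j <= N)%N.
  by move=> jl; rewrite /N (leq_trans _ (leq_maxr _ _))//; apply: (leq_bigmax (Ordinal jl)).
pose P' j k := P j (prj N (M j) k).
(* The colour is the first [j] compatible with [eta] whose approximant contains the cell;
   overlapping approximants and uncovered cells count as error. *)
pose col k := ohead [seq j <- iota 0 (2 ^ l) | P' j k && (eta j == prj N n k)].
have colE k j : col k = Some j -> [/\ (j < 2 ^ l)%N, P' j k & eta j = prj N n k].
  rewrite /col; case E : [seq _ <- _ | _] => [//|i s] [ij].
  have : i \in i :: s by rewrite mem_head.
  by rewrite -E ij mem_filter mem_iota add0n => /andP[/andP[-> /eqP ->] /= ->].
have [|zeta [bz ez hz]] := @truncated_colouring n l N eta col be lN.
  by move=> k j _ /colE[].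
exists N, zeta; split => //.
pose E j := Z `&` (C j `+` cells N (P' j)).
have mE j : measurable (E j) by apply: measurableI => //; exact: measurable_setY.
have hE j : (j < 2 ^ l)%N -> (lambda (E j) < e'%:E)%E.
  by move=> /MN jl; have := hP j; rewrite (cells_up _ jl).
have mCj j : (j < 2 ^ l)%N -> lambda (Z `&` C j) = (mesh l)%:E.
  move=> jl; rewrite -(measure_cell ch jl).
  have mj : measurable (Z `&` [set z | cell l z = j]).
    by apply: measurableI => //; apply: label_measurable; exact: cell_measurable.
  rewrite -(aut_preserving x^-1 mj); apply: eq_measure_ae.
  - exact: measurableI.
  - exact: aut_preimage_measurable.
  - by apply: filterS (supp_stable sxV) => w h; split=> -[Zw] /= cw; split => //; exact/h.
pose T j := Z `&` cells N (fun k => (col k == Some j) && (zeta k != j)).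
have mT j : measurable (T j) by apply: measurableI => //; exact: mcells.
have hT j : (j < 2 ^ l)%N -> (lambda (T j) <= e'%:E)%E.
  (* The cells coloured [j] lie in [C j] up to [E j], and [C j] has the measure of [2 ^ (N - l)]
     cells of level [N]; so the excess discarded by the truncation has measure at most [e']. *)
  move=> jl; rewrite /T /cells (measure_cells ch N (fun k => (col k == Some j) && (zeta k != j))) lee_fin.
  set a := count _ _; have m0 := mesh_gt0 ch N.
  have aq := hz j; rewrite -/a in aq; move: aq; set b := count _ _ => aq.
  have : (b%:R * mesh N <= (2 ^ (N - l))%:R * mesh N + e')%R.
    rewrite -lee_fin EFinD -(meshE ch lN) -(mCj j jl) -(measure_cells ch N (fun k => col k == Some j)).
    apply: (@le_trans _ _ (lambda (Z `&` C j) + lambda (E j))%E); last first.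
      by apply: leeD => //; apply: ltW; exact: hE.
    apply: measure_cover2 => //.
    + by apply: measurableI => //; exact: (mcells N (fun k => col k == Some j)).
    + exact: measurableI.
    + move=> w [Zw /= /eqP/colE[_ Pw _]]; have [Cw|nC] := pselect (C j w); first by left.
      by right; split => //; right.
  move=> h; apply: (@le_trans _ _ ((b - 2 ^ (N - l))%N%:R * mesh N)%R).
    by rewrite ler_pM2r// ler_nat.
  have [bq|qb] := leqP b (2 ^ (N - l)); first by move: bq; rewrite -subn_eq0 => /eqP ->; rewrite mul0r ltW.
  by rewrite natrB; [rewrite mulrBl lerBlDl; exact: h|exact: ltnW].
pose Bad := Z `&` [set w | cell n w = eta (cell l (x^-1 $ w)) /\ zeta (cell N w) <> cell l (x^-1 $ w)].
have mBad : measurable Bad.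
  rewrite (_ : Bad = Z `&` \bigcup_j (C j `&` (cells n (fun k => k == eta j) `&`
      cells N (fun k => zeta k != j)))).
    apply: measurableI => //; apply: bigcupT_measurable => j; apply: measurableI => //.
    by apply: measurableI; exact: mcells.
  apply/seteqP; split=> w [Zw] /=.
    by move=> [h1 h2]; split => //; exists (cell l (x^-1 $ w)) => //; split => //; split; apply/eqP.
  by move=> [j _ [<- [/eqP h1 /eqP h2]]]; split.
apply: (@le_lt_trans _ _ (lambda Bad)).
  rewrite -(aut_preserving x mBad); apply: le_measure_ae.
  - rewrite (_ : _ `&` _ = Z `&` \bigcup_j ([set z | cell l z = j] `&`
       ((fun z => cell n (x $ z)) @^-1` [set k | k = eta j] `&`
        (fun z => cell N (x $ z)) @^-1` [set k | zeta k <> j]))).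
      apply: measurableI => //; apply: bigcupT_measurable => j.
      apply: measurableI; first by apply: label_measurable; exact: cell_measurable.
      by apply: measurableI; apply: preimage_measurable => //; apply: measurableT_comp;
        [exact: cell_measurable|exact: mpb_measurable|exact: cell_measurable|exact: mpb_measurable].
    apply/seteqP; split=> z [Zz] /=; first by move=> h; split => //; exists (cell l z).
    by move=> [j _ [<- ]].
  - exact: aut_preimage_measurable.
  - ae_use (autVK x); ae_use (supp_stable sx); apply: aeW => z h1 h2 [Zz /= [h3 h4]].
    by split; [exact/h1|rewrite /= h2].
apply: (@le_lt_trans _ _ ((2 ^ l)%:R * (e' + e'))%:E); last first.
  have a0 : (0 < (2 ^ l)%:R :> R)%R by rewrite ltr0n expn_gt0.
  have e4 : ((2 ^ l.+2)%:R = 4%:R * (2 ^ l)%:R :> R)%R by rewrite -natrM !expnS mulnA.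
  rewrite lte_fin /e' e4; have -> : ((2 ^ l)%:R * (e / (4%:R * (2 ^ l)%:R) + e / (4%:R * (2 ^ l)%:R)) = e / 2)%R.
    by field; rewrite lt0r_neq0.
  by rewrite ltr_pdivrMr// ltr_pMr// ltr1n.
apply: (@measure_finite_cover (2 ^ l) (fun j => E j `|` T j)) => //.
- by move=> j; exact: measurableU.
- by move=> j jl; apply: (le_trans (measureU2 _ _ _)) => //; rewrite EFinD; apply: leeD; [exact/ltW/hE|exact: hT].
- ae_use (cell_bound ch); ae_use (ae_map x^-1 (cell_bound ch)); ae_use (supp_stable sxV).
  apply: aeW => w h1 h2 h3 [Zw /= [h4 h5]]; set j := cell l _ in h4 h5.
  have jl : (j < 2 ^ l)%N by apply: h2; exact/h1.
  have [[i [il Ei]]|nE] := pselect (exists i, (i < 2 ^ l)%N /\ E i w); first by exists i => //; left.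
  exists j => //; right; split => //; rewrite /cells /=; set k := cell N w.
  (* Off every [E i], the cell of [w] lies in exactly one approximant, the right one; only the
     truncation can still spoil the value of [zeta]. *)
  have nEi i : (i < 2 ^ l)%N -> P' i k = (i == j).
    move=> il; apply/idP/eqP => [Pi|ij]; apply: contrapT => h; apply: nE; exists i; split => //; split => //.
      by right; split => // ij; apply: h.
    by left; split => //; rewrite /C /= -/j.
  have -> : col k = Some j.
    rewrite /col (_ : [seq _ <- _ | _] = [:: j])//.
    have -> : [seq i <- iota 0 (2 ^ l) | P' i k && (eta i == prj N n k)] = [seq i <- iota 0 (2 ^ l) | pred1 j i].
      apply: eq_in_filter => i; rewrite mem_iota => /= il; rewrite nEi//.
      case: eqP => // ->; rewrite -h4 /k -cell_prj ?eqxx//.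
      by apply: leq_trans lN; case: be.
    by rewrite filter_pred1_uniq ?iota_uniq// mem_iota.
  by rewrite eqxx; apply/eqP.
Qed.

End Approx.

(** * Density of tame automorphisms *)

Section Dense.
Context (R : realType) (d : measure_display) (Y : measurableType d).
Variable lambda : {measure set Y -> \bar R}.
Local Notation G := (Aut lambda).
Variable ch : chart lambda.
Local Notation Z := (ch_dom ch).
Local Notation psi := (ch_inv ch).
Local Notation cell := (cell ch).
Local Notation loc := (loc ch).
Local Notation tame := (tame ch).

Let mZ : measurable Z := ch_dom_measurable ch.

Lemma measurable_cell_aut n (T : G) : measurable_fun setT (fun z => cell n (T $ z)).
Proof. by apply: measurableT_comp; [exact: cell_measurable|exact: mpb_measurable]. Qed.

Let follows (T : G) (st : nat * nat * (nat -> nat)) : set Y :=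
  [set z | cell st.1.1 (T $ z) = st.2 (cell st.1.2 z)].

Let mfollows T st : measurable (follows T st).
Proof.
apply: (measurable_rel (fun a b => a = st.2 b)); first exact: measurable_cell_aut.
exact: cell_measurable.
Qed.

(** [refine] is used for [T] and then for [T^-1]: the map [ze] between the two levels approximates
    the inverse, and it is the [eta] that keeps the inverses coherent. *)
Lemma follow_step (T : G) n l th (e : R) : supp Z T -> bal l n th -> (0 < e)%R ->
  exists n' l' th', [/\ (n < n')%N, (l < l')%N, bal l' n' th',
    exists eta, eqn_on l' (eta \o th') (prj l' l) /\
      eqn_on l' (prj n' n \o th') (th \o prj l' l) &
    (lambda (Z `&` (follows T (n, l, th) `\` follows T (n', l', th'))) < e%:E)%E].
Proof.
move=> sT bth e0; have e2 : (0 < e / 2)%R by rewrite divr_gt0.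
have [n' [ze [nn' bz ez hz]]] := refine n sT bth e2.
have [l' [th' [ll' bth' eth' hth']]] := refine l (suppV sT) bz e2.
exists n', l', th'; split => //.
  exists ze; split => // k kl /=.
  by rewrite -(ez _ (bal_lt bth' kl)) /= -[ze _]/((ze \o th') k) eth'.
move: hz hth'; set B1 := Z `&` _ => hz; set B2 := Z `&` _ => hth'.
have mB1 : measurable B1.
  apply: measurableI => //; apply: measurableI.
    exact: (mfollows T (n, l, th)).
  apply: (measurable_rel (fun a b => ze a <> b)); [exact: measurable_cell_aut|exact: cell_measurable].
have mB2 : measurable B2.
  apply: measurableI => //; apply: measurableI.
    exact: (mfollows T^-1 (l, n', ze)).
  apply: (measurable_rel (fun a b => th' a <> b)); [exact: measurable_cell_aut|exact: cell_measurable].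
apply: (@le_lt_trans _ _ (lambda B1 + lambda (T @^-1` B2))%E); last first.
  rewrite aut_preserving// [e]splitr EFinD; exact: lteD.
have mTB2 := aut_preimage_measurable T mB2.
apply: (@le_trans _ _ (lambda (B1 `|` T @^-1` B2))); last exact: measureU2.
apply: le_measure_ae.
- by apply: measurableI => //; exact: measurableD.
- exact: measurableU.
- ae_use (autVK T); ae_use (supp_stable sT); apply: aeW => z h1 h2 [Zz [/= h3 h4]].
  have [e1|ne] := eqVneq (ze (cell n' (T $ z))) (cell l z); last by left; split => //; split => //; exact/eqP.
  right; split; first exact/h1.
  by rewrite /= h2; split => // e3; apply: h4; rewrite /follows /= e3.
Qed.

(** The losses [dl k] add up to [e / 2]. A point lost at no stage follows every finite map, so [S]
    and [T] send it into the same cells and hence to the same point. *)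
Lemma tame_dense (T : G) m (e : R) : lebesgue_like lambda -> lambda setT = +oo%E ->
  supp Z T -> loc m m T id -> (0 < e)%R ->
  exists S : G, [/\ tame S, loc m m S id & exists E, [/\ measurable E, (lambda E < e%:E)%E &
    supp E (S^-1 * T)]].
Proof.
move=> iso infY sT lT e0.
pose st := (nat * nat * (nat -> nat))%type.
pose dl k : R := (e / 2 / (2 ^ k.+1)%:R)%R.
have e2 : (0 < e / 2)%R by rewrite divr_gt0.
have dl0 k : (0 < dl k)%R by rewrite divr_gt0// ltr0n expn_gt0.
pose ok (s : st) := bal s.1.2 s.1.1 s.2.
pose nxt (k : nat) (s s' : st) := [/\ (s.1.1 < s'.1.1)%N, (s.1.2 < s'.1.2)%N, ok s',
    exists eta, eqn_on s'.1.2 (eta \o s'.2) (prj s'.1.2 s.1.2) /\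
      eqn_on s'.1.2 (prj s'.1.1 s.1.1 \o s'.2) (s.2 \o prj s'.1.2 s.1.2) &
    (lambda (Z `&` (follows T s `\` follows T s')) < (dl k)%:E)%E].
have step k s : exists s', ok s -> nxt k s s'.
  have [|] := pselect (ok s); last by exists s.
  case: s => [[n l] th] oks; have [n' [l' [th' h]]] := follow_step sT oks (dl0 k).
  by exists (n', l', th').
have /choice[next hnext] := fun p : nat * st => step p.1 p.2.
pose fix pos k : st := if k is i.+1 then next (i, pos i) else (m, m, id).
have okp k : ok (pos k).
  by elim: k => [|k ih]; [exact: bal_id|have [] := hnext (k, pos k) ih].
have hn k : nxt k (pos k) (pos k.+1) by exact: (hnext (k, pos k) (okp k)).
have [||||S [tS hS]] := @coherent_limit _ _ _ lambda ch iso infY (fun k => (pos k).1.1) (fun k => (pos k).1.2) (fun k => (pos k).2).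
- exact: okp.
- by move=> k; have [] := hn k.
- by move=> k; have [] := hn k.
- by move=> k; have [] := hn k.
have sS : supp Z S by case: tS.
exists S; split => //; first exact: (hS 0%N).
pose D k := Z `&` (follows T (pos k) `\` follows T (pos k.+1)).
have mD k : measurable (D k) by apply: measurableI => //; exact: measurableD.
exists (\bigcup_k D k); split; first exact: bigcupT_measurable.
  apply: (@le_lt_trans _ _ (e / 2)%:E); last by rewrite lte_fin ltr_pdivrMr// ltr_pMr// ltr1n.
  apply: (@le_trans _ _ (\sum_(i <oo) lambda (D i))%E).
    by apply: measure_sigma_subadditive => //; exact: bigcupT_measurable.
  apply: le_trans (epsilon_trick0 xpredT (ltW e2)).
  by apply: lee_nneseries => // i _; have [_ _ _ _ /ltW] := hn i.
have nge k : (k <= (pos k).1.1)%N.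
  by elim: k => // k ih; apply: leq_ltn_trans ih _; have [] := hn k.
have hS' := ae_foralln hS.
ae_use (autM S^-1 T); ae_use (autVK S); ae_use sT; ae_use sS; ae_use (supp_stable sS); ae_use (supp_stable sT).
ae_use lT; ae_use hS'; ae_use (ae_map S (phi_range ch)); ae_use (ae_map T (phi_range ch)).
ae_use (ae_map S (ch_mapK ch)); ae_use (ae_map T (ch_mapK ch)).
apply: aeW => z pT pS rT rS hSz lTz stT stS fS fT SK -> nD.
suff -> : T $ z = S $ z by [].
have [Zz|nZ] := pselect (Z z); last by rewrite fS// fT.
have ZT := stT.1 Zz; have ZS := stS.1 Zz.
have fol k : follows T (pos k) z.
  elim: k => [|k ih]; first exact: lTz.
  by apply: contrapT => nf; apply: nD; exists k.
rewrite -(pT ZT) -(pS ZS); congr psi; apply: cell_separates.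
- by have /andP[] := rT ZT.
- by have /andP[] := rS ZS.
move=> n; rewrite (cell_prj ch (S $ z) (nge n)) (cell_prj ch (T $ z) (nge n)).
by have := fol n; rewrite /follows /= => ->; rewrite -hSz.
Qed.

Lemma level_subgroup (W : set G) : lebesgue_like lambda -> lambda setT = +oo%E ->
  syndetic W -> exists m, forall T : G, supp Z T -> loc m m T id -> pw W 40 T.
Proof.
move=> iso infY sW; have [eps eps0 heps] := small_supports iso infY sW.
have [m hm] := tame_subgroup ch iso infY sW.
exists m => T sT lT; have [S [tS lS [E [mE Ee sE]]]] := tame_dense iso infY sT lT eps0.
have -> : T = S * (S^-1 * T) by rewrite mulVKg.
by apply: (@pwM _ _ 12 28); [exact: hm|exact: heps Ee _ sE].
Qed.

End Dense.

(** * Topological groups *)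

Lemma pw_split (G : groupType) (V : set G) m n x : pw V (m + n) x ->
  exists a b, [/\ pw V m a, pw V n b & x = a * b].
Proof.
elim: m x => [|m ih] x /=; first by exists 1, x; rewrite mul1g.
move=> [a Va [b /ih[a' [b' [h1 h2 ->]]] ->]]; exists (a * a'), b'; rewrite mulgA.
by split => //; exists a => //; exists a'.
Qed.

Section TopologicalGroups.
Variable H : topologicalGroupType.
Implicit Types (U V : set H) (a x y : H).

Lemma nbhs_mul U x y : nbhs (x * y) U -> exists A B, [/\ nbhs x A, nbhs y B &
  forall a b, A a -> B b -> U (a * b)].
Proof.
move=> /(mulg_continuous (x, y))[[A B] /= [nA nB] h]; exists A, B; split => // a b Aa Bb.
exact: (h (a, b)).
Qed.

Lemma nbhs_translate U a x : nbhs (a * x) U -> nbhs x [set y | U (a * y)].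
Proof.
move=> /nbhs_mul[A [B [nA nB h]]]; apply: filterS nB => y By.
by apply: h => //; exact: nbhs_singleton.
Qed.

Lemma nbhs_translateR U a x : nbhs (x * a) U -> nbhs x [set y | U (y * a)].
Proof.
move=> /nbhs_mul[A [B [nA nB h]]]; apply: filterS nA => y Ay.
by apply: h => //; exact: nbhs_singleton.
Qed.

Lemma nbhs_inv U x : nbhs x^-1 U -> nbhs x [set y | U y^-1].
Proof. exact: invg_continuous. Qed.

(** Continuity of the product doubles the exponent, and [n <= 2 ^ n] suffices since [V] contains
    [1]. *)
Lemma nbhs_pw U n : nbhs (1 : H) U -> exists V, [/\ nbhs (1 : H) V,
  forall x, V x -> V x^-1 & pw V n `<=` U].
Proof.
move=> nU; suff [V nV hV] : exists2 V, nbhs (1 : H) V & pw V (2 ^ n) `<=` U.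
  have nV' : nbhs (1 : H) [set y | V y^-1] by apply: nbhs_inv; rewrite invg1.
  have V1 : V 1 by exact: nbhs_singleton.
  exists (V `&` [set y | V y^-1]); split; first exact: filterI.
    by move=> x [h1 h2]; split => //=; rewrite invgK.
  move=> x hx; apply: hV; apply: (pw_le (m := n)) => //; first exact/ltnW/ltn_expl.
  elim: n x hx {nU} => [//|n ih] x [a [Va _] [b hb ->]].
  by exists a => //; exists b => //; exact: ih.
elim: n U nU => [|n ih] U nU.
  by exists U => // x [a Ua [b -> ->]]; rewrite mulg1.
have [|A [B [nA nB hAB]]] := @nbhs_mul U 1 1; first by rewrite mulg1.
have [V nV hV] := ih _ (filterI nA nB); exists V => // x.
rewrite expnS mul2n -addnn => hx.
have [a [b [ha hb ->]]] := pw_split hx.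
by apply: hAB; [have [] := hV a ha|have [] := hV b hb].
Qed.

(** The points of the dense sequence need not be in the image of [pi]. Each is replaced by some
    [pi (k i)] in the same translate of [V], if there is one; this is why [pw V 2] appears in place
    of [V]. *)
Lemma syndetic_preimage (G : groupType) (pi : G -> H) V : separable_space H ->
  {morph pi : x y / x * y} -> nbhs (1 : H) V -> (forall x, V x -> V x^-1) ->
  syndetic (pi @^-1` pw V 2).
Proof.
move=> [D cD dD] piM nV VV; have V1 : V 1 by exact: nbhs_singleton.
have pi1 : pi 1 = 1 by apply: (mulgI (pi 1)); rewrite -piM !mulg1.
have piV (x : G) : pi x^-1 = (pi x)^-1 by apply: (mulgI (pi x)); rewrite -piM !mulgV.
split.
- by rewrite /= pi1; exact: (@pw_le _ V 0 2 1 V1).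
- by move=> x /= hx; rewrite piV; exact: (@pwV _ V 2 _ VV hx).
have meet x : exists2 h, D h & V (h^-1 * x).
  have nx : nbhs x [set h | V (h^-1 * x)].
    by apply: (@nbhs_inv [set y | V (y * x)]); apply: nbhs_translateR; rewrite mulVg.
  have [h [/interior_subset hV Dh]] : (interior [set h | V (h^-1 * x)] `&` D) !=set0.
    by apply: dD; [exists x; exact: nx|exact: open_interior].
  by exists h.
have [D0|[f]] := pfcard_geP cD; first by have [h] := meet 1; rewrite D0.
have /choice[k hk] : forall i, exists g, forall x : G, V ((f i)^-1 * pi x) -> V ((f i)^-1 * pi g).
  move=> i; have [[g hg]|ng] := pselect (exists g, V ((f i)^-1 * pi g)); first by exists g.
  by exists 1 => x hx; exfalso; apply: ng; exists x.
exists k => x; have [h Dh hV] := meet (pi x).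
have [i _ fi] := 'surj_f Dh; exists i; rewrite /= piM piV.
rewrite -fi in hV; have hg := hk i x hV.
have -> : (pi (k i))^-1 * pi x = ((f i)^-1 * pi (k i))^-1 * ((f i)^-1 * pi x).
  by rewrite invgM invgK -mulgA mulVKg.
by apply: (@pwM _ _ 1 1); apply: pw1 => //; exact: VV.
Qed.

End TopologicalGroups.

Lemma automatic_continuity_of_syndetic (G : topologicalGroupType) n :
  (forall W : set G, syndetic W -> nbhs (1 : G) (pw W n)) -> automatic_continuity G.
Proof.
move=> hG H sH pi piM T U nU.
have pi1 : pi 1 = 1 by apply: (mulgI (pi 1)); rewrite -piM !mulg1.
have nU1 : nbhs (1 : H) [set h | U (pi T * h)] by apply: nbhs_translate; rewrite mulg1.
have [V [nV VV hV]] := nbhs_pw (n * 2) nU1.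
have nW := hG _ (syndetic_preimage sH piM nV VV).
have : nbhs T [set S | pw (pi @^-1` pw V 2) n (T^-1 * S)].
  by apply: nbhs_translate; rewrite mulVg.
apply: filterS => S /= hS; have -> : pi S = pi T * pi (T^-1 * S) by rewrite -piM mulVKg.
apply: hV; elim: n (T^-1 * S) hS {hG nW} => [x ->|p ih x [a ha [b hb ->]]] //.
by rewrite piM mulSn; apply: pwM => //; exact: ih.
Qed.

(** * Neighbourhoods of the identity *)

Section Neighborhood.
Context (R : realType) (d : measure_display) (Y : measurableType d).
Variable lambda : {measure set Y -> \bar R}.
Local Notation G := (Aut lambda).
Hypothesis iso : lebesgue_like lambda.
Hypothesis infY : lambda setT = +oo%E.

Lemma image_ae (T : G) (A : set Y) : \forall x \ae lambda, (T @` A) x <-> A (T^-1 $ x).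
Proof.
apply: filterS (autKV T) => x h; rewrite -mpb_preimage_inv /=.
by rewrite -[in X in _ <-> X](mpb_funK T (T^-1 $ x)) h.
Qed.

Lemma measure_swap (A B : set Y) : measurable A -> measurable B -> lambda A = lambda B ->
  (lambda A < +oo)%E -> lambda (A `\` B) = lambda (B `\` A).
Proof.
move=> mA mB AB fA.
have e1 : lambda A = (lambda (A `\` B) + lambda (A `&` B))%E by exact: measureDI.
have e2 : lambda B = (lambda (B `\` A) + lambda (B `&` A))%E by exact: measureDI.
have fI : lambda (A `&` B) \is a fin_num.
  rewrite ge0_fin_numE//; apply: le_lt_trans fA; apply: le_measure; rewrite ?inE//; exact: measurableI.
move: AB; rewrite e1 e2 (setIC B A) => /(congr1 (fun t => t - lambda (A `&` B))%E).
by rewrite !addeK.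
Qed.

(* [e^-1(0)] is the class of the complement of a set of finite measure *)
Lemma restore_classes (e f : Y -> nat) : measurable_fun setT e -> measurable_fun setT f ->
  (forall k, lambda [set x | e x = k] = lambda [set x | f x = k]) ->
  (lambda [set x | e x <> 0%N] < +oo)%E -> lambda [set x | e x <> 0%N] = lambda [set x | f x <> 0%N] ->
  exists2 u : G, supp [set x | e x <> f x] u & \forall x \ae lambda, e (u $ x) = f x.
Proof.
move=> me mf ef fe ef0.
have mk (g : Y -> nat) k : measurable_fun setT g -> measurable [set x | g x = k].
  by move=> mg; exact: label_measurable.
have mnk (g : Y -> nat) k : measurable_fun setT g -> measurable [set x | g x <> k].
  by move=> mg; have := measurableC (mk g k mg).
pose A k := [set x | f x = k] `\` [set x | e x = k].
pose B k := [set x | e x = k] `\` [set x | f x = k].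
have mA k : measurable (A k) by apply: measurableD; exact: mk.
have mB k : measurable (B k) by apply: measurableD; exact: mk.
have sub k : (lambda [set x | e x = k.+1] < +oo)%E.
  apply: le_lt_trans fe; apply: le_measure; rewrite ?inE; [exact: mk|exact: mnk|].
  by move=> x /= ->.
have fA k : (lambda (A k) < +oo)%E.
  case: k => [|k].
    apply: le_lt_trans fe; apply: le_measure; rewrite ?inE; [exact: mA|exact: mnk|].
    by move=> x [].
  apply: le_lt_trans (sub k); rewrite ef; apply: le_measure; rewrite ?inE; [exact: mA|exact: mk|].
  by move=> x [].
(* The class of 0 has infinite measure, but its differences are those of the complements, which have
   equal finite measure. *)
have AB k : lambda (A k) = lambda (B k).
  case: k => [|k]; last first.
    by apply: measure_swap; [exact: mk|exact: mk|by rewrite ef|by rewrite -ef].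
  have := measure_swap (mnk e 0%N me) (mnk f 0%N mf) ef0 fe; congr (lambda _ = lambda _).
    by apply/seteqP; split=> x [/= h1 h2]; split => //=; apply: contrapT.
  by apply/seteqP; split=> x [/= h1 h2]; split => //=; apply: contrapT.
have /choice[U hU] k := homogeneous_fin iso infY (mA k) (mB k) (AB k) (fA k).
pose lab (g : Y -> nat) x := if e x == f x then 0%N else (g x).+1.
have mlab g : measurable_fun setT g -> measurable_fun setT (lab g).
  move=> mg; rewrite (_ : lab g = fun x => if x \in [set x | e x = f x] then 0%N else (g x).+1); last first.
    apply/funext => x; rewrite /lab; case: eqP => h; first by rewrite ifT// inE.
    by rewrite ifF//; apply/negP; rewrite inE.
  apply: measurable_label_if.
    exact: (measurable_rel eq me mf).
  move=> _ S mS; rewrite setTI; exact: (preimage_measurable (A := [set k | S k.+1]) mg).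
pose V i : G := if i is k.+1 then U k else 1.
have labE g x i : lab g x = i.+1 <-> e x <> f x /\ g x = i.
  rewrite /lab; case: eqP => h; first by split=> // -[].
  by split=> [[->]|[_ ->]].
have lab0 g x : lab g x = 0%N <-> e x = f x by rewrite /lab; case: eqP.
have [|u hu] := @aut_glue _ _ _ lambda (lab f) (lab e) V (mlab f mf) (mlab e me).
  case=> [|k] /=; first by have := aut1 lambda; apply: filterS => x ->; rewrite !lab0.
  apply: filterS (hU k) => x h; rewrite !labE; split.
    by move=> [h1 h2]; have [|/= h3 h4] := h.1; [by split => //= h3; apply: h1; rewrite h2|split => // h5; apply: h4; rewrite -h5].
  by move=> [h1 h2]; have [|/= h3 h4] := h.2; [by split => //= h3; apply: h1; rewrite h2|split => // h5; apply: h4; rewrite h5].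
exists u.
  ae_use hu; ae_use (aut1 lambda); apply: aeW => x h1 [-> _] ne.
  by rewrite (lab0 f x).2 ?h1//; apply: contrapT.
ae_use hu; ae_use (aut1 lambda); apply: aeW => x h1 [ux e1].
case E : (lab f x) ux e1 => [|k] /= ux.
  by rewrite lab0 ux h1 => ->.
by move/labE => [_ ->]; have /labE[] := E.
Qed.

Lemma split_invariant (Z : set Y) (v : G) : measurable Z ->
  (\forall x \ae lambda, Z x <-> Z (v $ x)) ->
  exists a b, [/\ supp Z a, supp (~` Z) b, v = a * b &
    \forall x \ae lambda, Z x -> a $ x = v $ x].
Proof.
move=> mZ hv; pose io x := if x \in Z then 1%N else 0%N.
have mio : measurable_fun setT io by apply: measurable_label_if.
have io1 x : Z x -> io x = 1%N by move=> Zx; rewrite /io ifT// inE.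
have io0 x : ~ Z x -> io x = 0%N by move=> nZ; rewrite /io ifF//; apply/negP; rewrite inE.
pose U i : G := if i is k.+1 then v else 1.
have [|a ha] := @aut_glue _ _ _ lambda io io U mio mio.
  case=> [|k]; first by have := aut1 lambda; apply: filterS => x /= ->.
  apply: filterS hv => x /= h; have [Zx|nZ] := pselect (Z x).
    by rewrite !io1//; exact/h.
  by rewrite !io0// => /h.
have aZ : \forall x \ae lambda, Z x -> a $ x = v $ x.
  by apply: filterS ha => x [-> _] Zx; rewrite io1.
exists a, (a^-1 * v); split => //; last by rewrite mulVKg.
  ae_use ha; ae_use (aut1 lambda); apply: aeW => x h1 [-> _] nZ.
  by rewrite io0.
ae_use aZ; ae_use (autM a^-1 v); ae_use (autVK a); apply: aeW => x h1 -> h2 /contrapT Zx.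
by rewrite -h2.
Qed.

Lemma enlarge_chart (Z0 : set Y) : measurable Z0 -> (lambda Z0 < +oo)%E ->
  exists ch : chart lambda, Z0 `<=` ch_dom ch.
Proof.
move=> mZ0 fZ0; have mC := measurableC mZ0.
(* A set of measure 1 is added because a chart has positive size and [Z0] may be null. *)
have [|B [mB BZ B1]] := @subset_measure_eq _ _ _ lambda iso _ 1%E mC lee01.
  by rewrite measure_setC_pinfty// leey.
have mZ : measurable (Z0 `|` B) by exact: measurableU.
have Z0fin : lambda Z0 \is a fin_num by rewrite ge0_fin_numE.
have ZE : lambda (Z0 `|` B) = (fine (lambda Z0) + 1)%R%:E.
  rewrite measureU//; first by rewrite [X in (_ + X)%E]B1 EFinD fineK.
  by apply/seteqP; split=> // x [Zx /BZ].
have [phi [psi hiso]] := iso mZ.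
have c0 : (0 < fine (lambda Z0) + 1)%R by rewrite ltr_wpDl// fine_ge0.
by exists (Chart mZ hiso c0 ZE); left.
Qed.

Lemma nbhs_pw_syndetic (W : set G) : sigma_finite setT lambda -> syndetic W ->
  nbhs (1 : G) (pw W 108).
Proof.
move=> sf sW; have [W1 WV _] := sW.
have [Z0 [mZ0 fZ0 hZ0]] := cofinite_subgroup iso infY sf sW.
have [ch Z0Z] := enlarge_chart mZ0 fZ0.
have mZ := ch_dom_measurable ch; set Z := ch_dom ch in Z0Z mZ.
have [m hm] := level_subgroup ch iso infY sW.
have [eps eps0 heps] := small_supports iso infY sW.
pose e x := if x \in Z then (cell ch m x).+1 else 0%N.
have eZ x : Z x -> e x = (cell ch m x).+1 by move=> Zx; rewrite /e ifT// inE.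
have e0 x : ~ Z x -> e x = 0%N by move=> nZ; rewrite /e ifF//; apply/negP; rewrite inE.
have me : measurable_fun setT e.
  rewrite (_ : e = fun x => if x \in ~` Z then 0%N else (cell ch m x).+1); last first.
    by apply/funext => x; rewrite /e in_setC; case: (x \in Z).
  apply: measurable_label_if; first exact: measurableC.
  move=> _ S mS; rewrite setTI.
  exact: (preimage_measurable (A := [set k | S k.+1]) (cell_measurable ch m)).
pose p := (2 ^ m)%N; pose E k := [set x | e x = k.+1].
have mk k : measurable [set x | e x = k] by exact: label_measurable.
have mE k : measurable (E k) by exact: mk.
have fZ : (lambda Z < +oo)%E by rewrite (ch_domE ch) ltry.
(* Dividing by [p.+1] rather than [p] keeps [p * e1 < eps] strict, as [small_supports] demands. *)
pose e1 : R := (eps / p.+1%:R)%R.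
have e10 : (0 < e1)%R by rewrite divr_gt0.
exists ([seq E k | k <- iota 0 p], e1).
  split => //= A /mapP[k _ ->]; split => //; apply: le_lt_trans fZ.
  apply: le_measure; rewrite ?inE// => x /= ex; apply: contrapT => nZ.
  by move: ex; rewrite /E /= e0.
move=> T hT; pose f x := e (T^-1 $ x).
have mf : measurable_fun setT f by apply: measurableT_comp => //; exact: mpb_measurable.
have mkf k : measurable [set x | f x = k] by exact: label_measurable.
have ef k : lambda [set x | e x = k] = lambda [set x | f x = k].
  by rewrite -(aut_preserving T^-1 (mk k)).
have mn0 : measurable [set x | e x <> 0%N] by have := measurableC (mk 0%N).
have fe : (lambda [set x | e x <> 0%N] < +oo)%E.
  apply: le_lt_trans fZ; apply: le_measure; rewrite ?inE// => x /= ex.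
  by apply: contrapT => /e0.
have ef0 : lambda [set x | e x <> 0%N] = lambda [set x | f x <> 0%N].
  by rewrite -(aut_preserving T^-1 mn0).
have [u su hu] := restore_classes me mf ef fe ef0.
have mD : measurable [set x | e x <> f x].
  exact: (measurable_rel (fun a b => a <> b) me mf).
have small : (lambda [set x | e x <> f x] < eps%:E)%E.
  apply: (@le_lt_trans _ _ (p%:R * e1)%:E); last first.
    by rewrite lte_fin /e1 mulrA ltr_pdivrMr// mulrC ltr_pM2l// ltr_nat.
  apply: (@measure_finite_cover _ _ _ lambda p (fun j => E j `+` [set x | f x = j.+1])) => //.
  - by move=> j; apply: measurable_setY.
  - move=> j jp; have := hT (E j); rewrite /= map_f ?mem_iota// => /(_ isT) /ltW.
    congr (_ <= _)%E; apply: eq_measure_ae.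
    + by apply: measurable_setY; exact: mpb_image_measurable.
    + exact: measurable_setY.
    + ae_use (image_ae T (E j)); ae_use (image_ae 1 (E j)); ae_use (aut1 lambda).
      by apply: aeW => x h1; rewrite invg1 h1 /setY /= => -> ->; rewrite /E /= /f; tauto.
  (* Where [e] and [f] differ, one of the two labels is some [k.+1], and the point lies in the
     symmetric difference for [k]; so moves in or out of [Z] are covered as well. *)
  - ae_use (cell_bound ch); ae_use (ae_map T^-1 (cell_bound ch)); apply: aeW => x h1 h2 /= ne.
    case ek : (e x) => [|k]; last first.
      have Zx : Z x by apply: contrapT => /e0; rewrite ek.
      have := ek; rewrite (eZ _ Zx) => -[ck]; exists k; first by rewrite -ck; exact: h2.
      by left; split => //= fx; apply: ne; rewrite ek fx.
    case fk : (f x) => [|k]; first by rewrite ek fk in ne.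
    have Zx : Z (T^-1 $ x) by apply: contrapT => /e0; rewrite -/(f x) fk.
    have := fk; rewrite /f (eZ _ Zx) => -[ck]; exists k; first by rewrite -ck; exact: h1.
    by right; split => //=; rewrite /E /= ek.
have wu : pw W 28 u^-1 by apply: (heps _ mD small); exact: suppV.
pose v := u * T.
have hv : \forall x \ae lambda, e (v $ x) = e x.
  ae_use (autM u T); ae_use (ae_map T hu); ae_use (autVK T); apply: aeW => x h1 h2 ->.
  by rewrite h2 /f h1.
have [|a [b [sa sb vab aZ]]] := @split_invariant Z v mZ.
  apply: filterS hv => x h; have [Zx|nZ] := pselect (Z x).
    by split=> // _; apply: contrapT => /e0; rewrite h eZ.
  by split=> // Zv; move: h; rewrite (eZ _ Zv) (e0 _ nZ).
have -> : T = u^-1 * (a * b) by rewrite -vab mulKg.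
apply: (@pwM _ _ 28 80) => //; apply: (@pwM _ _ 40 40); last first.
  by apply: hZ0; apply: suppS sb => x nZ /Z0Z.
apply: hm => //; ae_use hv; ae_use aZ; apply: aeW => z h1 h2 Zz.
have Zv : Z (v $ z) by apply: contrapT => /e0; rewrite h2 eZ.
by move: h2; rewrite h1// (eZ _ Zv) (eZ _ Zz) => -[].
Qed.

Lemma automatic_continuity_lebesgue_like : sigma_finite setT lambda ->
  automatic_continuity G.
Proof.
move=> sf; apply: (@automatic_continuity_of_syndetic G 108) => W sW.
exact: nbhs_pw_syndetic.
Qed.

End Neighborhood.

Theorem theorem1p2 (R : realType) (d : measure_display) (Y : measurableType d)
    (lambda : {measure set Y -> \bar R})
    (Y_standard : standard_borel R Y)
    (lambda_nonatomic : nonatomic lambda)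
    (lambda_sigma_finite : sigma_finite [set: Y] lambda)
    (lambda_infinite : lambda [set: Y] = +oo%E) :
  automatic_continuity (Aut lambda).
Proof.
apply: automatic_continuity_lebesgue_like => //.
exact: standard_lebesgue_like Y_standard lambda_nonatomic lambda_sigma_finite.
Qed.
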